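(* Let $G$ be a locally compact group. (i) If $G\in[\mathrm{SIN}]$ and $G$ has property (F), then $G$ is amenably tracially separated. (ii) If $G$ is totally disconnected and amenably tracially separated, then $G$ has property (F).
   Context: $[\mathrm{SIN}]$ is the class of locally compact groups having a neighbourhood base at the identity of conjugation-invariant neighbourhoods. $\mathrm{T}(G)$ is the set of continuous positive definite $u:G\to\mathbb{C}$ with $u(e)=1$ and $u(st)=u(ts)$ for all $s,t\in G$; for $u\in\mathrm{T}(G)$ put $N_u=u^{-1}(\{1\})$ and $\tilde u(s,t)=u(st^{-1})$, a positive definite function on $G\times G$. Let $\varpi=\bigoplus_{u}\pi_u^{\infty}$ be the universal representation of $G$: the direct sum, over all continuous positive definite $u$ with $u(e)=1$, of infinite ampliations of the GNS representations $\pi_u$. Let $\varpi\times\varpi$ be the representation $(s,t)\mapsto\varpi(s)\otimes\varpi(t)$ of $G\times G$, and let $\mathrm{P}_{\min}(G\times G)$ be the closure, in the topology of uniform convergence on compact sets, of the cone generated by the functions $\langle(\varpi\times\varpi)(\cdot,\cdot)\xi,\xi\rangle$, $\xi\in\mathcal{H}_\varpi\otimes\mathcal{H}_\varpi$ (it corresponds to the positive functionals on $C^*(G)\otimes_{\min}C^*(G)$). The amenable traces are $\mathrm{T}_{\mathrm{am}}(G)=\{u\in\mathrm{T}(G):\tilde u\in\mathrm{P}_{\min}(G\times G)\}$, and $G$ is amenably tracially separated if $\bigcap_{u\in\mathrm{T}_{\mathrm{am}}(G)}N_u=\{e\}$. $G$ has the factorization property, or property (F), if the left-right regular representation $\lambda\cdot\rho:G\times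 G\to \mathrm{U}(L^2(G))$, $(\lambda\cdot\rho)(s,t)h(x)=h(s^{-1}xt)\Delta(t)^{1/2}$ ($\Delta$ the modular function), satisfies $\langle(\lambda\cdot\rho)(\cdot,\cdot)h,h\rangle\in\mathrm{P}_{\min}(G\times G)$ for every $h\in L^2(G)$; i.e. $\lambda\cdot\rho$ is weakly contained in $\varpi\times\varpi$. *)

(* Defs.v *)
From HB Require Import structures.
From mathcomp Require Import all_boot all_order all_algebra.
From mathcomp Require Import sesquilinear complex.
From mathcomp Require Import all_classical all_reals all_analysis.

Set Implicit Arguments.
Unset Strict Implicit.
Unset Printing Implicit Defensive.

Import Order.TTheory GRing.Theory Num.Theory.
Import numFieldTopology.Exports numFieldNormedType.Exports.

Local Open Scope classical_set_scope.
Local Open Scope complex_scope.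
Local Open Scope ring_scope.

(* The distinguished point of [PointedTopological] plays no role; it is there
   only because [g_sigma_algebraType] (Borel sets) wants a pointed carrier. *)
HB.mixin Record isTopologicalGroup G of PointedTopological G & Group G := {
  mulg_continuous : continuous (fun p : G * G => (p.1 * p.2)%g) ;
  invg_continuous : continuous (fun x : G => (x^-1)%g) ;
}.

#[short(type="topGroupType")]
HB.structure Definition TopologicalGroup :=
  {G of PointedTopological G & Group G & isTopologicalGroup G}.

Section ProductGroup.
Variables G H : topGroupType.

Lemma prod_mulg_continuous :
  continuous (fun p : (G * H) * (G * H) => (p.1 * p.2)%g).
Proof.
have c11 : continuous (fun p : (G * H) * (G * H) => p.1.1).
  by move=> p; apply: (@continuous_comp _ _ _ fst fst); exact: cvg_fst.
have c12 : continuous (fun p : (G * H) * (G * H) => p.1.2).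
  move=> p; apply: (@continuous_comp _ _ _ fst snd);
    [exact: cvg_fst | exact: cvg_snd].
have c21 : continuous (fun p : (G * H) * (G * H) => p.2.1).
  move=> p; apply: (@continuous_comp _ _ _ snd fst);
    [exact: cvg_snd | exact: cvg_fst].
have c22 : continuous (fun p : (G * H) * (G * H) => p.2.2).
  by move=> p; apply: (@continuous_comp _ _ _ snd snd); exact: cvg_snd.
move=> p; apply: (@cvg_pair _ _ _ (nbhs p) (nbhs (p.1.1 * p.2.1)%g)
  (nbhs (p.1.2 * p.2.2)%g) _ _ _
  (fun q => (q.1.1 * q.2.1)%g) (fun q => (q.1.2 * q.2.2)%g)).
- apply: (@continuous_comp _ _ _ (fun q : (G * H) * (G * H) => (q.1.1, q.2.1))
            (fun q : G * G => (q.1 * q.2)%g)); last exact: mulg_continuous.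
  by apply: cvg_pair; [exact: c11 | exact: c21].
- apply: (@continuous_comp _ _ _ (fun q : (G * H) * (G * H) => (q.1.2, q.2.2))
            (fun q : H * H => (q.1 * q.2)%g)); last exact: mulg_continuous.
  by apply: cvg_pair; [exact: c12 | exact: c22].
Qed.

Lemma prod_invg_continuous : continuous (fun p : G * H => (p^-1)%g).
Proof.
move=> p; apply: (@cvg_pair _ _ _ (nbhs p) (nbhs (p.1^-1)%g)
  (nbhs (p.2^-1)%g) _ _ _
  (fun q => (q.1^-1)%g) (fun q => (q.2^-1)%g)).
- apply: (@continuous_comp _ _ _ fst (fun x : G => (x^-1)%g));
    [exact: cvg_fst | exact: invg_continuous].
- apply: (@continuous_comp _ _ _ snd (fun x : H => (x^-1)%g));
    [exact: cvg_snd | exact: invg_continuous].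
Qed.

HB.instance Definition _ := isTopologicalGroup.Build (G * H)%type
  prod_mulg_continuous prod_invg_continuous.

End ProductGroup.

Definition locally_compact_group (G : topGroupType) : Prop :=
  hausdorff_space G /\ locally_compact [set: G].

Definition SIN (G : topGroupType) : Prop :=
  forall U : set G, nbhs 1%g U -> exists V : set G,
    [/\ nbhs 1%g V, V `<=` U & forall s x : G, V x -> V (s * x * s^-1)%g].

Section Hilbert.
Variable R : realType.

(* [hdot] is linear in its first argument and conjugate-linear in the second *)
Record hilbert := Hilbert {
  hilbert_sort :> completeNormedModType R[i] ;
  hdot : {dot hilbert_sort for (@Num.conj R[i])} ;
  hdot_norm : forall x : hilbert_sort, `|x| ^+ 2 = hdot x x }.

Definition linear_span (V : lmodType R[i]) (A : set V) : set V :=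
  [set x | exists n (c : 'I_n -> R[i]) (a : 'I_n -> V),
     (forall i, A (a i)) /\ x = \sum_i c i *: a i].

Definition total (H : hilbert) (A : set H) : Prop :=
  closure (linear_span A) = [set: H].

Section Representations.
Variable G : topGroupType.

(* unitarity of each [rep s] is isometry plus the group law, which makes
   [rep s] bijective *)
Record unitary_rep := UnitaryRep {
  rep_space : hilbert ;
  rep :> G -> rep_space -> rep_space ;
  rep_linear : forall s, linear (rep s) ;
  rep_dot : forall s x y, hdot rep_space (rep s x) (rep s y) =
                          hdot rep_space x y ;
  rep1 : forall x, rep 1%g x = x ;
  repM : forall s t x, rep (s * t)%g x = rep s (rep t x) ;
  rep_continuous : forall x, continuous (rep^~ x) }.

Definition rep_coef (pi : unitary_rep) (xi : rep_space pi) : G -> R[i] :=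
  fun s => hdot (rep_space pi) (pi s xi) xi.

Definition positive_definite (u : G -> R[i]) : Prop :=
  forall n (s : 'I_n -> G) (c : 'I_n -> R[i]),
    0 <= \sum_i \sum_j c i * (c j)^* * u ((s j)^-1 * s i)%g.

Definition normalized_pd (u : G -> R[i]) : Prop :=
  [/\ continuous (u : G -> R[i]^o), positive_definite u & u 1%g = 1].

Definition is_GNS (u : G -> R[i]) (pi : unitary_rep) : Prop :=
  exists xi : rep_space pi,
    total [set pi s xi | s in [set: G]] /\ u = rep_coef xi.

(* [pi] is the (internal) Hilbert direct sum of copies of the [rho i] *)
Definition is_direct_sum (I : Type) (rho : I -> unitary_rep)
    (pi : unitary_rep) : Prop :=
  exists J : forall i, rep_space (rho i) -> rep_space pi,
    [/\ forall i, linear (J i),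
        forall i x y, hdot (rep_space pi) (J i x) (J i y) =
                      hdot (rep_space (rho i)) x y,
        forall i j x y, i <> j -> hdot (rep_space pi) (J i x) (J j y) = 0,
        forall i s x, J i (rho i s x) = pi s (J i x) &
        total (\bigcup_i range (J i))].

(* The factor [nat] of the index type accounts for the infinite ampliations. *)
Definition is_universal_rep (varpi : unitary_rep) : Prop :=
  exists rho : {u : G -> R[i] | normalized_pd u} -> unitary_rep,
    (forall u, is_GNS (sval u) (rho u)) /\
    is_direct_sum
      (fun k : {u : G -> R[i] | normalized_pd u} * nat => rho k.1) varpi.

End Representations.

(* [Pi] is the representation (s, t) |-> pi1 s (x) pi2 t of G1 * G2 on the
   Hilbert tensor product, with [tens x y] playing the role of x (x) y *)
Definition is_outer_tensor (G1 G2 : topGroupType) (pi1 : unitary_rep G1)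
    (pi2 : unitary_rep G2) (Pi : unitary_rep (G1 * G2)%type) : Prop :=
  exists tens :
    {bilinear rep_space pi1 -> rep_space pi2 -> rep_space Pi},
  [/\ forall x x' y y',
        hdot (rep_space Pi) (tens x y) (tens x' y') =
        hdot (rep_space pi1) x x' * hdot (rep_space pi2) y y',
      total [set tens p.1 p.2 | p in [set: rep_space pi1 * rep_space pi2]] &
      forall s t x y, Pi (s, t) (tens x y) = tens (pi1 s x) (pi2 t y)].

Definition cone_gen (T : Type) (A : set (T -> R[i])) : set (T -> R[i]) :=
  [set f | exists n (a : 'I_n -> R) (phi : 'I_n -> T -> R[i]),
     (forall i, 0 <= a i /\ A (phi i)) /\
     f = fun x => \sum_i (a i)%:C * phi i x].

End Hilbert.

Section AmenableTraces.
Variables (R : realType) (G : topGroupType).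

(* [Pi] stands for the representation varpi x varpi of G * G *)
Variable Pi : unitary_rep R (G * G)%type.

Definition Pmin : set (G * G -> R[i]) :=
  @closure {family compact, (G * G)%type -> R[i]^o}
    (cone_gen [set rep_coef xi | xi in [set: rep_space Pi]]).

Definition trace (u : G -> R[i]) : Prop :=
  normalized_pd u /\ forall s t : G, u (s * t)%g = u (t * s)%g.

Definition amenable_trace (u : G -> R[i]) : Prop :=
  trace u /\ Pmin (fun p => u (p.1 * p.2^-1)%g).

Definition amenably_tracially_separated : Prop :=
  \bigcap_(u in amenable_trace) (u @^-1` [set 1]) = [set 1%g].

End AmenableTraces.

Section RegularRepresentation.
Variables (R : realType) (G : topGroupType).

Definition borel : Type := g_sigma_algebraType (@open G).
HB.instance Definition _ := Measurable.on borel.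

Variable mu : {measure set borel -> \bar R}.

Definition left_haar_measure : Prop :=
  [/\ mu setT != 0%E,
      forall (s : G) (A : set borel), measurable A ->
        mu [set (s * x)%g | x in (A : set G)] = mu A,
      forall K : set G, compact K -> (mu K < +oo)%E,
      forall A : set borel, measurable A ->
        mu A = ereal_inf [set mu U | U in [set U : set G | open U /\ A `<=` U]] &
      forall U : set G, open U ->
        mu U = ereal_sup [set mu K | K in [set K : set G | compact K /\ K `<=` U]]].

(* The convention mu (A t) = Delta t * mu A is the one for which [left_right]
   below is isometric on L^2. *)
Definition modular_function (Delta : G -> R) : Prop :=
  forall t : G, 0 < Delta t /\
    forall A : set borel, measurable A ->
      mu [set (x * t)%g | x in (A : set G)] = ((Delta t)%:E * mu A)%E.

Definition L2 (h : G -> R[i]) : Prop :=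
  [/\ measurable_fun [set: borel] (fun x : borel => complex.Re (h x)),
      measurable_fun [set: borel] (fun x : borel => complex.Im (h x)) &
      (\int[mu]_x (complex.Re (h x) ^+ 2 + complex.Im (h x) ^+ 2)%:E
         < +oo)%E].

Definition cintegral (f : G -> R[i]) : R[i] :=
  Complex (Rintegral mu [set: borel] (fun x : borel => complex.Re (f x)))
          (Rintegral mu [set: borel] (fun x : borel => complex.Im (f x))).

Definition left_right (Delta : G -> R) (s t : G) (h : G -> R[i]) : G -> R[i] :=
  fun x => h (s^-1 * x * t)%g * (Num.sqrt (Delta t))%:C.

Definition left_right_coef (Delta : G -> R) (h : G -> R[i]) :
    G * G -> R[i] :=
  fun p => cintegral (fun x => left_right Delta p.1 p.2 h x * (h x)^*).

Definition property_F (Pi : unitary_rep R (G * G)%type) (Delta : G -> R) :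
    Prop :=
  forall h, L2 h -> Pmin Pi (left_right_coef Delta h).

End RegularRepresentation.

(* Main.v *)
(* (i) For a conjugation-invariant neighbourhood V of the identity, the group is
   unimodular and the coefficient of lambda.rho at 1_V / mu(V)^(1/2) is
   u (s t^-1) with u s = mu (sV /\ V) / mu V; property (F) makes u an amenable
   trace, and u s = 0 as soon as sV and V are disjoint.

   (ii) If u is an amenable trace, so is |(1 + u) / 2|^2, because Pmin is stable
   under products, and products of such functions give, by compactness, a trace
   v with 0 <= v <= 1 = v 1 which is bounded by some r < 1 on a given compact set
   avoiding the identity.  Let L be a compact open subgroup.  Averaging
   v^n (a s b t^-1) over a and b in L and normalising, one gets in the limit
   mu (L /\ s^-1 L t) / mu L, which is therefore in Pmin.  Its symmetry forces
   unimodularity, so it is proportional to the coefficient of lambda.rho at 1_L,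
   and combinations of the translates of the 1_L are dense in L^2. *)

(* [Pmin] is handled as the smallest closed cone containing the coefficients of [varpi2]: a fact
   about it reduces to coefficients once it is stable under sums, nonnegative scalings and uniform
   limits on compact sets. The delicate fact is stability under products. A product of two
   coefficients of [varpi2] is a coefficient of the outer tensor square of the inner tensor square
   of [varpi], and this inner square is not given inside [varpi]. It is only weakly contained in it,
   and this is proved with errors uniform over the group and for finitely many vectors at once,
   because off-diagonal coefficients occur too. In (ii), taking powers of [v] makes the values off
   [L] decay, but it also shrinks the average over [L] by which one divides. A level [rho] with
   [r < rho < 1] settles the competition: [v > rho] on a set of positive measure, so the divisor
   decays no faster than [rho ^+ n], whereas the values off [L] are at most [r ^+ n]. Averages are
   finite sums over cosets of [M], so the approximants are finite combinations of translates, and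
   Haar measure enters by counting cosets. *)
Require Import Defs.
From HB Require Import structures.
From mathcomp Require Import all_boot all_order all_algebra.
From mathcomp Require Import sesquilinear complex.
From mathcomp Require Import all_classical all_reals all_analysis.
From mathcomp Require Import measurable_realfun.
From mathcomp Require Import ring lra.

Set Implicit Arguments.
Unset Strict Implicit.
Unset Printing Implicit Defensive.

Import Order.TTheory GRing.Theory Num.Theory.
Import numFieldTopology.Exports numFieldNormedType.Exports.
Import HBSimple HBNNSimple.

Local Open Scope classical_set_scope.
Local Open Scope complex_scope.
Local Open Scope ring_scope.

(** * Moduli and Hilbert space geometry *)

Section ComplexModulus.
Variable R : realType.
Implicit Types z w : R[i].

Definition cabs z : R := complex.Re `|z|.

Lemma cabsE z : `|z| = (cabs z)%:C.
Proof. by rewrite /cabs normc_def. Qed.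

Lemma cabs_ge0 z : 0 <= cabs z.
Proof. by rewrite -lecR -cabsE normr_ge0. Qed.

Lemma cabs_le z (e : R) : (cabs z <= e) = (`|z| <= e%:C).
Proof. by rewrite cabsE lecR. Qed.

Lemma cabs_lt z (e : R) : (cabs z < e) = (`|z| < e%:C).
Proof. by rewrite cabsE ltcR. Qed.

Lemma cabsD z w : cabs (z + w) <= cabs z + cabs w.
Proof. by rewrite cabs_le rmorphD /= -!cabsE ler_normD. Qed.

Lemma cabsN z : cabs (- z) = cabs z.
Proof. by rewrite /cabs normrN. Qed.

Lemma cabsB z w : cabs (z - w) <= cabs z + cabs w.
Proof. by rewrite -(cabsN w) cabsD. Qed.

Lemma cabsC z w : cabs (z - w) = cabs (w - z).
Proof. by rewrite -cabsN opprB. Qed.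

Lemma cabsM z w : cabs (z * w) = cabs z * cabs w.
Proof. by apply: complexI; rewrite rmorphM /= -!cabsE normrM. Qed.

Lemma cabs0 : cabs (0 : R[i]) = 0.
Proof. by rewrite /cabs normr0. Qed.

Lemma cabs_real (x : R) : cabs x%:C = `|x|.
Proof. by rewrite /cabs normc_def /= expr0n addr0 sqrtr_sqr. Qed.

Lemma cabs_conj z : cabs z^* = cabs z.
Proof. by rewrite /cabs norm_conjC. Qed.

Lemma cabs_eq0 z : (cabs z == 0) = (z == 0).
Proof. by rewrite -(inj_eq (@complexI R)) -cabsE normr_eq0. Qed.

Lemma cabs_sum (I : Type) (r : seq I) (F : I -> R[i]) :
  cabs (\sum_(i <- r) F i) <= \sum_(i <- r) cabs (F i).
Proof.
rewrite cabs_le rmorph_sum /=; apply: le_trans (ler_norm_sum _ _ _) _.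
by apply: ler_sum => i _; rewrite -cabsE.
Qed.

Lemma Re_le_cabs z : complex.Re z <= cabs z.
Proof.
rewrite -lecR -cabsE; apply: le_trans (normc_ge_Re z).
by rewrite lecR ler_norm.
Qed.

Lemma cabs_sqr z : cabs z ^+ 2 = complex.Re z ^+ 2 + complex.Im z ^+ 2.
Proof. by apply: complexI; rewrite rmorphXn /= -cabsE add_Re2_Im2. Qed.

Lemma mulCconj_sqr z : z * z^* = (cabs z ^+ 2)%:C.
Proof. by rewrite -normCK cabsE rmorphXn. Qed.

Lemma ReD z w : complex.Re (z + w) = complex.Re z + complex.Re w.
Proof. by case: z w => a b [c d]. Qed.

Lemma ImD z w : complex.Im (z + w) = complex.Im z + complex.Im w.
Proof. by case: z w => a b [c d]. Qed.

Lemma ReM z w : complex.Re (z * w) =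
  complex.Re z * complex.Re w - complex.Im z * complex.Im w.
Proof. by case: z w => a b [c d]. Qed.

Lemma ImM z w : complex.Im (z * w) =
  complex.Re z * complex.Im w + complex.Im z * complex.Re w.
Proof. by case: z w => a b [c d]. Qed.

Lemma conjCE z : z^* = Complex (complex.Re z) (- complex.Im z).
Proof. by case: z. Qed.

Lemma eqC z w : complex.Re z = complex.Re w -> complex.Im z = complex.Im w ->
  z = w.
Proof. by case: z w => a b [c d] /= -> ->. Qed.

Lemma conjC_real (x : R) : (x%:C)^* = x%:C.
Proof. by rewrite conjCE /= oppr0. Qed.

End ComplexModulus.

Section HilbertGeometry.
Variables (R : realType) (H : hilbert R).
Implicit Types x y z : H.
Local Notation dot := (hdot H).

Lemma dotDl x y z : dot (x + y) z = dot x z + dot y z.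
Proof. exact: linearDl. Qed.
Lemma dotDr x y z : dot x (y + z) = dot x y + dot x z.
Proof. exact: linearDr. Qed.
Lemma dotBl x y z : dot (x - y) z = dot x z - dot y z.
Proof. exact: linearBl. Qed.
Lemma dotBr x y z : dot x (y - z) = dot x y - dot x z.
Proof. exact: linearBr. Qed.
Lemma dotZl (c : R[i]) x y : dot (c *: x) y = c * dot x y.
Proof. by rewrite linearZl_LR. Qed.
Lemma dotZr (c : R[i]) x y : dot x (c *: y) = c^* * dot x y.
Proof. by rewrite linearZr_LR. Qed.
Lemma dot0l x : dot 0 x = 0.
Proof. exact: linear0l. Qed.
Lemma dot0r x : dot x 0 = 0.
Proof. exact: linear0r. Qed.
Lemma dotC x y : dot x y = (dot y x)^*.
Proof. by rewrite hermC expr0 mul1r. Qed.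
Lemma dot_suml (I : finType) (F : I -> H) x :
  dot (\sum_i F i) x = \sum_i dot (F i) x.
Proof. by rewrite linear_sumlz. Qed.
Lemma dot_sumr (I : finType) (F : I -> H) x :
  dot x (\sum_i F i) = \sum_i dot x (F i).
Proof. by rewrite linear_sumr. Qed.

Definition hnorm x : R := complex.Re `|x|.

Lemma hnormE x : `|x| = (hnorm x)%:C.
Proof. by rewrite -(RRe_real (ger0_real (normr_ge0 x))). Qed.

Lemma hnorm_ge0 x : 0 <= hnorm x.
Proof. by rewrite -lecR -hnormE normr_ge0. Qed.

Lemma dotxx x : dot x x = (hnorm x ^+ 2)%:C.
Proof. by rewrite -hdot_norm hnormE rmorphXn. Qed.

Lemma hnormB x y : hnorm (x - y) <= hnorm x + hnorm y.
Proof. by rewrite -lecR rmorphD /= -!hnormE ler_normB. Qed.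

Lemma hnorm_eq0 x : (hnorm x == 0) = (x == 0).
Proof. by rewrite -(inj_eq (@complexI R)) -hnormE normr_eq0. Qed.

(** Pythagoras for the orthogonal projection of [x] on the line of [y]. It yields both the
    Cauchy-Schwarz inequality and the almost orthogonality in [almost_projection]. *)
Lemma hnormB_sqr x y (c : R[i]) : c = dot x y -> y != 0 ->
  hnorm (x - (c / (hnorm y ^+ 2)%:C) *: y) ^+ 2 =
  hnorm x ^+ 2 - cabs c ^+ 2 / hnorm y ^+ 2.
Proof.
move=> cE y0; apply: complexI; rewrite -dotxx rmorphB /= -!dotxx.
have N0 : dot y y != 0.
  by rewrite dotxx (inj_eq (@complexI R)) sqrf_eq0 hnorm_eq0.
have Nr : (dot y y)^* = dot y y by rewrite -dotC.
rewrite fmorph_div /= -dotxx -mulCconj_sqr !(dotBl, dotBr) !(dotZl, dotZr) -cE.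
rewrite (dotC y x) -cE rmorphM fmorphV /= Nr.
by field.
Qed.

Lemma CauchySchwarz_hdot x y : cabs (dot x y) <= hnorm x * hnorm y.
Proof.
have [->|y0] := eqVneq y 0.
  by rewrite dot0r cabs0 mulr_ge0 ?hnorm_ge0.
have := sqr_ge0 (hnorm (x - (dot x y / (hnorm y ^+ 2)%:C) *: y)).
rewrite hnormB_sqr // subr_ge0 ler_pdivrMr; last first.
  by rewrite exprn_gt0 // lt_neqAle hnorm_ge0 eq_sym hnorm_eq0 y0.
by rewrite -exprMn ler_pXn2r // nnegrE ?mulr_ge0 ?hnorm_ge0 ?cabs_ge0.
Qed.

End HilbertGeometry.

(** * The cone Pmin *)

Section ClosedCones.
Variables (R : realType) (T : topologicalType).
Implicit Types (S P : set (T -> R[i])) (f g : T -> R[i]).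

Definition compact_approx S f : Prop := forall (K : set T) (e : R),
  compact K -> 0 < e ->
  exists2 g, S g & forall p, K p -> cabs (f p - g p) < e.

Lemma closure_compact_approx S f :
  @closure {family compact, T -> R[i]^o} S f <-> compact_approx S f.
Proof.
split=> [clS K e cK e0|apS].
  have eC : (0 : R[i]) < e%:C by rewrite ltcR.
  have := @fam_nbhs T R[i]^o compact K _ f (entourage_ball R[i]^o (PosNum eC)) cK.
  move=> /clS [g [Sg fg]]; exists g => // p Kp.
  by have := fg p Kp; rewrite /ball /= cabs_lt.
(* The sets of approximants generate a proper filter that contains [S] and converges to [f], so
   every neighbourhood of [f] meets [S]. *)
pose D := [set Ke : set T * R | compact Ke.1 /\ 0 < Ke.2].
pose B (Ke : set T * R) :=
  [set g | S g /\ forall p, Ke.1 p -> cabs (f p - g p) < Ke.2].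
have FF : Filter (filter_from D B).
  apply: filter_from_filter; first by exists (set0, 1); split => //; exact: compact0.
  move=> [K e] [K' e'] [/= cK e0] [/= cK' e'0].
  exists (K `|` K', Num.min e e').
    by split => /=; [exact: compactU|rewrite lt_min e0].
  move=> g [/= Sg fg]; split; split=> //= p Kp.
    by have := fg p (or_introl Kp); rewrite lt_min => /andP[].
  by have := fg p (or_intror Kp); rewrite lt_min => /andP[].
have PF : ProperFilter (filter_from D B).
  apply: filter_from_proper => -[K e] [/= cK e0].
  by have [g Sg fg] := apS K e cK e0; exists g.
have Ff : {family compact, (filter_from D B) --> (f : T -> R[i]^o)}.
  apply/(@fam_cvgP T R[i]^o) => K cK U /uniform_nbhs[E [entE EU]].
  have [e /= e0 eE] := entE.
  have eR : 0 < complex.Re e by move: e0; rewrite ltcE /= => /andP[].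
  exists (K, complex.Re e) => // g [/= Sg fg]; apply: EU => p Kp.
  apply: eE => /=; rewrite /ball_ /=.
  have := fg p Kp; rewrite cabs_lt RRe_real //.
  exact: ger0_real (ltW e0).
move=> B' /Ff B'F; have SF : filter_from D B S.
  by exists (set0, 1); [split=> //; exact: compact0|move=> g []].
have [g [Sg Bg]] := @filter_ex _ _ PF _ (filterI SF B'F).
by exists g.
Qed.

(** Serves as an induction predicate as much as a cone: [P] is later taken to be positive
    definiteness, continuity, hermitian symmetry, or a preimage of [Pmin] itself. *)
Definition closed_cone P : Prop :=
  [/\ P (fun=> 0),
      forall f g, P f -> P g -> P (fun p => f p + g p),
      forall (a : R) f, 0 <= a -> P f -> P (fun p => a%:C * f p) &
      compact_approx P `<=` P].

Lemma closed_cone_sum P (I : Type) (r : seq I) (F : I -> T -> R[i]) :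
  closed_cone P -> (forall i, P (F i)) -> P (fun p => \sum_(i <- r) F i p).
Proof.
move=> [P0 PD _ _] PF; elim: r => [|i r IHr].
  by rewrite (_ : (fun _ => _) = fun=> 0) //; apply/funext => p; rewrite big_nil.
rewrite (_ : (fun _ => _) = fun p => F i p + \sum_(j <- r) F j p); first exact: PD.
by apply/funext => p; rewrite big_cons.
Qed.

Lemma closed_cone_closure P S : closed_cone P -> S `<=` P ->
  compact_approx (cone_gen S) `<=` P.
Proof.
move=> cP SP; have [_ _ PZ] := cP; apply: subset_trans => f apf K e cK e0.
have [_ [n [a [phi [aphi ->]]]] fg] := apf K e cK e0.
exists (fun x => \sum_i (a i)%:C * phi i x) => //.
apply: closed_cone_sum => // i; have [a0 /SP] := aphi i; exact: PZ.
Qed.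

Lemma cone_gen_sub S : S `<=` cone_gen S.
Proof.
move=> f Sf; exists 1%N, (fun=> 1), (fun=> f); split=> //.
by apply/funext => x; rewrite big_ord1 mul1r.
Qed.

Lemma cone_gen0 S : cone_gen S (fun=> 0).
Proof.
exists 0%N, (fun=> 0), (fun=> fun=> 0); split=> [[]//|].
by apply/funext => x; rewrite big_ord0.
Qed.

Lemma cone_genD S f g : cone_gen S f -> cone_gen S g ->
  cone_gen S (fun p => f p + g p).
Proof.
move=> [m [a [phi [aphi ->]]]] [n [b [psi [bpsi ->]]]].
exists (m + n)%N, (fun i => match fintype.split i with inl j => a j | inr j => b j end),
  (fun i => match fintype.split i with inl j => phi j | inr j => psi j end).
split=> [i|]; first by case: fintype.split.
apply/funext => x; rewrite big_split_ord /=; congr (_ + _); apply: eq_bigr => i _.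
  by have -> : fintype.split (lshift n i) = inl i by exact: (unsplitK (inl _ i)).
by have -> : fintype.split (rshift m i) = inr i by exact: (unsplitK (inr _ i)).
Qed.

Lemma cone_genZ S (c : R) f : 0 <= c -> cone_gen S f ->
  cone_gen S (fun p => c%:C * f p).
Proof.
move=> c0 [m [a [phi [aphi ->]]]]; exists m, (fun i => c * a i), phi.
split=> [i|]; first by have [a0 ?] := aphi i; split=> //; exact: mulr_ge0.
by apply/funext => x; rewrite mulr_sumr; apply: eq_bigr => i _; rewrite rmorphM mulrA.
Qed.

Lemma closed_cone_closure_cone S : closed_cone (compact_approx (cone_gen S)).
Proof.
split.
- by move=> K e cK e0; exists (fun=> 0) => [|p Kp]; [exact: cone_gen0|
    rewrite subr0 cabs0].
- move=> f g apf apg K e cK e0; have e2 : 0 < e / 2 by rewrite divr_gt0.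
  have [f' Sf ff'] := apf K _ cK e2; have [g' Sg gg'] := apg K _ cK e2.
  exists (fun p => f' p + g' p) => [|p Kp]; first exact: cone_genD.
  rewrite opprD addrACA; apply: le_lt_trans (cabsD _ _) _.
  by rewrite [e]splitr ltrD ?ff' ?gg'.
- move=> a f a0 apf K e cK e0.
  have a1 : 0 < a + 1 by rewrite ltr_wpDl.
  have ea : 0 < e / (a + 1) by rewrite divr_gt0.
  have [f' Sf ff'] := apf K _ cK ea.
  exists (fun p => a%:C * f' p) => [|p Kp]; first exact: cone_genZ.
  rewrite -mulrBr cabsM cabs_real ger0_norm //.
  have := ff' p Kp; rewrite ltr_pdivlMr // => /(le_lt_trans _); apply.
  by rewrite mulrC ler_wpM2l ?cabs_ge0 // lerDl.
- move=> f apf K e cK e0; have e2 : 0 < e / 2 by rewrite divr_gt0.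
  have [f' Sf ff'] := apf K _ cK e2; have [g' Sg gg'] := Sf K _ cK e2.
  exists g' => // p Kp; rewrite -(subrKA (f' p)) [e]splitr.
  by apply: le_lt_trans (cabsD _ _) _; rewrite ltrD ?ff' ?gg'.
Qed.

End ClosedCones.

Section PminCone.
Variables (R : realType) (G : topGroupType) (Pi : unitary_rep R (G * G)%type).

Lemma PminE : Pmin Pi =
  compact_approx (cone_gen [set rep_coef xi | xi in [set: rep_space Pi]]).
Proof. by apply/funext => f; apply/propext/closure_compact_approx. Qed.

Lemma Pmin_closed_cone : closed_cone (Pmin Pi).
Proof. by rewrite PminE; exact: closed_cone_closure_cone. Qed.

Lemma Pmin_coef (xi : rep_space Pi) : Pmin Pi (rep_coef xi).
Proof.
rewrite PminE => K e cK e0; exists (rep_coef xi) => [|p _].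
  by apply: cone_gen_sub; exists xi.
by rewrite subrr cabs0.
Qed.

Lemma Pmin_ind (P : set (G * G -> R[i])) : closed_cone P ->
  (forall xi : rep_space Pi, P (rep_coef xi)) -> Pmin Pi `<=` P.
Proof.
move=> cP Pcoef; rewrite PminE; apply: closed_cone_closure => //.
by move=> _ [xi _ <-].
Qed.

End PminCone.

Section SmallModulus.
Variable R : realType.

Lemma cabs_small_eq0 (z : R[i]) : (forall e : R, 0 < e -> cabs z < e) -> z = 0.
Proof.
move=> ze; apply/eqP; rewrite -cabs_eq0 eq_le cabs_ge0 andbT leNgt.
by apply/negP => z0; have := ze _ z0; rewrite ltxx.
Qed.

(** The order of [R[i]] demands a zero imaginary part. Each approximant [w] has one, so the
    imaginary part of [z] and the negative part of its real part are smaller than every [e]. *)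
Lemma ge0_of_approx (z : R[i]) :
  (forall e : R, 0 < e -> exists2 w, 0 <= w & cabs (z - w) < e) -> 0 <= z.
Proof.
move=> zw.
have key (e : R) : 0 < e -> `|complex.Im z| < e /\ - e < complex.Re z.
  move=> e0; have [w] := zw _ e0; rewrite lecE /= => /andP[/eqP w0 w1] zwe.
  have := Re_le_cabs (w - z); have := cabs_sqr (z - w); rewrite cabsC in zwe *.
  rewrite !ReD ImD; case: z w {zw} w0 w1 zwe => a b [c d] /= -> c0.
  have := cabs_ge0 ((c +i* 0) - (a +i* b)); move: (cabs _) => m m0 me mE ca.
  split; last by lra.
  rewrite oppr0 addr0 in mE; apply: le_lt_trans me.
  rewrite -(@ler_pXn2r _ 2) ?nnegrE ?normr_ge0 //.
  by rewrite real_normK ?num_real // mE lerDr sqr_ge0.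
rewrite lecE /=; apply/andP; split.
  rewrite -normr_eq0 eq_le normr_ge0 andbT leNgt; apply/negP => z0.
  by have [] := key _ z0; rewrite ltxx.
rewrite leNgt; apply/negP => z0.
have z0' : 0 < - complex.Re z by rewrite oppr_gt0.
by have [] := key _ z0'; rewrite opprK ltxx.
Qed.

Lemma continuous_cabsP (T : topologicalType) (f : T -> R[i]) :
  continuous (f : T -> R[i]^o) <->
  forall x (e : R), 0 < e -> \forall y \near x, cabs (f x - f y) < e.
Proof.
split=> [cf x e e0|cf x].
  have eC : (0 : R[i]) < e%:C by rewrite ltcR.
  have /(@cvgrPdist_lt _ R[i]^o) /(_ _ eC) := cf x.
  by move/filterS; apply => y; rewrite cabs_lt.
apply/(@cvgrPdist_lt _ R[i]^o) => e e0.
have eR : 0 < complex.Re e by move: e0; rewrite ltcE /= => /andP[].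
move: (cf x _ eR) => /filterS; apply => y; rewrite cabs_lt RRe_real //.
exact: ger0_real (ltW e0).
Qed.

End SmallModulus.

Section ClosedConePreimage.
Variables (R : realType) (X Y : topologicalType).
Variable F : (X -> R[i]) -> Y -> R[i].
Hypothesis FD : forall f g, F (fun p => f p + g p) = fun q => F f q + F g q.
Hypothesis FZ : forall (a : R) f, F (fun p => a%:C * f p) = fun q => a%:C * F f q.
Hypothesis Fbounded : forall K : set Y, compact K -> exists (K' : set X) (C : R),
  [/\ compact K', 0 <= C & forall f (e : R), 0 <= e ->
    (forall p, K' p -> cabs (f p) <= e) -> forall q, K q -> cabs (F f q) <= C * e].

(** The section hypotheses say that [F] is real linear and continuous for uniform convergence on
    compact sets, so it pulls closed cones back to closed cones. *)
Lemma closed_cone_preimage (P : set (Y -> R[i])) :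
  closed_cone P -> closed_cone (F @^-1` P).
Proof.
have FB f g q : F f q - F g q = F (fun p => f p - g p) q.
  have -> : (fun p => f p - g p) = fun p => f p + (-1)%:C * g p.
    by apply/funext => p; rewrite rmorphN1 mulN1r.
  by rewrite FD FZ rmorphN1 mulN1r.
move=> [P0 PD PZ Pap]; split.
- rewrite /preimage /= (_ : (fun=> 0) = fun p => 0%:C * 0); last first.
    by apply/funext => p; rewrite mul0r.
  rewrite FZ (_ : (fun _ => _) = fun=> 0) //.
  by apply/funext => q; rewrite mul0r.
- by move=> f g Pf Pg; rewrite /preimage /= FD; exact: PD.
- by move=> a f a0 Pf; rewrite /preimage /= FZ; exact: PZ.
- move=> f apf; apply: Pap => K e cK e0.
  have [K' [C [cK' C0 FC]]] := Fbounded cK.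
  have C1 : 0 < C + 1 by rewrite ltr_wpDl.
  have eC : 0 < e / (C + 1) by rewrite divr_gt0.
  have [g Pg fg] := apf K' _ cK' eC; exists (F g) => // q Kq.
  rewrite FB; apply: le_lt_trans (FC _ (e / (C + 1)) (ltW eC) _ q Kq) _.
    by move=> p /fg /ltW.
  by rewrite mulrA ltr_pdivrMr // mulrC ltr_pM2l // ltrDl.
Qed.

End ClosedConePreimage.

Section PminProperties.
Variables (R : realType) (G : topGroupType).

Lemma rep_dotV (pi : unitary_rep R G) s (x y : rep_space pi) :
  hdot _ (pi s x) y = hdot _ x (pi (s^-1)%g y).
Proof. by rewrite -(rep_dot s^-1%g) -repM mulVg rep1. Qed.

Lemma repB (pi : unitary_rep R G) s (x y : rep_space pi) :
  pi s (x - y) = pi s x - pi s y.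
Proof.
by have := rep_linear s (-1) y x; rewrite !scaleN1r (addrC (- y)) => ->; exact: addrC.
Qed.

Lemma rep0 (pi : unitary_rep R G) s : pi s 0 = 0.
Proof. by have := repB s (0 : rep_space pi) 0; rewrite !subrr. Qed.

Lemma repD (pi : unitary_rep R G) s (x y : rep_space pi) :
  pi s (x + y) = pi s x + pi s y.
Proof. by have := rep_linear s 1 x y; rewrite !scale1r. Qed.

Lemma repZ (pi : unitary_rep R G) s (c : R[i]) (x : rep_space pi) :
  pi s (c *: x) = c *: pi s x.
Proof. by have := rep_linear s c x 0; rewrite !addr0 rep0 addr0. Qed.

Lemma rep_sum (pi : unitary_rep R G) s (I : Type) (r : seq I)
  (F : I -> rep_space pi) : pi s (\sum_(i <- r) F i) = \sum_(i <- r) pi s (F i).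
Proof.
by elim: r => [|i r IHr]; rewrite ?big_nil ?rep0 // !big_cons repD IHr.
Qed.

Lemma rep_hnorm (pi : unitary_rep R G) s (x : rep_space pi) :
  hnorm (pi s x) = hnorm x.
Proof.
have : hnorm (pi s x) ^+ 2 = hnorm x ^+ 2.
  by apply: complexI; rewrite -!dotxx rep_dot.
by move/eqP; rewrite eqrXn2 ?hnorm_ge0 // => /eqP.
Qed.

Lemma coef_le (pi : unitary_rep R G) s (x y : rep_space pi) :
  cabs (hdot _ (pi s x) y) <= hnorm x * hnorm y.
Proof. by rewrite (le_trans (CauchySchwarz_hdot _ _)) // rep_hnorm. Qed.

Lemma coef_continuous (pi : unitary_rep R G) (x y : rep_space pi) :
  continuous ((fun s => hdot _ (pi s x) y) : G -> R[i]^o).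
Proof.
apply/continuous_cabsP => s e e0.
have y1 : 0 < hnorm y + 1 by rewrite ltr_wpDl ?hnorm_ge0.
have ey : (0 : R[i]) < (e / (hnorm y + 1))%:C by rewrite ltcR divr_gt0.
have /cvgrPdist_lt /(_ _ ey) := @rep_continuous _ _ pi x s.
move/filterS; apply => t; rewrite hnormE ltcR ltr_pdivlMr // => st.
rewrite -dotBl; apply: le_lt_trans (CauchySchwarz_hdot _ _) _.
by apply: le_lt_trans st; rewrite ler_wpM2l ?hnorm_ge0 // lerDl.
Qed.

Lemma coef_pd (pi : unitary_rep R G) (x : rep_space pi) :
  positive_definite (rep_coef x).
Proof.
move=> n s c; rewrite /rep_coef.
suff -> : \sum_i \sum_j c i * (c j)^* * hdot _ (pi ((s j)^-1 * s i)%g x) x =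
  hdot _ (\sum_i c i *: pi (s i) x) (\sum_i c i *: pi (s i) x).
  by rewrite dotxx lecR sqr_ge0.
rewrite dot_suml; apply: eq_bigr => i _; rewrite dot_sumr; apply: eq_bigr => j _.
by rewrite dotZl dotZr mulrA repM rep_dotV invgK.
Qed.

(** Each inequality involves finitely many points, and a finite set is compact, so uniform
    approximation on compact sets passes it to the limit. *)
Lemma closed_cone_pd : closed_cone (@positive_definite R G).
Proof.
split.
- move=> n s c; rewrite big1 // => i _; rewrite big1 // => j _.
  by rewrite mulr0.
- move=> f g pf pg n s c; have := addr_ge0 (pf n s c) (pg n s c).
  rewrite -big_split /=; congr (0 <= _); apply: eq_bigr => i _.
  by rewrite -big_split; apply: eq_bigr => j _; rewrite mulrDr.
- move=> a f a0 pf n s c; have aC : 0 <= a%:C :> R[i] by rewrite lecR.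
  have := mulr_ge0 aC (pf n s c).
  rewrite mulr_sumr; congr (0 <= _); apply: eq_bigr => i _.
  by rewrite mulr_sumr; apply: eq_bigr => j _; rewrite mulrCA.
- move=> f apf n s c; apply: ge0_of_approx => e e0.
  pose C := \sum_i \sum_j cabs (c i * (c j)^*) : R.
  have C0 : 0 <= C by apply: sumr_ge0 => i _; apply: sumr_ge0 => j _; exact: cabs_ge0.
  have C1 : 0 < C + 1 by rewrite ltr_wpDl.
  have eC : 0 < e / (C + 1) by rewrite divr_gt0.
  pose K := [set ((s ij.2)^-1 * s ij.1)%g | ij in [set: 'I_n * 'I_n]].
  have cK : compact K by apply: finite_compact; apply: finite_image; exact: finite_finset.
  have [g pg fg] := apf K _ cK eC.
  exists (\sum_i \sum_j c i * (c j)^* * g ((s j)^-1 * s i)%g); first exact: pg.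
  apply: (@le_lt_trans _ _ (C * (e / (C + 1)))); last first.
    by rewrite mulrA ltr_pdivrMr // mulrC ltr_pM2l // ltrDl.
  rewrite -sumrB mulr_suml; apply: le_trans (cabs_sum _ _) _; apply: ler_sum => i _.
  rewrite -sumrB mulr_suml; apply: le_trans (cabs_sum _ _) _; apply: ler_sum => j _.
  rewrite -mulrBr [leLHS]cabsM; apply: ler_wpM2l; first exact: cabs_ge0.
  apply/ltW/fg.
  by exists (i, j).
Qed.

Lemma closed_cone_hermitian :
  closed_cone [set f : G -> R[i] | forall p, f (p^-1)%g = (f p)^*].
Proof.
split.
- by move=> p; rewrite conjC0.
- by move=> f g hf hg p; rewrite rmorphD hf hg.
- by move=> a f a0 hf p; rewrite rmorphM hf; congr (_ * _); rewrite [RHS]conjC_real.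
- move=> f apf p; apply/eqP; rewrite -subr_eq0; apply/eqP/cabs_small_eq0 => e e0.
  have e2 : 0 < e / 2 by rewrite divr_gt0.
  have cK : compact [set p; p^-1%g] by apply: compactU; exact: compact_set1.
  have [g hg fg] := apf _ _ cK e2.
  rewrite -(subrKA (g p^-1%g)) {2}hg -rmorphB /= [e]splitr.
  apply: le_lt_trans (cabsD _ _) _; rewrite cabs_conj ltrD ?fg //=; first by right.
  by rewrite cabsC fg //; left.
Qed.

Definition compact_nbhs_base (T : topologicalType) : Prop :=
  forall x : T, exists2 K : set T, nbhs x K & compact K.

Lemma locally_compact_compact_nbhs : locally_compact_group G ->
  compact_nbhs_base G.
Proof.
move=> [hG lcG] x; have [K xK [cK _]] := lcG x I; exists K => //.
by apply: (@filterS _ (nbhs x) _ _ _ _ xK) => y; apply.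
Qed.

Lemma compact_nbhs_base_prod (X Y : topologicalType) : compact_nbhs_base X ->
  compact_nbhs_base Y -> compact_nbhs_base (X * Y)%type.
Proof.
move=> bX bY [x y]; have [K xK cK] := bX x; have [L yL cL] := bY y.
by exists (K `*` L); [exists (K, L)|exact: compact_setX].
Qed.

(** A compact neighbourhood of each point turns uniform convergence on compact sets into local
    uniform convergence, which preserves continuity. *)
Lemma closed_cone_continuous : compact_nbhs_base G ->
  closed_cone [set f : G -> R[i] | continuous (f : G -> R[i]^o)].
Proof.
move=> bG; split => /=.
- by move=> p; exact: cvg_cst.
- by move=> f g cf cg p; apply: (@cvgD _ R[i]^o); [exact: cf|exact: cg].
- move=> a f a0 cf p; apply: (@cvgM R[i]^o); [exact: cvg_cst|exact: cf].
- move=> f apf; apply/continuous_cabsP => x e e0.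
  have e3 : 0 < e / 3 by rewrite divr_gt0.
  have [K xK cK] := bG x.
  have [g /continuous_cabsP cg fg] := apf _ _ cK e3.
  near=> y.
  have Ky : K y by near: y.
  have Kx : K x by exact: nbhs_singleton.
  have gxy : cabs (g x - g y) < e / 3 by near: y; exact: cg.
  have := cabsD (f x - g x) (g x - f y); rewrite subrKA => /le_lt_trans; apply.
  have := cabsD (g x - g y) (g y - f y); rewrite subrKA => gf.
  have := fg y Ky; rewrite cabsC => fgy; have := fg x Kx; lra.
Unshelve. all: by end_near. Qed.

End PminProperties.

(** * Weak containment of unitary representations in the universal one *)

Section AlmostProjection.
Variables (R : realType) (H : hilbert R).

(* Avoids completeness: a vector [p] of [V] almost realising the distance from
   [w] to [V] makes [w - p] almost orthogonal to [V]. *)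
Lemma almost_projection (V : set H) (w : H) (d : R) :
  V 0 -> (forall c x y, V x -> V y -> V (x + c *: y)) -> 0 < d ->
  exists p, [/\ V p, hnorm p <= 2 * hnorm w + 1 &
    forall v, V v -> cabs (hdot H (w - p) v) <= d * hnorm v].
Proof.
move=> V0 VD d0.
pose A := [set hnorm (w - p) ^+ 2 | p in V].
have A0 : A (hnorm w ^+ 2) by exists 0; rewrite ?subr0.
have lA : has_lbound A by exists 0 => _ [p _ <-]; exact: sqr_ge0.
have infA : has_inf A by split=> //; exists (hnorm w ^+ 2).
have d1 : 0 < Num.min 1 (d ^+ 2) by rewrite lt_min ltr01 exprn_gt0.
have [_ [p Vp <-] pd] := inf_adherent d1 infA.
have pA x : A x -> hnorm (w - p) ^+ 2 < x + Num.min 1 (d ^+ 2).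
  by move=> Ax; apply: lt_le_trans pd _; rewrite lerD2r; exact: ge_inf.
exists p; split=> // [|v Vv].
  have := pA _ A0; rewrite minEle => wp.
  have {}wp : hnorm (w - p) ^+ 2 <= (hnorm w + 1) ^+ 2.
    have : hnorm (w - p) ^+ 2 < hnorm w ^+ 2 + 1.
      by apply: lt_le_trans wp _; rewrite lerD2l; case: ifP => // /negbT; rewrite -ltNge => /ltW.
    by have := hnorm_ge0 w; nra.
  rewrite ler_pXn2r ?nnegrE ?addr_ge0 ?hnorm_ge0 // in wp.
  have := hnormB w (w - p); rewrite opprB addrC subrK.
  by move: wp; set a := hnorm (w - p); set b := hnorm p; set c := hnorm w; lra.
have [->|v0] := eqVneq v 0.
  by rewrite dot0r cabs0 mulr_ge0 ?hnorm_ge0 // ltW.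
set c := hdot H (w - p) v.
have Vq : V (p + (c / (hnorm v ^+ 2)%:C) *: v) by exact: VD.
have := pA _ (imageP _ Vq).
rewrite opprD addrA (hnormB_sqr (erefl c)) //.
have v1 : 0 < hnorm v by rewrite lt_neqAle hnorm_ge0 eq_sym hnorm_eq0 v0.
have m1 : Num.min 1 (d ^+ 2) <= d ^+ 2 by rewrite ge_min lexx orbT.
move=> wp; have {}wp : cabs c ^+ 2 / hnorm v ^+ 2 <= d ^+ 2.
  by move: wp m1; set m := Num.min _ _; set x := _ / _; set y := hnorm _ ^+ 2; lra.
rewrite ler_pdivrMr ?exprn_gt0 // -exprMn in wp.
by rewrite ler_pXn2r ?nnegrE ?cabs_ge0 ?mulr_ge0 ?(ltW d0) ?hnorm_ge0 // in wp.
Qed.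

End AlmostProjection.

Section OrbitPairs.
Variables (R : realType) (G : topGroupType) (sigma tau : unitary_rep R G).
Variables (a : rep_space sigma) (b : rep_space tau).
Hypothesis ab : forall s, hdot _ (sigma s a) a = hdot _ (tau s b) b.

(** The graph of the intertwiner between the linear spans of the orbits of [a] and [b]. With a
    relation there is no well-definedness to prove; [orbit_pair_dot] says that it is isometric. *)
Inductive orbit_pair : rep_space sigma -> rep_space tau -> Prop :=
| orbit_pair0 : orbit_pair 0 0
| orbit_pairD c s x y : orbit_pair x y ->
    orbit_pair (c *: sigma s a + x) (c *: tau s b + y).

Lemma orbit_pair_gen : orbit_pair a b.
Proof.
by have := orbit_pairD 1 1%g orbit_pair0; rewrite !scale1r !addr0 !rep1.
Qed.

Lemma orbit_pair_lin c x y x' y' : orbit_pair x y -> orbit_pair x' y' ->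
  orbit_pair (x' + c *: x) (y' + c *: y).
Proof.
move=> xy x'y'; elim: xy => [|d s {}x {}y _ IH]; first by rewrite !scaler0 !addr0.
by rewrite !scalerDr !scalerA !addrA -!(addrC (_ *: _) x', addrC (_ *: _) y')
  -!addrA; exact: orbit_pairD.
Qed.

Lemma orbit_pair_rep s x y : orbit_pair x y -> orbit_pair (sigma s x) (tau s y).
Proof.
elim=> [|c t {}x {}y _ IH]; first by rewrite !rep0; exact: orbit_pair0.
by rewrite !repD !repZ -!repM; exact: orbit_pairD.
Qed.

(** A double induction reduces both sides to the coefficients at [t^-1 * s], where [ab] applies. *)
Lemma orbit_pair_dot x y x' y' : orbit_pair x y -> orbit_pair x' y' ->
  hdot _ x x' = hdot _ y y'.
Proof.
move=> xy; elim=> [|c t {}x' {}y' _ IH]; first by rewrite !dot0r.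
rewrite !dotDr !dotZr IH; congr (_ * _ + _).
elim: xy => [|d s {IH}x {}y _ IH]; first by rewrite !dot0l.
rewrite !dotDl !dotZl IH; congr (_ * _ + _).
by rewrite -[t]invgK -!rep_dotV -!repM.
Qed.

End OrbitPairs.

Section UniversalApproximation.
Variables (R : realType) (G : topGroupType) (varpi : unitary_rep R G).
Hypothesis varpi_universal : is_universal_rep varpi.

Lemma universal_coef (u : G -> R[i]) : normalized_pd u ->
  exists xi : rep_space varpi, u = rep_coef xi.
Proof.
move=> nu; have [rho [gns [J [_ Jdot _ Jrep _]]]] := varpi_universal.
have [xi [_ uxi]] := gns (exist _ u nu).
exists (J (exist _ u nu, 0%N) xi); rewrite [LHS]uxi; apply/funext => s.
by rewrite /rep_coef -Jrep Jdot.
Qed.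

(** Vectors leave the support of [w] one at a time. The orbit span of [w a] is copied into a GNS
    summand of [varpi]; each [w k] is split into a vector of that span and a remainder nearly
    orthogonal to it, and the remainders are treated by induction. The error is uniform over the
    whole group, not merely on compact sets. *)
Lemma universal_approx (sigma : unitary_rep R G) (I : finType)
    (w : I -> rep_space sigma) (e : R) : 0 < e ->
  exists z : I -> rep_space varpi, forall s k l,
    cabs (hdot _ (sigma s (w k)) (w l) - hdot _ (varpi s (z k)) (z l)) < e.
Proof.
move=> e0; have [rho [gns [J [Jlin Jdot Jorth Jrep _]]]] := varpi_universal.
have J0 i : J i 0 = 0.
  have := Jlin i 1 0 0; rewrite !scale1r addr0 => /(congr1 (fun x => x - J i 0)).
  by rewrite subrr addrK => <-.
pose level n (x : rep_space varpi) := forall u k (y : rep_space (rho u)),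
  (k < n)%N -> hdot _ (J (u, k) y) x = 0.
(* The induction leaves the copies of index < N of the ampliation free, so that
   the two pieces of each [z k] are orthogonal. *)
suff main (S : seq I) : forall w e N, 0 < e -> (forall k, k \notin S -> w k = 0) ->
  exists z : I -> rep_space varpi, (forall k, level N (z k)) /\ forall s k l,
    cabs (hdot _ (sigma s (w k)) (w l) - hdot _ (varpi s (z k)) (z l)) < e.
  have [k|z [_ zP]] := main (enum I) w e 0%N e0; last by exists z.
  by rewrite mem_enum inE.
elim: S => [|a S IH] {e0}w {}e N e0 wS.
  exists (fun=> 0); split=> [k u n y _|s k l]; first by rewrite dot0r.
  by rewrite !wS // !dot0r subr0 cabs0.
have [wa0|wa0] := eqVneq (w a) 0.
  apply: IH => // k kS; have [->//|ka] := eqVneq k a.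
  by apply: wS; rewrite inE negb_or ka.
have wa1 : hdot _ (w a) (w a) != 0.
  by rewrite dotxx (inj_eq (@complexI R)) sqrf_eq0 hnorm_eq0.
(* The summands of [varpi] are indexed by functions with value 1 at the identity; the factor in [b]
   undoes this normalisation. *)
pose b0 := (hnorm (w a))^-1%:C *: w a.
pose u := rep_coef b0.
have nu : normalized_pd u.
  split; [exact: coef_continuous|exact: coef_pd|].
  rewrite /u /rep_coef rep1 dotZl dotZr dotxx conjC_real -!rmorphM.
  rewrite (_ : _ * _ = 1) //; field.
  by rewrite hnorm_eq0.
have [xi [_ uxi]] := gns (exist _ u nu).
pose j := (exist _ u nu : {u : G -> R[i] | normalized_pd u}, N).
pose b := (hnorm (w a))%:C *: J j xi.
have ab s : hdot _ (sigma s (w a)) (w a) = hdot _ (varpi s b) b.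
  have uxis : hdot _ (rho j.1 s xi) xi = hdot _ (sigma s b0) b0.
    exact: esym (congr1 (fun f => f s) uxi).
  rewrite /b repZ dotZl dotZr -Jrep Jdot uxis /b0 repZ dotZl dotZr !mulrA.
  rewrite !conjC_real -!rmorphM (_ : _ * _ * _ * _ = 1) ?mul1r //; field.
  by rewrite hnorm_eq0.
pose opair := orbit_pair (w a) b.
have opairJ x y : opair x y -> exists y0, y = J j y0.
  elim=> [|c s {}x {}y _ [y0 ->]]; first by exists 0; rewrite J0.
  exists ((c * (hnorm (w a))%:C) *: rho j.1 s xi + y0).
  by rewrite Jlin repZ scalerA Jrep.
pose B := \sum_k hnorm (w k).
have wB k : hnorm (w k) <= B.
  by rewrite /B (bigD1 k) //= lerDl sumr_ge0 // => *; exact: hnorm_ge0.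
have B0 : 0 <= B by apply: sumr_ge0 => *; exact: hnorm_ge0.
(* Each of the two cross terms is at most [d] times the bound [2 * B + 1] on the projected vectors,
   that is [e / 4]; the remainders take the other [e / 2]. *)
pose d := e / 4 / (2 * B + 1).
have d0 : 0 < d by rewrite !divr_gt0 // ltr_wpDl ?mulr_ge0.
have d1 : d * (2 * B + 1) = e / 4 by rewrite mulfVK // gt_eqF // ltr_wpDl ?mulr_ge0.
have /choice[py pyP] k : exists py, [/\ opair py.1 py.2, hnorm py.1 <= 2 * B + 1,
    (k \notin S -> w k = py.1) & forall x y, opair x y ->
    cabs (hdot _ (w k - py.1) x) <= d * hnorm x].
  have [kS|kS] := boolP (k \in S).
    pose V := [set x | exists y, opair x y].
    have V0 : V 0 by exists 0; exact: orbit_pair0.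
    have VD c x x' : V x -> V x' -> V (x + c *: x').
      by move=> [y xy] [y' x'y']; exists (y + c *: y'); exact: orbit_pair_lin.
    have [p [[y py] pw pv]] := almost_projection (w k) V0 VD d0.
    exists (p, y); split=> //= [|x x' xx']; first by have := wB k; lra.
    by apply: pv; exists x'.
  (* Outside [S] the vector is [w a] or 0, hence already in the orbit span: its remainder vanishes
     and the support shrinks to [S]. *)
  exists (w k, if k == a then b else 0); split=> //=.
  - case: eqP => [->|/eqP ka]; first exact: orbit_pair_gen.
    by rewrite wS ?inE ?negb_or ?ka //; exact: orbit_pair0.
  - by have := wB k; have := hnorm_ge0 (w k); lra.
  - by move=> x y _; rewrite subrr dot0l cabs0 mulr_ge0 ?hnorm_ge0 // ltW.
have [q qE] : exists q, forall k, q k = w k - (py k).1.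
  by exists (fun k => w k - (py k).1).
have e2 : 0 < e / 2 by rewrite divr_gt0.
have [k kS|z [zN zP]] := IH q (e / 2) N.+1 e2.
  by rewrite qE; have [_ _ -> //] := pyP k; rewrite subrr.
exists (fun k => (py k).2 + z k); split=> [k u' n y nN|s k l].
  have [/opairJ[y0 ->] _ _ _] := pyP k.
  rewrite dotDr zN ?addr0; last exact: ltnW.
  by apply: Jorth => -[_ nE]; rewrite nE ltnn in nN.
have [pk pkB _ qk] := pyP k; have [pl plB _ ql] := pyP l.
rewrite -qE in qk; rewrite -qE in ql.
have wE m : w m = (py m).1 + q m by rewrite qE addrC subrK.
have [yk ykE] := opairJ _ _ pk; have [yl ylE] := opairJ _ _ pl.
have o1 : hdot _ (varpi s (py k).2) (z l) = 0.
  by rewrite ykE -Jrep; apply: zN.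
have o2 : hdot _ (varpi s (z k)) (py l).2 = 0.
  by rewrite rep_dotV ylE -Jrep dotC zN // conjC0.
rewrite {1}(wE k) {1}(wE l) !repD !dotDl !dotDr o1 o2 addr0 add0r.
rewrite (orbit_pair_dot ab (orbit_pair_rep s pk) pl).
have b1 : cabs (hdot _ (sigma s (py k).1) (q l)) <= e / 4.
  rewrite dotC cabs_conj; apply: le_trans (ql _ _ (orbit_pair_rep s pk)) _.
  by rewrite rep_hnorm -d1 ler_pM2l.
have b2 : cabs (hdot _ (sigma s (q k)) (py l).1) <= e / 4.
  rewrite rep_dotV; apply: le_trans (qk _ _ (orbit_pair_rep _ pl)) _.
  by rewrite rep_hnorm -d1 ler_pM2l.
have b3 := zP s k l.
set x1 := hdot _ (varpi s (py k).2) _ in b1 b2 b3 *.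
move: b1 b2 b3; set x2 := hdot _ _ _; set x3 := hdot _ _ _.
set x4 := hdot _ _ _; set x5 := hdot _ _ _ => b1 b2 b3.
have -> : x1 + x2 + (x3 + x4) - (x1 + x5) = (x4 - x5) + (x2 + x3) by ring.
have := cabsD (x4 - x5) (x2 + x3); have := cabsD x2 x3; lra.
Qed.

End UniversalApproximation.

(** * Stability properties of Pmin *)

Section ContinuousGroupOperations.
Variables (T : topologicalType) (G : topGroupType) (f g : T -> G).

Lemma continuous_mulg : continuous f -> continuous g ->
  continuous (fun x => (f x * g x)%g).
Proof.
move=> cf cg x.
apply: (@continuous_comp _ _ _ (fun x => (f x, g x)) (fun p => (p.1 * p.2)%g)).
  by apply: cvg_pair; [exact: cf|exact: cg].
exact: mulg_continuous.
Qed.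

Lemma continuous_invg : continuous f -> continuous (fun x => (f x)^-1%g).
Proof.
move=> cf x; apply: (@continuous_comp _ _ _ f (fun y => y^-1%g)); first exact: cf.
exact: invg_continuous.
Qed.

End ContinuousGroupOperations.

Section PminAlgebra.
Variables (R : realType) (G : topGroupType) (varpi : unitary_rep R G).
Hypothesis varpi_universal : is_universal_rep varpi.
Variable varpi2 : unitary_rep R (G * G)%type.

(** This operation sends the coefficient at [xi] to the coefficient at
    [\sum_i c i *: varpi2 (g i) xi], and it is continuous for uniform convergence on compact
    sets. *)
Lemma Pmin_translate (I : finType) (g : I -> G * G) (c : I -> R[i]) f :
  Pmin varpi2 f ->
  Pmin varpi2 (fun p => \sum_i \sum_j c i * (c j)^* * f ((g j)^-1 * p * g i)%g).
Proof.
pose F (f : G * G -> R[i]) p :=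
  \sum_i \sum_j c i * (c j)^* * f ((g j)^-1 * p * g i)%g.
suff FP : Pmin varpi2 `<=` F @^-1` Pmin varpi2 by move=> /FP.
clear f.
apply: Pmin_ind.
  apply: closed_cone_preimage; last exact: Pmin_closed_cone.
  - move=> f h; apply/funext => q; rewrite /F -big_split; apply: eq_bigr => i _.
    by rewrite -big_split; apply: eq_bigr => j _; rewrite mulrDr.
  - move=> a f; apply/funext => q; rewrite /F mulr_sumr; apply: eq_bigr => i _.
    by rewrite mulr_sumr; apply: eq_bigr => j _; rewrite mulrCA.
  - move=> K cK.
    exists (\big[setU/set0]_(ij : I * I) ((fun p => (g ij.2)^-1 * p * g ij.1)%g @` K)).
    exists (\sum_i \sum_j cabs (c i * (c j)^*)); split.
    + apply: bigsetU_compact => ij _; apply: continuous_compact; last exact: cK.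
      apply: continuous_subspaceT; apply: continuous_mulg; last exact: cst_continuous.
      by apply: continuous_mulg; [exact: cst_continuous|move=> ?; exact: cvg_id].
    + by apply: sumr_ge0 => i _; apply: sumr_ge0 => j _; exact: cabs_ge0.
    + move=> f e e0 fe q Kq; rewrite mulr_suml.
      apply: le_trans (cabs_sum _ _) _; apply: ler_sum => i _; rewrite mulr_suml.
      apply: le_trans (cabs_sum _ _) _; apply: ler_sum => j _.
      rewrite [leLHS]cabsM; apply: ler_wpM2l; first exact: cabs_ge0.
      apply: fe; rewrite -bigcup_seq; exists (i, j) => /=; first exact: mem_index_enum.
      by exists q.
move=> xi; rewrite /preimage /=.
rewrite (_ : F _ = rep_coef (\sum_i c i *: varpi2 (g i) xi)); first exact: Pmin_coef.
apply/funext => p; rewrite /F /rep_coef rep_sum dot_suml; apply: eq_bigr => i _.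
rewrite dot_sumr; apply: eq_bigr => j _; rewrite repZ dotZl dotZr mulrA.
by rewrite repM repM rep_dotV invgK.
Qed.

Hypothesis varpi2_tensor : is_outer_tensor varpi varpi varpi2.

(** Finite sums of elementary tensors are dense, and a coefficient depends continuously on its
    vector, uniformly over the group; so it is enough to test [P] on such sums. *)
Lemma Pmin_ind_tensor (P : set (G * G -> R[i])) : closed_cone P ->
  (forall (I : finType) (x y : I -> rep_space varpi),
    P (fun p => \sum_k \sum_l
      hdot _ (varpi p.1 (x k)) (x l) * hdot _ (varpi p.2 (y k)) (y l))) ->
  Pmin varpi2 `<=` P.
Proof.
move=> cP PT; have [tens [tdot tot trep]] := varpi2_tensor.
apply: Pmin_ind => // xi; have [_ _ _ Pap] := cP; apply: Pap => K e cK e0.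
(* The coefficients at [xi] and [z] differ by at most [|xi - z| (|xi| + |z|)], and [d <= 1] gives
   [|z| < |xi| + 1]. *)
pose d := Num.min 1 (e / (2 * hnorm xi + 2)).
have d0 : 0 < d.
  by rewrite lt_min ltr01 divr_gt0 // ltr_wpDl ?mulr_ge0 ?hnorm_ge0.
have dC : (0 : R[i]) < d%:C by rewrite ltcR.
have : closure (linear_span [set tens p.1 p.2 |
    p in [set: rep_space varpi * rep_space varpi]]) xi by rewrite tot.
move=> /(_ _ (nbhsx_ballx xi _ dC)) [zeta [[n [c [a [aT ->]]]]]].
rewrite -ball_normE /= hnormE ltcR => xid.
have /choice[xy xyP] i : exists xy, a i = tens xy.1 xy.2.
  by have [xy _ <-] := aT i; exists xy.
pose x i := c i *: (xy i).1; pose y i := (xy i).2.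
have zE : \sum_i c i *: a i = \sum_i tens (x i) (y i).
  by apply: eq_bigr => i _; rewrite xyP /x linearZl_LR.
rewrite zE in xid; exists (rep_coef (\sum_i tens (x i) (y i))).
  have := PT _ x y; congr (P _); apply/funext => -[s t] /=.
  rewrite /rep_coef rep_sum dot_suml; apply: eq_bigr => k _.
  by rewrite dot_sumr; apply: eq_bigr => l _; rewrite trep tdot.
move=> p _; set z := \sum_i _ in xid *.
have -> : rep_coef xi p - rep_coef z p =
    hdot _ (varpi2 p (xi - z)) xi + hdot _ (varpi2 p z) (xi - z).
  by rewrite repB dotBl dotBr /rep_coef; ring.
have zb : hnorm z < hnorm xi + 1.
  have := hnormB xi (xi - z); rewrite subKr => /le_lt_trans; apply.
  by rewrite ltrD2l; move: xid; rewrite lt_min => /andP[].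
have {}xid : hnorm (xi - z) * (2 * hnorm xi + 2) < e.
  rewrite -ltr_pdivlMr; last by rewrite ltr_wpDl ?mulr_ge0 ?hnorm_ge0.
  by move: xid; rewrite lt_min => /andP[].
apply: le_lt_trans (cabsD _ _) _.
have := coef_le p (xi - z) xi; have := coef_le p z (xi - z).
have := hnorm_ge0 (xi - z); have := hnorm_ge0 xi; nra.
Qed.

(** On sums of elementary tensors the flip exchanges the two families of vectors, so no flip unitary
    on [varpi2] has to be constructed. *)
Lemma Pmin_flip f : Pmin varpi2 f -> Pmin varpi2 (fun p => f (p.2, p.1)).
Proof.
pose F (f : G * G -> R[i]) p := f (p.2, p.1).
suff FP : Pmin varpi2 `<=` F @^-1` Pmin varpi2 by move=> /FP.
clear f.
apply: Pmin_ind_tensor.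
  apply: closed_cone_preimage => //; last exact: Pmin_closed_cone.
  move=> K cK; exists [set (p.2, p.1) | p in K], 1; split=> // [|f e e0 fe q Kq].
    apply: continuous_compact; last exact: cK.
      apply: continuous_subspaceT => p.
    by apply: cvg_pair; [exact: cvg_snd|exact: cvg_fst].
  by rewrite mul1r; apply: fe; exists q.
move=> I x y; rewrite /preimage /=.
have [tens [tdot _ trep]] := varpi2_tensor.
rewrite (_ : F _ = rep_coef (\sum_i tens (y i) (x i))); first exact: Pmin_coef.
apply/funext => -[s t]; rewrite /F /rep_coef rep_sum dot_suml; apply: eq_bigr => k _.
by rewrite dot_sumr; apply: eq_bigr => l _; rewrite trep tdot mulrC.
Qed.

Lemma Pmin_one : Pmin varpi2 (fun=> 1).
Proof.
have [tens [tdot _ trep]] := varpi2_tensor.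
have n1 : normalized_pd ((fun=> 1) : G -> R[i]).
  split=> // [x|n s c]; first exact: cvg_cst.
  rewrite (_ : \sum_i _ = (\sum_i c i) * (\sum_i c i)^*).
    by rewrite mulCconj_sqr lecR sqr_ge0.
  rewrite mulr_suml; apply: eq_bigr => i _; rewrite rmorph_sum mulr_sumr.
  by apply: eq_bigr => j _; rewrite mulr1.
have [xi xiE] := universal_coef varpi_universal n1.
have := @Pmin_coef _ _ varpi2 (tens xi xi); congr (Pmin _ _); apply/funext => -[s t].
rewrite /rep_coef trep tdot.
have xi1 r : hdot _ (varpi r xi) xi = 1 by exact: esym (congr1 (fun f => f r) xiE).
by rewrite !xi1 mulr1.
Qed.

(** This bound makes multiplication by a member of [Pmin] continuous for uniform convergence on
    compact sets, as [Pmin_mul] requires. *)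
Lemma Pmin_bounded f (K : set (G * G)) : Pmin varpi2 f -> compact K ->
  exists2 C, 0 <= C & forall p, K p -> cabs (f p) <= C.
Proof.
move=> + cK; suff bP : Pmin varpi2 `<=`
    [set f | exists2 C, 0 <= C & forall p, K p -> cabs (f p) <= C] by move=> /bP.
clear f.
apply: Pmin_ind.
  split.
  - by exists 0 => // p _; rewrite cabs0.
  - move=> f g [C C0 fC] [D D0 gD]; exists (C + D) => [|p Kp]; first exact: addr_ge0.
    by rewrite (le_trans (cabsD _ _)) // lerD ?fC ?gD.
  - move=> a f a0 [C C0 fC]; exists (a * C) => [|p Kp]; first exact: mulr_ge0.
    by rewrite cabsM cabs_real ger0_norm // ler_wpM2l // fC.
  - move=> f /(_ K 1 cK ltr01) [g [C C0 gC] fg].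
    exists (1 + C) => [|p Kp]; first exact: addr_ge0.
    by rewrite -(subrK (g p) (f p)) (le_trans (cabsD _ _)) // lerD ?gC ?ltW ?fg.
move=> xi; exists (hnorm xi * hnorm xi) => [|p _]; last exact: coef_le.
by rewrite mulr_ge0 ?hnorm_ge0.
Qed.

(** The inner tensor square of [varpi]: products of coefficients of [varpi] are coefficients of this
    representation. *)
Definition diagonal_rep : unitary_rep R G :=
  @UnitaryRep R G (rep_space varpi2) (fun s => varpi2 (s, s))
    (fun s => rep_linear (s, s)) (fun s => rep_dot (s, s)) (@rep1 _ _ varpi2)
    (fun s t => repM (s, s) (t, t))
    (fun x s => continuous_comp (cvg_pair cvg_id cvg_id)
       (@rep_continuous _ _ varpi2 x (s, s))).

(** The product is built from coefficients of the inner tensor square, at the vectors [X] in one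
    variable and [Y] in the other. [universal_approx] replaces both families by vectors of [varpi],
    whose tensors live in [varpi2]. *)
Lemma Pmin_mul_tensor (I J : finType) (x y : I -> rep_space varpi)
    (x' y' : J -> rep_space varpi) :
  Pmin varpi2 (fun p =>
    (\sum_k \sum_l hdot _ (varpi p.1 (x k)) (x l) * hdot _ (varpi p.2 (y k)) (y l)) *
    (\sum_k \sum_l hdot _ (varpi p.1 (x' k)) (x' l) * hdot _ (varpi p.2 (y' k)) (y' l))).
Proof.
have [tens [tdot _ trep]] := varpi2_tensor.
pose X (k : I * J) : rep_space diagonal_rep := tens (x k.1) (x' k.2).
pose Y (k : I * J) : rep_space diagonal_rep := tens (y k.1) (y' k.2).
have -> : (fun p : G * G =>
    (\sum_k \sum_l hdot _ (varpi p.1 (x k)) (x l) * hdot _ (varpi p.2 (y k)) (y l)) *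
    (\sum_k \sum_l hdot _ (varpi p.1 (x' k)) (x' l) * hdot _ (varpi p.2 (y' k)) (y' l)))
  = fun p => \sum_k \sum_l hdot _ (diagonal_rep p.1 (X k)) (X l) *
       hdot _ (diagonal_rep p.2 (Y k)) (Y l).
  apply/funext => -[s t] /=; rewrite big_distrlr /= pair_bigA; apply: eq_bigr => -[k k'] _.
  rewrite big_distrlr /= pair_bigA; apply: eq_bigr => -[l l'] _.
  by rewrite /X /Y /= !trep !tdot; ring.
have [_ _ _ Pap] := Pmin_closed_cone varpi2; apply: Pap => K e cK e0.
pose B := \sum_k (hnorm (X k) + hnorm (Y k)).
have XB k : hnorm (X k) <= B.
  rewrite /B (bigD1 k) //= -addrA lerDl addr_ge0 ?hnorm_ge0 // sumr_ge0 // => *.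
  by rewrite addr_ge0 ?hnorm_ge0.
have YB k : hnorm (Y k) <= B.
  rewrite /B (bigD1 k) //= -addrA addrCA lerDl addr_ge0 ?hnorm_ge0 // sumr_ge0 // => *.
  by rewrite addr_ge0 ?hnorm_ge0.
have B0 : 0 <= B by apply: sumr_ge0 => *; rewrite addr_ge0 ?hnorm_ge0.
pose N : R := #|{: (I * J)}|%:R.
have N0 : 0 <= N by rewrite ler0n.
(* Each of the [N * N] products has two factors bounded by [B ^+ 2] and moving by less than
   [d <= 1], so it moves by at most [(2 * B ^+ 2 + 1) * d]. *)
pose D := N * N * (2 * B ^+ 2 + 1).
have D0 : 0 <= D by rewrite !mulr_ge0 // addr_ge0 // mulr_ge0 // sqr_ge0.
pose d := Num.min 1 (e / (D + 1)).
have d0 : 0 < d by rewrite lt_min ltr01 divr_gt0 // ltr_wpDl.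
have [z zP] := universal_approx varpi_universal X d0.
have [z' z'P] := universal_approx varpi_universal Y d0.
exists (rep_coef (\sum_k tens (z k) (z' k))) => [|[s t] _]; first exact: Pmin_coef.
rewrite /rep_coef rep_sum dot_suml -sumrB.
have d1 : d <= 1 by rewrite ge_min lexx.
have De : D * d < e.
  have : d <= e / (D + 1) by rewrite ge_min lexx orbT.
  rewrite ler_pdivlMr ?ltr_wpDl // => /(lt_le_trans _); apply.
  by rewrite mulrC ltr_pM2l // ltrDl.
apply: le_lt_trans De; apply: le_trans (cabs_sum _ _) _.
have -> : D * d = \sum_(k : I * J) \sum_(l : I * J) (2 * B ^+ 2 + 1) * d.
  have sumN (a : R) : \sum_(k : I * J) a = N * a by rewrite sumr_const mulr_natl.
  by rewrite !sumN /D; ring.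
apply: ler_sum => k _; rewrite dot_sumr -sumrB.
apply: le_trans (cabs_sum _ _) _; apply: ler_sum => l _; rewrite trep tdot.
have := zP s k l; have := z'P t k l.
have : cabs (hdot _ (diagonal_rep s (X k)) (X l)) <= B ^+ 2.
  by apply: le_trans (coef_le _ _ _) _; rewrite expr2 ler_pM ?hnorm_ge0.
have : cabs (hdot _ (diagonal_rep t (Y k)) (Y l)) <= B ^+ 2.
  by apply: le_trans (coef_le _ _ _) _; rewrite expr2 ler_pM ?hnorm_ge0.
rewrite /=; move: (hdot _ _ (X l)) (hdot _ _ (Y l)) (hdot _ _ (z l)) (hdot _ _ (z' l)).
move=> u v u' v' vB uB vv' uu'.
have -> : u * v - u' * v' = (u - u') * v + u * (v - v') - (u - u') * (v - v').
  by ring.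
have := cabsB ((u - u') * v + u * (v - v')) ((u - u') * (v - v')).
have := cabsD ((u - u') * v) (u * (v - v')); rewrite !cabsM.
have := cabs_ge0 (u - u'); have := cabs_ge0 (v - v').
have := cabs_ge0 u; have := cabs_ge0 v.
move: (cabs u) (cabs v) (cabs (u - u')) (cabs (v - v'))
  uu' vv' uB vB => a b c c' cd c'd aB bB b0 a0 c'0 c0 fle gle.
have h1 : c * b <= d * B ^+ 2 by apply: ler_pM => //; exact: ltW.
have h2 : a * c' <= B ^+ 2 * d by apply: ler_pM => //; exact: ltW.
have h3 : c * c' <= d * 1.
  by apply: ler_pM => //; apply: ltW => //; exact: lt_le_trans d1.
by apply: le_trans gle _; apply: le_trans (lerD fle (lexx _)) _; lra.
Qed.

(** The product is linear and continuous in each factor, so [Pmin_ind_tensor] is applied to one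
    factor at a time, the other being held fixed. *)
Lemma Pmin_mul f g : Pmin varpi2 f -> Pmin varpi2 g ->
  Pmin varpi2 (fun p => f p * g p).
Proof.
have cmul g' : Pmin varpi2 g' ->
    closed_cone ((fun f p => f p * g' p) @^-1` Pmin varpi2).
  move=> Pg; apply: closed_cone_preimage; last exact: Pmin_closed_cone.
  - by move=> f1 f2; apply/funext => p; rewrite mulrDl.
  - by move=> a f1; apply/funext => p; rewrite mulrA.
  - move=> K cK; have [C C0 gC] := Pmin_bounded Pg cK.
    exists K, C; split=> // h e e0 he q Kq; rewrite cabsM mulrC.
    by rewrite ler_pM ?cabs_ge0 ?gC ?he.
move=> Pf Pg; move: f Pf; apply: (Pmin_ind_tensor (cmul _ Pg)) => I x y.
rewrite /preimage /=; pose A p := \sum_k \sum_l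
  hdot _ (varpi p.1 (x k)) (x l) * hdot _ (varpi p.2 (y k)) (y l).
suff : Pmin varpi2 (fun p => g p * A p).
  by congr (Pmin _ _); apply/funext => p; rewrite mulrC.
have PA : Pmin varpi2 A.
  have [tens [tdot _ trep]] := varpi2_tensor.
  have := @Pmin_coef _ _ varpi2 (\sum_k tens (x k) (y k)); congr (Pmin _ _).
  apply/funext => -[s t]; rewrite /rep_coef rep_sum dot_suml; apply: eq_bigr => k _.
  by rewrite dot_sumr; apply: eq_bigr => l _; rewrite trep tdot.
suff gP : Pmin varpi2 `<=` (fun f p => f p * A p) @^-1` Pmin varpi2 by exact: gP.
apply: (Pmin_ind_tensor (cmul _ PA)) => J x' y'; exact: Pmin_mul_tensor.
Qed.

End PminAlgebra.

(** * Compact open subgroups *)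

Section CompactSets.
Variable T : topologicalType.

Lemma near_compact (X : topologicalType) (K : set X) (t : T) (P : T -> X -> Prop) :
  compact K -> (forall k, K k -> \forall z \near (k, t), P z.2 z.1) ->
  \forall y \near t, forall k, K k -> P y k.
Proof.
move=> /compact_near_coveringP cK KP.
exact: (cK _ (nbhs t) P _ KP).
Qed.

(** The finite intersection property for a downward directed family: if every [F i] met [K], the
    intersections would generate a proper filter, and a cluster point in [K] would lie in all the
    closed sets [F i]. *)
Lemma compact_directed (I : Type) (D : set I) (F : I -> set T) (K : set T) :
  compact K -> D !=set0 -> (forall i, D i -> closed (F i)) ->
  (forall i j, D i -> D j -> exists2 k, D k & F k `<=` F i `&` F j) ->
  (forall p, K p -> exists2 i, D i & ~ F i p) ->
  exists2 i, D i & forall p, K p -> ~ F i p.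
Proof.
move=> cK [i0 Di0] clF dirF KF; apply: contrapT => noi.
have KFi i : D i -> exists2 p, K p & F i p.
  move=> Di; apply: contrapT => nop; apply: noi; exists i => // p Kp Fp.
  by apply: nop; exists p.
pose B i := K `&` F i.
have FF : ProperFilter (filter_from D B).
  apply: filter_from_proper => [|i Di]; last by have [p ? ?] := KFi i Di; exists p.
  apply: filter_from_filter; first by exists i0.
  move=> i j Di Dj; have [k Dk kij] := dirF i j Di Dj; exists k => // p [Kp /kij[Fi Fj]].
  by split; split.
have [|p [Kp clp]] := cK _ FF; first by exists i0 => // p [].
have [i Di nFi] := KF p Kp; apply: nFi; apply: (clF i Di).
move=> V Vp; have [|q [[Kq Fq] Vq]] := clp (B i) V _ Vp.
  by exists i.
by exists q.
Qed.

Lemma hausdorff_compact_separation (A B : set T) : hausdorff_space T ->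
  compact A -> compact B -> A `&` B `<=` set0 ->
  exists U V : set T, [/\ open U, open V, A `<=` U, B `<=` V & U `&` V = set0].
Proof.
move=> hT cA cB AB0; rewrite open_hausdorff in hT.
(* Used twice: with the neighbourhoods of a point of [B], to separate it from [A]; then with the
   neighbourhoods of [A], to separate [A] from [B]. *)
have key (FA : set (set T)) (K : set T) : compact K -> Filter FA ->
    (forall b, K b -> exists V W, [/\ open V, V b, FA W & V `&` W = set0]) ->
    exists2 W, FA W & K `<=` ~` closure W.
  move=> cK fFA KV.
  apply: (@compact_directed _ FA closure K) => //.
  - by exists setT; exact: filterT.
  - by move=> W _; exact: closed_closure.
  - move=> W W' FW FW'; exists (W `&` W'); [exact: filterI|exact: closureI].
  - move=> b /KV[V [W [oV Vb FW VW0]]]; exists W => // /(_ V (open_nbhs_nbhs (conj oV Vb))).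
    by rewrite setIC VW0 => -[].
pose FA := [set W | exists2 U, open U /\ A `<=` U & U `<=` W].
have fFA : Filter FA.
  split; first by exists setT => //; split=> //; exact: openT.
  - move=> P Q [U [oU AU] UP] [V [oV AV] VQ]; exists (U `&` V).
      by split; [exact: openI|move=> a Aa; split; [exact: AU|exact: AV]].
    by move=> a [/UP ? /VQ].
  - by move=> P Q PQ [U oU UP]; exists U => //; exact: subset_trans PQ.
have [b Bb|W [U [oU AU] UW] BW] := key FA B cB fFA.
  have [a Aa|W Wb AW] := key (nbhs b) A cA _.
    have ab : a != b by apply/eqP => ab; apply: (AB0 a); split=> //; rewrite ab.
    have [[U V] /= [] /[!inE] Ua Vb [oU oV UV0]] := hT a b ab.
    by exists U, V; split => //; exact: open_nbhs_nbhs.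
  exists (W°), (~` closure W); split=> //; first exact: open_interior.
    by exists (~` closure W) => //; split=> //; apply/closed_openC/closed_closure.
  apply/seteqP; split=> // x [/interior_subset Wx] []; exact: subset_closure.
exists U, (~` closure W); split=> //; first by apply/closed_openC/closed_closure.
by apply/seteqP; split=> // x [/UW Wx] []; exact: subset_closure.
Qed.

(* The intersection of the relatively clopen subsets of [C] containing [x] is
   connected, hence reduced to [x]. *)
Lemma totally_disconnected_clopen (x : T) (U C : set T) : hausdorff_space T ->
  totally_disconnected [set: T] -> compact C -> nbhs x C -> nbhs x U ->
  exists K, [/\ compact K, open K, K x & K `<=` U].
Proof.
move=> hT tdT cC xC xU; have clC := compact_closed hT cC.
pose D := [set K : set T | [/\ closed K, closed (C `\` K), K `<=` C & K x]].
have Cx : C x by exact: nbhs_singleton.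
have D0 : D !=set0.
  by exists C; split=> //; rewrite setDv; exact: closed0.
have clD K : D K -> closed K by case.
have dirD K K' : D K -> D K' -> exists2 K'', D K'' & K'' `<=` K `&` K'.
  move=> [cK cCK KC Kx] [cK' cCK' K'C K'x]; exists (K `&` K') => //.
  split=> //; [exact: closedI| |by move=> y [/KC]].
  by rewrite setDIr; exact: closedU.
pose Q := \bigcap_(K in D) K.
have QC : Q `<=` C.
  by have [K DK] := D0; move=> y /(_ K DK); case: DK => _ _ + _; exact.
have clQ : closed Q by exact: closed_bigI.
have cQ : compact Q by exact: subclosed_compact cC QC.
have splitQ A B : closed A -> closed B -> A `&` B `<=` set0 -> Q = A `|` B -> A x ->
    Q `<=` A.
  move=> clA clB AB0 QAB Ax.
  have cA : compact A by apply: subclosed_compact cQ _ => //; rewrite QAB; exact: subsetUl.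
  have cB : compact B by apply: subclosed_compact cQ _ => //; rewrite QAB; exact: subsetUr.
  have [U1 [V1 [oO oV AO BV OV0]]] := hausdorff_compact_separation hT cA cB AB0.
  have cCO : compact (C `\` (U1 `|` V1)).
    apply: subclosed_compact cC _; last by move=> y [].
    by rewrite setDE; apply: closedI => //; apply/open_closedC/openU.
  have [p [Cp nOV]|K DK KOV] := compact_directed cCO D0 clD dirD.
    apply: contrapT => nK; apply: nOV; have : Q p.
      by move=> K DK; apply: contrapT => nKp; apply: nK; exists K.
    by rewrite QAB => -[/AO|/BV]; [left|right].
  have [cK cCK KC Kx] := DK.
  have KOV' y : K y -> U1 y \/ V1 y.
    by move=> Ky; apply: contrapT => nOV; apply: (KOV y) => //; split=> //; exact: KC.
  (* [U1] and [V1] are disjoint and cover [K], so cutting with [U1] is removing [V1]; this keeps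
     both the piece and its complement in [C] closed. *)
  have KO : K `&` U1 = K `\` V1.
    apply/seteqP; split=> y [Ky] => [Oy|nVy]; split=> //.
      by move=> Vy; have : (U1 `&` V1) y by []; rewrite OV0.
    by case: (KOV' y Ky).
  have DKO : D (K `&` U1).
    split.
    - by rewrite KO setDE; apply: closedI => //; exact: open_closedC.
    - rewrite setDIr; apply: closedU => //.
      by rewrite setDE; apply: closedI => //; exact: open_closedC.
    - by move=> y [/KC].
    - by split=> //; exact: AO.
  move=> y Qy; have [_ Oy] := Qy _ DKO; move: Qy; rewrite QAB => -[//|/BV Vy].
  by have : (U1 `&` V1) y by []; rewrite OV0.
have conQ : connected Q.
  move=> B B0 [U1 oU1 BU1] [F clF BF].
  have clB : closed B by rewrite BF; exact: closedI.
  have clQB : closed (Q `\` B).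
    rewrite (_ : _ `\` _ = Q `&` ~` U1); first by apply: closedI => //; exact: open_closedC.
    by rewrite BU1; apply/seteqP; split=> y [Qy] nU1; split=> //; [move=> U1y; apply: nU1|case].
  have QB : Q = B `|` Q `\` B.
    apply/seteqP; split=> y; last by case=> [|[]//]; rewrite BU1 => -[].
    by move=> Qy; have [By|nBy] := pselect (B y); [left|right].
  have Qx : Q x by move=> K [].
  have [Bx|nBx] := pselect (B x).
    apply/seteqP; split; first by rewrite BU1 => y [].
    by apply: splitQ clB clQB _ QB Bx => y [? []].
  have : Q `<=` Q `\` B.
    apply: splitQ clQB clB _ _ _ => //; first by move=> y [[]].
    by rewrite setUC.
  by have [b Bb] := B0; move=> /(_ b); rewrite {1}QB => /(_ (or_introl Bb)) [].
have Q1 : Q `<=` [set x].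
  rewrite -(tdT x I); apply: connected_component_max => // K; by case.
(* Members of [D] are clopen only relative to [C]; one lying in the interior of [C] is open in the
   whole space. *)
have cCU : compact (C `\` (C° `&` U°)).
  apply: subclosed_compact cC _; last by move=> y [].
  by rewrite setDE; apply: closedI => //; apply/open_closedC/openI; exact: open_interior.
have [p [Cp nU]|K DK KU] := compact_directed cCU D0 clD dirD.
  apply: contrapT => nK; apply: nU; have /Q1 -> : Q p.
    by move=> K DK; apply: contrapT => nKp; apply: nK; exists K.
  by split.
have [cK cCK KC Kx] := DK.
have KCU y : K y -> (C° `&` U°) y.
  by move=> Ky; apply: contrapT => nOV; apply: (KU y) => //; split=> //; exact: KC.
exists K; split=> //; last by move=> y /KCU[_ /interior_subset].
  exact: subclosed_compact KC.
rewrite (_ : K = C° `\` (C `\` K)).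
  by rewrite setDE; apply: openI; [exact: open_interior|exact: closed_openC].
apply/seteqP; split=> y.
  by move=> Ky; have [Cy _] := KCU _ Ky; split=> // -[_]; exact.
by move=> [/interior_subset Cy nCK]; apply: contrapT => nK; apply: nCK.
Qed.

End CompactSets.

Section OpenSubgroups.
Variable G : topGroupType.
Implicit Types L M : set G.

Definition subgroup L : Prop :=
  [/\ L 1%g, forall x y, L x -> L y -> L (x * y)%g & forall x, L x -> L (x^-1)%g].

Definition compact_open_subgroup L : Prop := [/\ subgroup L, open L & compact L].

Lemma subgroupMr L x y : subgroup L -> L y -> L (x * y)%g <-> L x.
Proof.
move=> [L1 LM LV] Ly; split=> [xy|Lx]; last exact: LM.
by rewrite -(mulgK y x); apply: LM => //; exact: LV.
Qed.

Lemma open_preimage_mulg (x y : G) (U : set G) : open U ->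
  open [set z | U (x * z * y)%g].
Proof.
move=> oU; apply: (@open_comp _ _ (fun z => (x * z * y)%g)) => // z _.
apply: continuous_mulg; last exact: cst_continuous.
by apply: continuous_mulg => [|?]; [exact: cst_continuous|exact: cvg_id].
Qed.

Lemma open_preimage_mulgl (x : G) (U : set G) : open U ->
  open [set z | U (x * z)%g].
Proof.
by move=> /(open_preimage_mulg x 1%g); congr open; apply/funext => z; rewrite /= mulg1.
Qed.

Lemma right_invariant_open M (A : set G) : nbhs 1%g M ->
  (forall x m, A x -> M m -> A (x * m)%g) -> open A.
Proof.
move=> oM AM; rewrite openE => x Ax; rewrite /interior.
have : nbhs x [set z | M° (x^-1 * z * 1)%g].
  apply: open_nbhs_nbhs; split; last by rewrite /= mulg1 mulVg.
  by apply: open_preimage_mulg; exact: open_interior.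
apply: filterS => y; rewrite /= mulg1 => /interior_subset Mxy.
by rewrite -(mulVKg x y); exact: AM.
Qed.

Lemma subgroup_nbhs_open L : subgroup L -> nbhs 1%g L -> open L.
Proof.
move=> [_ LM _] nL; apply: (@right_invariant_open L) => // x m; exact: LM.
Qed.

Lemma subgroup_open_closed L : subgroup L -> open L -> closed L.
Proof.
move=> sL oL; have [L1 _ _] := sL; rewrite -[L]setCK; apply/open_closedC.
apply: (@right_invariant_open L) => [|x m nLx Lm]; first exact: open_nbhs_nbhs.
by move/(subgroupMr x sL Lm).
Qed.

(** The subgroup is the stabiliser under right translation of a compact open neighbourhood [K] of
    the identity. It is a neighbourhood of the identity because [K] is compact and open, and it lies
    in [K] because [K] contains the identity. *)
Lemma van_dantzig : hausdorff_space G -> compact_nbhs_base G ->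
  totally_disconnected [set: G] -> forall U, nbhs 1%g U ->
  exists2 L, compact_open_subgroup L & L `<=` U.
Proof.
move=> hG bG tdG U U1; have [C nC cC] := bG 1%g.
have [K [cK oK K1 KU]] := totally_disconnected_clopen hG tdG cC nC U1.
pose S := [set x | forall k, K k -> K (k * x)%g].
pose L := [set x | S x /\ S (x^-1)%g].
have nS : nbhs 1%g S.
  apply: (near_compact cK) => k Kk; apply: mulg_continuous => /=.
  by rewrite mulg1; exact: open_nbhs_nbhs.
have nL : nbhs 1%g L.
  apply: filterI => //; have /(_ S) := @invg_continuous G 1%g; rewrite invg1; exact.
have sL : subgroup L.
  split=> [|x y [Sx Sx'] [Sy Sy']|x [Sx Sx']].
  - by split=> k; rewrite ?invg1 mulg1.
  - split=> k Kk; first by rewrite mulgA; exact: Sy (Sx _ _).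
    by rewrite invgM mulgA; exact: Sx' (Sy' _ _).
  - by split; rewrite ?invgK.
have LK : L `<=` K by move=> x [/(_ 1%g K1)]; rewrite mul1g.
have oL : open L by exact: subgroup_nbhs_open.
exists L; last exact: subset_trans KU.
split=> //; apply: subclosed_compact cK LK; exact: subgroup_open_closed.
Qed.

(** [M] is the intersection of the conjugates of a small compact open subgroup by elements of [L];
    compactness of [L] keeps this intersection a neighbourhood of the identity. *)
Lemma normal_open_subgroup L U : hausdorff_space G -> compact_nbhs_base G ->
  totally_disconnected [set: G] -> compact_open_subgroup L -> nbhs 1%g U ->
  exists M, [/\ compact_open_subgroup M, M `<=` L, M `<=` U &
    forall l m, L l -> M m -> M (l^-1 * m * l)%g].
Proof.
move=> hG bG tdG [sL oL cL] nU; have [L1 LM LV] := sL.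
have [|M0 [sM0 oM0 cM0] M0U] := van_dantzig hG bG tdG (U := U `&` L).
  by apply: filterI => //; exact: open_nbhs_nbhs.
have [M01 M0M M0V] := sM0.
pose M := [set x | forall l, L l -> M0 (l^-1 * x * l)%g].
have MM0 : M `<=` M0 by move=> x /(_ 1%g L1); rewrite invg1 mul1g mulg1.
have nM : nbhs 1%g M.
  apply: (near_compact cL) => l Ll.
  have : continuous (fun z : G * G => (z.1^-1 * z.2 * z.1)%g).
    apply: continuous_mulg; last by move=> ?; exact: cvg_fst.
    apply: continuous_mulg; last by move=> ?; exact: cvg_snd.
    by apply: continuous_invg => ?; exact: cvg_fst.
  move=> /(_ (l, 1%g)) /(_ M0); rewrite /= mulg1 mulVg; apply.
  exact: open_nbhs_nbhs.
have sM : subgroup M.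
  split=> [l Ll|x y Mx My l Ll|x Mx l Ll].
  - by rewrite mulg1 mulVg.
  - rewrite (_ : _ * _ = (l^-1 * x * l) * (l^-1 * y * l))%g; first by apply: M0M; auto.
    by rewrite !mulgA mulgK.
  - rewrite (_ : _ * _ = (l^-1 * x * l)^-1)%g; first by apply: M0V; auto.
    by rewrite !invgM invgK mulgA.
have oM : open M by exact: subgroup_nbhs_open.
exists M; split.
- split=> //; apply: subclosed_compact cM0 MM0; exact: subgroup_open_closed.
- by move=> x /MM0/M0U[].
- by move=> x /MM0/M0U[].
- move=> l m Ll Mm k Lk; rewrite (_ : _ * _ = (l * k)^-1 * m * (l * k))%g.
    by apply: Mm; exact: LM.
  by rewrite invgM !mulgA.
Qed.

(** A finite subcover by cosets may repeat some of them. Repetitions are pruned along the covering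
    list, so that counting representatives counts cosets exactly. *)
Lemma coset_representatives M (K : set G) : subgroup M -> open M -> compact K ->
  exists (n : nat) (x : 'I_n -> G), [/\ forall i, K (x i),
    forall y, K y -> exists i, M ((x i)^-1 * y)%g &
    forall i j, M ((x i)^-1 * x j)%g -> i = j].
Proof.
move=> sM oM; have [M1 MM MV] := sM; rewrite compact_cover => cK.
have [| |D KD DK] := cK G K (fun x => [set y | M (x^-1 * y)%g]).
- move=> x _; exact: open_preimage_mulgl.
- by move=> y Ky; exists y => //=; rewrite mulVg.
suff [s [sK sD sM']] : exists s : seq G, [/\ forall x, x \in s -> K x,
    forall y, K y -> exists2 x, x \in s & M (x^-1 * y)%g &
    forall i j, (i < size s)%N -> (j < size s)%N ->
      M ((nth 1%g s i)^-1 * nth 1%g s j)%g -> i = j].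
  exists (size s), (fun i => nth 1%g s i); split=> [i|y /sD[x xs xy]|i j ij].
  - by apply: sK; exact: mem_nth.
  - have xsi : (index x s < size s)%N by rewrite index_mem.
    by exists (Ordinal xsi); rewrite /= nth_index.
  - by apply: val_inj; exact: (sM' i j).
have [s0 [s0K s0D]] : exists s0 : seq G, (forall x, x \in s0 -> K x) /\
    forall y, K y -> exists2 x, x \in s0 & M (x^-1 * y)%g.
  exists (finmap.enum_fset D); split=> [x xD|y /DK[x /= xD xy]]; last by exists x.
  by have := KD x xD; rewrite inE.
have : exists s : seq G, [/\ forall x, x \in s -> K x,
    forall y, y \in s0 -> exists2 x, x \in s & M (x^-1 * y)%g &
    forall i j, (i < size s)%N -> (j < size s)%N ->
      M ((nth 1%g s i)^-1 * nth 1%g s j)%g -> i = j].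
  clear s0D; elim: s0 s0K => [|a s0 IH] s0K; first by exists [::].
  have [|s [sK sD sM']] := IH; first by move=> x xs; apply: s0K; rewrite inE xs orbT.
  have [[x xs xa]|nsa] := pselect (exists2 x, x \in s & M (x^-1 * a)%g).
    exists s; split=> // y; rewrite inE => /predU1P[->|]; last exact: sD.
    by exists x.
  exists (a :: s); split=> [x|y|].
  - by rewrite inE => /predU1P[->|]; [apply: s0K; rewrite inE eqxx|exact: sK].
  - rewrite inE => /predU1P[->|/sD[x xs xy]].
      by exists a; [rewrite inE eqxx|rewrite mulVg].
    by exists x; rewrite // inE xs orbT.
  - move=> [|i] [|j] //= si sj Mij; last by congr _.+1; exact: sM'.
      exfalso; apply: nsa; exists (nth 1%g s j); first exact: mem_nth.
      by have := MV _ Mij; rewrite invgM invgK.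
    by exfalso; apply: nsa; exists (nth 1%g s i) => //; exact: mem_nth.
move=> [s [sK sD sM']]; exists s; split=> // y /s0D[x /sD[z zs zx] xy].
exists z => //; rewrite (_ : _ * _ = (z^-1 * x) * (x^-1 * y))%g; first exact: MM.
by rewrite !mulgA mulgK.
Qed.

End OpenSubgroups.

(** * Concentrated traces *)

Section ConcentratedTraces.
Variables (R : realType) (G : topGroupType) (varpi : unitary_rep R G).
Hypothesis varpi_universal : is_universal_rep varpi.
Variable varpi2 : unitary_rep R (G * G)%type.
Hypothesis varpi2_tensor : is_outer_tensor varpi varpi varpi2.

(** Values in [[0, 1]] make the class stable under products and the sets where [v = 1] directed,
    since a product equals 1 only where both factors do. *)
Definition unit_trace (v : G -> R) : Prop :=
  [/\ continuous (v : G -> R^o), forall x, 0 <= v x <= 1, v 1%g = 1,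
      forall s t, v (s * t)%g = v (t * s)%g &
      Pmin varpi2 (fun p => (v (p.1 * p.2^-1)%g)%:C)].

Lemma unit_trace1 : unit_trace (fun=> 1).
Proof.
split=> // [x|x|]; first exact: cvg_cst.
  by rewrite ler01 lexx.
exact: Pmin_one varpi2_tensor.
Qed.

Lemma unit_traceM v w : unit_trace v -> unit_trace w ->
  unit_trace (fun x => v x * w x).
Proof.
move=> [cv v01 v1 vC Pv] [cw w01 w1 wC Pw]; split.
- by move=> x; apply: (@cvgM R); [exact: cv|exact: cw].
- move=> x; have /andP[v0 vx1] := v01 x; have /andP[w0 wx1] := w01 x.
  by rewrite mulr_ge0 //= mulr_ile1.
- by rewrite v1 w1 mulr1.
- by move=> s t; rewrite vC wC.
- have := Pmin_mul varpi_universal varpi2_tensor Pv Pw; congr (Pmin _ _).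
  by apply/funext => p; rewrite rmorphM.
Qed.

Lemma unit_traceX v n : unit_trace v -> unit_trace (fun x => v x ^+ n).
Proof.
move=> uv; elim: n => [|n IH].
  by rewrite (_ : (fun _ => _) = fun=> 1) //; exact: unit_trace1.
rewrite (_ : (fun _ => _) = fun x => v x * v x ^+ n); first exact: unit_traceM.
by apply/funext => x; rewrite exprS.
Qed.

Lemma normalized_pd_le1 (u : G -> R[i]) x : normalized_pd u -> cabs (u x) <= 1.
Proof.
move=> nu; have [xi uE] := universal_coef varpi_universal nu.
have [_ _ u1] := nu; move: u1; rewrite uE /rep_coef rep1 dotxx => xi1.
apply: le_trans (coef_le _ _ _) _; rewrite -expr2 -lecR.
by move: xi1 => /= ->.
Qed.

Lemma normalized_pdV (u : G -> R[i]) x : normalized_pd u -> u (x^-1)%g = (u x)^*.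
Proof.
move=> nu; have [xi ->] := universal_coef varpi_universal nu.
by rewrite /rep_coef rep_dotV invgK dotC.
Qed.

(* [(1 + u) / 2] has modulus 1 only where [u = 1], and the modulus is squared
   within [Pmin] because the conjugate of [u (s t^-1)] is [u (t s^-1)]. *)
Lemma amenable_trace_unit_trace (u : G -> R[i]) (q : G) :
  amenable_trace varpi2 u -> u q != 1 -> exists2 v, unit_trace v & v q < 1.
Proof.
move=> [[nu uC] Pu] uq; pose z x := 2^-1%:C * (1 + u x) : R[i].
have [cu _ u1] := nu.
have zP x : cabs (z x) ^+ 2 = ((1 + complex.Re (u x)) ^+ 2 + complex.Im (u x) ^+ 2) / 4.
  rewrite cabsM cabs_real exprMn cabs_sqr ReD ImD /= add0r.
  by rewrite real_normK ?num_real //; field.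
have ule x : complex.Re (u x) ^+ 2 + complex.Im (u x) ^+ 2 <= 1.
  by rewrite -cabs_sqr expr_le1 ?cabs_ge0 // normalized_pd_le1.
have z1 x : cabs (z x) <= 1.
  rewrite -(@expr_le1 _ 2) ?cabs_ge0 // zP.
  have := ule x; have := sqr_ge0 (complex.Re (u x) - 1).
  have := sqr_ge0 (complex.Im (u x)); nra.
exists (fun x => cabs (z x) ^+ 2); last first.
  rewrite lt_neqAle expr_le1 ?cabs_ge0 // z1 andbT; apply: contra uq => /eqP.
  rewrite zP => e; have := ule q => uq1.
  have a1 : complex.Re (u q) = 1 by nra.
  have b0 : complex.Im (u q) = 0.
    by apply/eqP; rewrite -sqrf_eq0; apply/eqP; rewrite a1 in e; lra.
  by apply/eqP/eqC; rewrite ?a1 ?b0.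
have dist (a b c : R) : c <= a + b -> b <= a + c -> `|b - c| <= a.
  by move=> ca ba; rewrite ler_norml; apply/andP; split; lra.
have cb x e : cabs (z x - z e) = cabs (u x - u e) / 2.
  rewrite /z -mulrBr opprD addrACA subrr add0r cabsM cabs_real mulrC.
  by rewrite ger0_norm ?invr_ge0.
split.
- move=> x; apply/cvgrPdist_lt => e e0.
  have /continuous_cabsP /(_ x e e0) := cu; apply: filterS => y uxy.
  apply: le_lt_trans uxy; have := cb x y.
  have := cabsD (z x - z y) (z y); rewrite subrK.
  have := cabsD (z y - z x) (z x); rewrite subrK (cabsC (z y)).
  have := cabs_ge0 (z x); have := cabs_ge0 (z y).
  have := z1 x; have := z1 y.
  move=> zy1 zx1 zy0 zx0 zyx zxy ze.
  (* The sum of the two moduli is at most 2, which cancels the factor [2^-1] in [z]. *)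
  rewrite subr_sqr normrM (ger0_norm (addr_ge0 zx0 zy0)).
  have -> : cabs (u x - u y) = cabs (z x - z y) * 2 by rewrite ze; field.
  apply: ler_pM => //; first exact: addr_ge0; last lra.
  exact: dist.
- by move=> x; rewrite sqr_ge0 expr_le1 ?cabs_ge0 ?z1.
- by rewrite zP u1 /=; field.
- by move=> s t; rewrite /z uC.
- have [_ PD PZ _] := Pmin_closed_cone varpi2.
  have P1 := Pmin_one varpi_universal varpi2_tensor.
  have h0 : 0 <= 2^-1 :> R by rewrite invr_ge0.
  have Pz := PZ _ _ h0 (PD _ _ P1 Pu).
  have := Pmin_mul varpi_universal varpi2_tensor Pz (Pmin_flip varpi2_tensor Pz).
  congr (Pmin _ _); apply/funext => p /=; rewrite -mulCconj_sqr /z.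
  have -> : u (p.2 * p.1^-1)%g = (u (p.1 * p.2^-1)%g)^*.
    by rewrite -normalized_pdV // invgM invgK.
  by apply: eqC; rewrite !conjCE !(ReM, ImM, ReD, ImD) /=; ring.
Qed.

(** The trace supplied by separation depends on the point of [Q]. The sets where [v = 1] are closed
    and directed, so compactness gives one [v] below 1 on all of [Q], and then a uniform bound. *)
Lemma unit_trace_compact (Q : set G) :
  amenably_tracially_separated varpi2 -> compact Q -> ~ Q 1%g ->
  exists v (r : R), [/\ unit_trace v, 0 <= r < 1 & forall x, Q x -> v x <= r].
Proof.
move=> sepG cQ Q1.
have [| | | |v uv vQ] := @compact_directed G _ unit_trace (fun v => [set x | v x = 1]) _ cQ.
- by exists (fun=> 1); exact: unit_trace1.
- move=> v [cv _ _ _ _].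
  by apply: (@closed_comp _ _ v [set y | y = 1]); [move=> x _; exact: cv|exact: closed_eq].
- move=> v w uv uw; exists (fun x => v x * w x); first exact: unit_traceM.
  move=> x /= vw1; have [_ /(_ x)/andP[v0 v1] _ _ _] := uv.
  have [_ /(_ x)/andP[w0 w1] _ _ _] := uw; split; nra.
- move=> q Qq; have : ~ [set 1%g] q by move=> q1; apply: Q1; rewrite -q1.
  rewrite -sepG => /existsNP[u /not_implyP[au uq]].
  have [|v uv vq] := amenable_trace_unit_trace au (q := q); first exact/eqP.
  by exists v => //= v1; rewrite v1 ltxx in vq.
have [cv v01 _ _ _] := uv.
have : \forall y \near (1 : R), forall k, Q k -> v k < y.
  apply: (near_compact cQ) => k Qk.
  have vk1 : v k < 1.
    by have /andP[_] := v01 k; rewrite le_eqVlt => /orP[/eqP /(vQ _ Qk)|].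
  pose c := (v k + 1) / 2.
  exists ([set x | v x < c], [set y | c < y]) => [|[x y] /= [] ]; last exact: lt_trans.
  split => /=; last by apply: lt_nbhsr; rewrite /c; lra.
  have : \forall y \near v k, y < c by apply: lt_nbhsl; rewrite /c; lra.
  exact: cv.
move=> /nbhs_ballP[e /= e0 eP].
(* The minimum with 1 keeps the bound [r] nonnegative. *)
have ey : ball (1 : R) e (1 - Num.min e 1 / 2).
  have me : Num.min e 1 <= e by rewrite ge_min lexx.
  have m0 : 0 < Num.min e 1 by rewrite lt_min e0 ltr01.
  by rewrite /ball /= subKr ger0_norm; lra.
exists v, (1 - Num.min e 1 / 2); split=> // [|x Qx]; last exact/ltW/eP.
have : Num.min e 1 <= 1 by rewrite ge_min lexx orbT.
have : 0 < Num.min e 1 by rewrite lt_min e0 ltr01.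
by move=> *; apply/andP; split; lra.
Qed.

End ConcentratedTraces.

(** * Haar measure *)

Section HaarMeasure.
Variables (R : realType) (G : topGroupType).
Hypothesis hG : hausdorff_space G.
Variable mu : {measure set (borel G) -> \bar R}.
Hypothesis mu_haar : left_haar_measure mu.

Lemma measurable_borel_open (U : set G) : open U -> measurable (U : set (borel G)).
Proof. by move=> oU; exact: sub_sigma_algebra. Qed.

Lemma measurable_borel_closed (C : set G) : closed C ->
  measurable (C : set (borel G)).
Proof.
move=> clC; rewrite -[C]setCK; apply: measurableC; apply: measurable_borel_open.
exact: closed_openC.
Qed.

Lemma measurable_borel_compact (K : set G) : compact K ->
  measurable (K : set (borel G)).
Proof. by move=> cK; apply: measurable_borel_closed; exact: compact_closed. Qed.

Lemma measurable_fun_borel_continuous (f : G -> G) : continuous f ->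
  measurable_fun setT (f : borel G -> borel G).
Proof.
move=> cf; apply: (@measurability _ _ (borel G) (borel G) setT f (@open G)) => //.
move=> _ [U oU <-]; rewrite setTI; apply: measurable_borel_open.
by apply: open_comp => // x _; exact: cf.
Qed.

Lemma measurable_fun_translation (s t : G) :
  measurable_fun setT ((fun x => s * x * t)%g : borel G -> borel G).
Proof.
apply: measurable_fun_borel_continuous; apply: continuous_mulg.
  by apply: continuous_mulg => [|?]; [exact: cst_continuous|exact: cvg_id].
exact: cst_continuous.
Qed.

Lemma image_mulgl (s : G) (A : set G) :
  [set (s * x)%g | x in A] = [set x | A (s^-1 * x)%g].
Proof.
apply/seteqP; split=> [_ [x Ax <-]|x /= Ax]; first by rewrite /= mulKg.
by exists (s^-1 * x)%g => //; rewrite mulVKg.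
Qed.

Lemma image_mulgr (t : G) (A : set G) :
  [set (x * t)%g | x in A] = [set x | A (x * t^-1)%g].
Proof.
apply/seteqP; split=> [_ [x Ax <-]|x /= Ax]; first by rewrite /= mulgK.
by exists (x * t^-1)%g => //; rewrite mulgVK.
Qed.

Lemma haar_mulgl (s : G) (A : set (borel G)) : measurable A ->
  mu [set x | A (s * x)%g] = mu A.
Proof.
move=> mA; have [_ inv _ _ _] := mu_haar; rewrite -(inv s^-1%g A mA) image_mulgl.
by rewrite invgK.
Qed.

Lemma haar_compact_fin (K : set G) : compact K -> (mu K < +oo)%E.
Proof. by have [_ _ + _ _] := mu_haar; exact. Qed.

(** If [U] were null, so would be every compact set, being covered by finitely many left translates
    of [U]; inner regularity would then make the whole group null. *)
Lemma haar_open_gt0 (U : set G) : open U -> U !=set0 -> (0 < mu U)%E.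
Proof.
move=> oU [u Uu]; rewrite lt0e measure_ge0 andbT; apply/eqP => U0.
have [muT _ _ _ inner] := mu_haar; apply/negP: muT; rewrite negbK; apply/eqP.
rewrite (inner setT openT); apply/eqP; rewrite eq_le; apply/andP; split; last first.
  by apply: ereal_sup_ubound; exists set0; [split=> //; exact: compact0|exact: measure0].
apply: ge_ereal_sup => _ [K [cK _] <-].
move: cK; rewrite compact_cover => cK.
have [x _|y Ky|D _ DK] := cK G K (fun x => [set y | U (u * x^-1 * y)%g]).
- exact: open_preimage_mulgl.
- by exists y => //=; rewrite mulgVK.
have mU x : measurable ([set y | U (u * x^-1 * y)%g] : set (borel G)).
  apply: measurable_borel_open; exact: open_preimage_mulgl.
apply: (@le_trans _ _ (mu (\big[setU/set0]_(x <- finmap.enum_fset D)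
    [set y | U (u * x^-1 * y)%g] : set (borel G)))).
  apply: le_measure; rewrite ?inE.
  - by apply: measurable_borel_compact; rewrite compact_cover.
  - by apply: bigsetU_measurable => x _; exact: mU.
  - by move=> y /DK; rewrite /cover bigcup_seq.
have mU0 x : mu [set y | U (u * x^-1 * y)%g] = 0%E.
  by rewrite (@haar_mulgl (u * x^-1)%g U) //; exact: measurable_borel_open.
elim: (finmap.enum_fset D) => [|x s IH]; first by rewrite big_nil measure0.
rewrite big_cons measureU0 ?mU0 //; first by apply: bigsetU_measurable => z _; exact: mU.
by apply/eqP; rewrite eq_le IH measure_ge0.
Qed.

Lemma haar_compact_open (L : set G) : compact_open_subgroup L ->
  mu L = (fine (mu L))%:E /\ 0 < fine (mu L).
Proof.
move=> [[L1 _ _] oL cL]; have L0 : (0 < mu L)%E by apply: haar_open_gt0 => //; exists 1%g.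
have Ly := haar_compact_fin cL; split; last by rewrite fine_gt0 // L0.
by rewrite fineK // ge0_fin_numE // ltW.
Qed.

(** A right [M]-invariant set is the disjoint union of the left cosets whose representatives it
    contains, and each coset has the measure of [M]. *)
Lemma haar_count_cosets (M A : set G) (n : nat) (x : 'I_n -> G) :
  compact_open_subgroup M -> (forall y m, A y -> M m -> A (y * m)%g) ->
  (forall y, A y -> exists i, M ((x i)^-1 * y)%g) ->
  (forall i j, M ((x i)^-1 * x j)%g -> i = j) ->
  mu A = (#|[pred i | `[< A (x i) >]]|%:R * fine (mu M))%:E.
Proof.
move=> cM AM Ax xinj; have [[M1 MM MV] oM _] := cM.
have [muM _] := haar_compact_open cM.
have mC i : measurable ([set y | M ((x i)^-1 * y)%g] : set (borel G)).
  apply: measurable_borel_open; exact: open_preimage_mulgl.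
have muC i : mu [set y | M ((x i)^-1 * y)%g] = (fine (mu M))%:E.
  by rewrite (@haar_mulgl (x i)^-1%g M) //; exact: measurable_borel_open.
set P := [pred i | _].
have -> : A = \big[setU/set0]_(i in P) [set y | M ((x i)^-1 * y)%g].
  rewrite -bigcup_pred; apply/seteqP; split=> y.
    move=> Ay; have [i xiy] := Ax y Ay; have Axi : A (x i).
      rewrite (_ : x i = y * (y^-1 * x i))%g; last by rewrite mulVKg.
      by apply: AM => //; rewrite -[(_ * _)%g]invgK invgM invgK; exact: MV.
    by exists i => //=; rewrite inE.
  move=> [i /=]; rewrite inE => Axi xiy.
  by rewrite -(mulVKg (x i) y); exact: AM.
rewrite (@measure_bigsetU_ord _ _ _ mu n (fun i => i \in P)) => //.
  rewrite (eq_bigr (fun=> (fine (mu M))%:E)).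
    by rewrite sumEFin sumr_const mulr_natl.
  by move=> i _; exact: muC.
move=> i j _ _ [y [/= xiy xjy]]; apply: xinj.
rewrite (_ : _ * _ = ((x i)^-1 * y) * ((x j)^-1 * y)^-1)%g; first by apply: MM => //; exact: MV.
by rewrite invgM invgK mulgA mulgK.
Qed.

End HaarMeasure.

(** * Averages over cosets and the overlap functions *)

Section CosetSums.
Variables (R : realType) (G : topGroupType) (L M : set G) (n : nat) (x : 'I_n -> G).
Hypothesis sL : subgroup L.
Hypothesis sM : subgroup M.
Hypothesis ML : M `<=` L.
Hypothesis normM : forall l m, L l -> M m -> M (l^-1 * m * l)%g.
Hypothesis xL : forall i, L (x i).
Hypothesis xcover : forall y, L y -> exists i, M ((x i)^-1 * y)%g.
Hypothesis xinj : forall i j, M ((x i)^-1 * x j)%g -> i = j.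

(** Sending [j] to the coset of [(x j)^-1 * z] permutes the cosets of [M] in [L], and [w] varies by
    at most [d] on each. Injectivity is where normality of [M] in [L] enters: it turns a relation
    between products into [(x j)^-1 * x k] in [M]. *)
Lemma coset_sum_close (w : G -> R) (d : R) (z : G) :
  (forall y m, L y -> M m -> `|w (y * m)%g - w y| <= d) -> L z ->
  `|\sum_j w ((x j)^-1 * z)%g - \sum_j w (x j)| <= n%:R * d.
Proof.
move=> wd Lz; have [L1 LM LV] := sL; have [M1 MM MV] := sM.
have /choice[sg sgP] j : exists i, M ((x i)^-1 * ((x j)^-1 * z))%g.
  by apply: xcover; apply: LM => //; exact: LV.
have sg_inj : injective sg.
  move=> j k jk; apply: xinj.
  set m := ((x (sg j))^-1 * ((x j)^-1 * z))%g.
  set m' := ((x (sg k))^-1 * ((x k)^-1 * z))%g.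
  have Mm : M (m * m'^-1)%g by apply: MM; [exact: sgP|apply: MV; exact: sgP].
  have := normM (LV _ (xL (sg j))) Mm; rewrite /m /m' jk; congr M.
  by rewrite !(invgM, invgK) !mulgA !(mulgK, mulgV, mul1g).
rewrite [X in _ - X](reindex_inj sg_inj) -sumrB; apply: le_trans (ler_norm_sum _ _ _) _.
have -> : n%:R * d = \sum_(j < n) d by rewrite sumr_const card_ord mulr_natl.
apply: ler_sum => j _; rewrite -[X in w X - _](mulVKg (x (sg j))).
exact: wd.
Qed.

End CosetSums.

Section Overlap.
Variables (R : realType) (G : topGroupType).
Hypothesis hG : hausdorff_space G.
Hypothesis bG : compact_nbhs_base G.
Hypothesis tdG : totally_disconnected [set: G].
Variable mu : {measure set (borel G) -> \bar R}.
Hypothesis mu_haar : left_haar_measure mu.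
Variable varpi : unitary_rep R G.
Hypothesis varpi_universal : is_universal_rep varpi.
Variable varpi2 : unitary_rep R (G * G)%type.
Hypothesis varpi2_tensor : is_outer_tensor varpi varpi varpi2.
Hypothesis sepG : amenably_tracially_separated varpi2.

(** This is [L /\ s^-1 L t]. *)
Definition overlap (L : set G) (s t : G) : set G :=
  [set b | L b /\ L (s * b * t^-1)%g].

Lemma exists_expr_lt (r e : R) : 0 <= r < 1 -> 0 < e -> exists n, r ^+ n < e.
Proof.
move=> /andP[r0 r1] e0; have r1' : `|r| < 1 by rewrite ger0_norm.
have /cvgrPdist_lt /(_ e e0) [n _ nP] := cvg_expr r1'.
exists n; have := nP n (leqnn n); rewrite sub0r normrN ger0_norm //.
exact: exprn_ge0.
Qed.

(* The approximants are the averages of [v^n (a^-1 s b t^-1)] over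
   representatives [a], [b] of the cosets in [L] of a small normal open subgroup
   [M], normalised at the identity: for [b] fixed the average over [a] is close
   to that of [v^n] when [s b t^-1] is in [L], and is negligible otherwise
   because [v^n] decays off [L]. *)
Lemma overlap_Pmin (L : set G) : compact_open_subgroup L ->
  Pmin varpi2 (fun p => (fine (mu (overlap L p.1 p.2)) / fine (mu L))%:C).
Proof.
move=> coL; have [sL oL cL] := coL; have [L1 LM LV] := sL.
have [_ _ PZ Pap] := Pmin_closed_cone varpi2; apply: Pap => K e cK e0.
have cK1 : compact [set p.1 | p in K].
  by apply: continuous_compact cK; apply: continuous_subspaceT => p; exact: cvg_fst.
have cK2 : compact [set p.2 | p in K].
  by apply: continuous_compact cK; apply: continuous_subspaceT => p; exact: cvg_snd.
pose f (z : (G * G) * (G * G)) := (z.1.1 * z.1.2 * z.2.1 * z.2.2^-1)%g.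
(* Contains every point at which [v] is evaluated when [(s, t)] runs over [K]. Removing the open set
   [L] leaves a compact set avoiding the identity. *)
pose P := f @` ((L `*` [set p.1 | p in K]) `*` (L `*` [set p.2 | p in K])).
have cP : compact P.
  apply: continuous_compact; last by apply: compact_setX; exact: compact_setX.
  apply: continuous_subspaceT.
  have c1 : continuous (fun z : (G * G) * (G * G) => z.1) by move=> z; exact: cvg_fst.
  have c2 : continuous (fun z : (G * G) * (G * G) => z.2) by move=> z; exact: cvg_snd.
  apply: continuous_mulg; last apply: continuous_invg.
    apply: continuous_mulg; first apply: continuous_mulg.
    - by move=> z; apply: continuous_comp; [exact: c1|exact: cvg_fst].
    - by move=> z; apply: continuous_comp; [exact: c1|exact: cvg_snd].
    - by move=> z; apply: continuous_comp; [exact: c2|exact: cvg_fst].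
  by move=> z; apply: continuous_comp; [exact: c2|exact: cvg_snd].
have cQ : compact (P `\` L).
  apply: (subclosed_compact _ cP); last by move=> y [].
  by rewrite setDE; apply: closedI; [exact: (compact_closed hG cP)|exact: open_closedC].
have [|v [r [uv /andP[r0 r1] vr]]] :=
  unit_trace_compact varpi_universal varpi2_tensor sepG cQ; first by move=> [].
pose rho := (1 + r) / 2.
have rho0 : 0 < rho by rewrite /rho; lra.
have rrho : r < rho by rewrite /rho; lra.
have [cv v01 v1 _ _] := uv.
pose W := [set x | L x /\ rho < v x].
have oW : open W.
  apply: openI => //; apply: (@open_comp _ _ v [set y | rho < y]); last exact: open_gt.
  by move=> x _; exact: cv.
have W1 : W 1%g by split=> //; rewrite v1 /rho; lra.
have WL : W `<=` L by move=> x [].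
have [muL muL0] := haar_compact_open hG mu_haar coL.
have mL := measurable_borel_open oL; have mW := measurable_borel_open oW.
have muWL : (mu W <= mu L)%E by apply: le_measure => //; rewrite inE.
have muW0 : (0 < mu W)%E by apply: haar_open_gt0 => //; exists 1%g.
have muW : mu W = (fine (mu W))%:E.
  rewrite fineK // ge0_fin_numE ?ltW //; apply: le_lt_trans muWL _.
  by rewrite muL ltry.
(* Bounds from below the proportion of cosets contributing at least [q / 2] to the normalising sum
   [S]. *)
pose c := fine (mu W) / fine (mu L).
have c0 : 0 < c by rewrite divr_gt0 // -lte_fin -muW.
have [n nP] : exists n, (r / rho) ^+ n < e * c / 4.
  apply: exists_expr_lt; last by rewrite divr_gt0 // mulr_gt0.
  apply/andP; split; first by rewrite divr_ge0 // ltW.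
  by rewrite ltr_pdivrMr // mul1r.
pose w x := v x ^+ n.
have [cw w01 w1 wC Pw] : unit_trace varpi2 w.
  exact: (unit_traceX varpi_universal varpi2_tensor n uv).
pose q := rho ^+ n.
have q0 : 0 < q by exact: exprn_gt0.
have rq : r ^+ n < e * c / 4 * q.
  by rewrite -ltr_pdivrMr // -expr_div_n.
(* The bound [q / 2] lets a coset meeting [W] contribute [q / 2] to [S]. The other one and the
   choice of [n] give [d + r ^+ n < e * c * q / 2], the error affordable since
   [S >= c * N%:R * (q / 2)]. *)
pose d := Num.min (q / 2) (e * c * q / 8).
have d0 : 0 < d.
  have ecq : 0 < e * c * q by apply: mulr_gt0 => //; exact: mulr_gt0.
  rewrite lt_min; apply/andP; split; exact: divr_gt0.
have [dq dec] : d <= q / 2 /\ d <= e * c * q / 8.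
  by split; rewrite /d ge_min lexx ?orbT.
(* This makes [overlap L s t] right invariant under [M] for [(s, t)] in [K], hence a union of
   cosets. *)
have near1 : \forall m \near (1%g : G), forall t, [set p.2 | p in K] t -> L (t * m * t^-1)%g.
  apply: (near_compact cK2) => t _.
  have : continuous (fun z : G * G => (z.1 * z.2 * z.1^-1)%g).
    apply: continuous_mulg; last by apply: continuous_invg => ?; exact: cvg_fst.
    by apply: continuous_mulg => ?; [exact: cvg_fst|exact: cvg_snd].
  move=> /(_ (t, 1%g)) /(_ L); rewrite /= mulg1 mulgV; apply.
  exact: open_nbhs_nbhs.
have near2 : \forall m \near (1%g : G), forall y, L y -> `|w (y * m)%g - w y| < d.
  apply: (near_compact cL) => y _.
  have h : continuous (fun z : G * G => w (z.1 * z.2)%g - w z.1 : R^o).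
    move=> z; apply: (@cvgB R R^o).
      apply: (@continuous_comp _ _ _ (fun z : G * G => z.1 * z.2)%g w); last exact: cw.
      exact: mulg_continuous.
    by apply: (@continuous_comp _ _ _ fst w); [exact: cvg_fst|exact: cw].
  have /cvgrPdist_lt /(_ d d0) := h (y, 1%g); apply: filterS => z.
  by rewrite /= mulg1 subrr sub0r normrN.
have [M [coM ML MU normM]] :=
  normal_open_subgroup hG bG tdG coL (filterI near1 near2).
have [sM oM cM] := coM.
have [muM muM0] := haar_compact_open hG mu_haar coM.
have [N [x [xL xcover xinj]]] := coset_representatives sM oM cL.
have wd y m : L y -> M m -> `|w (y * m)%g - w y| <= d.
  by move=> Ly /MU[_ /(_ y Ly)] /ltW.
have coset A : A `<=` L -> (forall y m, A y -> M m -> A (y * m)%g) ->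
    fine (mu A) = #|[pred i | `[< A (x i) >]]|%:R * fine (mu M).
  move=> AL AM; rewrite (haar_count_cosets hG mu_haar coM AM _ xinj) //.
  by move=> y /AL; exact: xcover.
have LN : fine (mu L) = N%:R * fine (mu M).
  rewrite (coset L) // => [|y m Ly /ML]; last exact: LM.
  congr (_%:R * _); rewrite -[RHS]card_ord; apply: eq_card => i.
  by rewrite [LHS](_ : _ = `[< L (x i) >]) // asboolT.
have N0 : 0 < N%:R :> R by move: muL0; rewrite LN pmulr_lgt0.
pose S := \sum_j w (x j).
(* The union of the cosets of [M] meeting [W]: unlike [W], it can be measured by counting
   representatives. *)
pose W' := [set y | L y /\ exists2 m, M m & W (y * m)%g].
have W'c : c * N%:R <= #|[pred i | `[< W' (x i) >]]|%:R.
  have W'L : W' `<=` L by move=> y [].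
  have W'M y m : W' y -> M m -> W' (y * m)%g.
    move=> [Ly [m' Mm' Wym]] Mm; have [_ MM MV] := sM.
    split; first by apply: LM => //; exact: ML.
    exists (m^-1 * m')%g; first by apply: MM => //; exact: MV.
    by rewrite mulgA mulgK.
  have oW' : open W' by apply: right_invariant_open W'M; apply: open_nbhs_nbhs; split=> //; case: sM.
  have muW' : (mu W <= mu W')%E.
    apply: le_measure; rewrite ?inE //; first exact: measurable_borel_open.
    by move=> y Wy; split; [exact: WL|exists 1%g; rewrite ?mulg1 //; case: sM].
  rewrite -(ler_pM2r muM0) -(coset W') // /c -[leLHS]mulrA -LN mulfVK ?gt_eqF //.
  have muW'L : (mu W' <= mu L)%E.
    by apply: le_measure; rewrite ?inE //; exact: measurable_borel_open.
  apply: fine_le => //; first by rewrite muW.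
  rewrite ge0_fin_numE ?measure_ge0 //; apply: le_lt_trans muW'L _.
  by rewrite muL ltry.
have Sq : c * N%:R * (q / 2) <= S.
  apply: (@le_trans _ _ (\sum_(j in [pred i | `[< W' (x i) >]]) q / 2)).
    by rewrite sumr_const -[leRHS]mulr_natl ler_pM2r // divr_gt0.
  rewrite /S [leRHS](bigID (mem [pred i | `[< W' (x i) >]])) /= -[leLHS]addr0.
  apply: lerD; last by apply: sumr_ge0 => j _; have /andP[] := w01 (x j).
  apply: ler_sum => j; rewrite !inE => -[Lxj [m Mm [_ vxm]]].
  have := wd _ _ Lxj Mm; rewrite ler_norml => /andP[_].
  have : q <= w (x j * m)%g by apply: lerXn2r; rewrite ?nnegrE; apply: ltW => //; exact: lt_trans vxm.
  by move: dq; clear; lra.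
have S0 : 0 < S.
  apply: lt_le_trans Sq; apply: mulr_gt0; last exact: divr_gt0.
  exact: mulr_gt0.
(* Translating the first variable on both sides is enough: the argument of [w] becomes
   [(x j)^-1 * s * x i * t^-1]. *)
pose g i : G * G := (x i, 1%g).
pose Phi p := \sum_i \sum_j (1 : R[i]) * (1 : R[i])^* *
  (w (((g j)^-1 * p * g i).1 * ((g j)^-1 * p * g i).2^-1)%g)%:C.
have PPhi : Pmin varpi2 Phi by exact: (@Pmin_translate _ _ varpi2 _ g (fun=> 1) _ Pw).
have NS0 : 0 < N%:R * S by rewrite mulr_gt0.
exists (fun p => ((N%:R * S)^-1)%:C * Phi p) => [|[s t] Kst].
  by apply: PZ => //; rewrite invr_ge0 ltW.
have PhiE : Phi (s, t) = (\sum_i \sum_j w ((x j)^-1 * (s * x i * t^-1))%g)%:C.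
  rewrite rmorph_sum; apply: eq_bigr => i _; rewrite rmorph_sum; apply: eq_bigr => j _.
  rewrite conjC1 !mul1r /=; congr (w _)%:C.
  by rewrite invg1 mul1g mulg1 !mulgA.
rewrite PhiE -rmorphM -rmorphB cabs_real /=.
pose A := [pred i | `[< overlap L s t (x i) >]].
have -> : fine (mu (overlap L s t)) / fine (mu L) = #|A|%:R / N%:R.
  rewrite (coset (overlap L s t)) ?LN => [|y []//|y m [Ly Lsyt] Mm].
    by rewrite invfM mulrACA divff ?mulr1 // gt_eqF.
  split; first by apply: LM => //; exact: ML.
  rewrite (_ : s * (y * m) * t^-1 = s * y * t^-1 * (t * m * t^-1))%g.
    apply: LM => //; have [+ _] := MU m Mm; apply; by exists (s, t).
  by rewrite !mulgA mulgVK.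
have key i : `|(if i \in A then S else 0) - \sum_j w ((x j)^-1 * (s * x i * t^-1))%g|
    <= N%:R * (d + r ^+ n).
  have rn0 : 0 <= r ^+ n by exact: exprn_ge0.
  case: ifPn => iA.
    have Lz : L (s * x i * t^-1)%g by move: iA; rewrite inE => -[].
    rewrite distrC; apply: le_trans (coset_sum_close sL sM normM xL xcover xinj wd Lz) _.
    by rewrite ler_pM2l // lerDl.
  rewrite sub0r normrN; apply: le_trans (ler_norm_sum _ _ _) _.
  have -> : N%:R * (d + r ^+ n) = \sum_(j < N) (d + r ^+ n).
    by rewrite sumr_const card_ord mulr_natl.
  apply: ler_sum => j _; have /andP[w0 _] := w01 ((x j)^-1 * (s * x i * t^-1))%g.
  rewrite ger0_norm //; apply: le_trans (_ : r ^+ n <= _); last by rewrite lerDr ltW.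
  have /andP[v0 _] := v01 ((x j)^-1 * (s * x i * t^-1))%g.
  apply: lerXn2r; rewrite ?nnegrE //; apply: vr; split.
    exists (((x j)^-1, s), (x i, t))%g => /=; last by rewrite /f /= !mulgA.
    split; split => //=; first exact: LV.
      by exists (s, t).
    by exists (s, t).
  move=> Lz; move/negP: iA; apply; rewrite inE; split=> //.
  by rewrite -(mulVKg (x j) (_ * _)%g); apply: LM.
have -> : #|A|%:R / N%:R = (N%:R * S)^-1 * \sum_i (if i \in A then S else 0).
  rewrite -big_mkcond sumr_const -[S *+ _]mulr_natl mulrCA; congr (_ * _).
  by rewrite invfM mulfVK // gt_eqF.
rewrite -mulrBr -sumrB normrM ger0_norm ?invr_ge0 ?(ltW NS0) //.
rewrite mulrC ltr_pdivrMr //.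
apply: le_lt_trans (ler_norm_sum _ _ _) _.
apply: (@le_lt_trans _ _ (\sum_(i < N) N%:R * (d + r ^+ n))); first exact: ler_sum.
rewrite sumr_const card_ord -[_ *+ N]mulr_natl.
rewrite [ltRHS]mulrCA ltr_pM2l //.
apply: (@lt_le_trans _ _ (e * (c * N%:R * (q / 2)))); last by rewrite ler_pM2l.
have -> : e * (c * N%:R * (q / 2)) = N%:R * (e * c * q / 2) by field.
by rewrite ltr_pM2l //; move: dec rq; set y := e * c; lra.
Qed.

End Overlap.

(** * Unimodularity from the symmetry of overlaps *)

Section Unimodular.
Variables (R : realType) (G : topGroupType).
Hypothesis hG : hausdorff_space G.
Hypothesis bG : compact_nbhs_base G.
Hypothesis tdG : totally_disconnected [set: G].
Variable mu : {measure set (borel G) -> \bar R}.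
Hypothesis mu_haar : left_haar_measure mu.
Variable varpi : unitary_rep R G.
Hypothesis varpi_universal : is_universal_rep varpi.
Variable varpi2 : unitary_rep R (G * G)%type.
Hypothesis varpi2_tensor : is_outer_tensor varpi varpi varpi2.
Hypothesis sepG : amenably_tracially_separated varpi2.

Lemma overlap_open (L : set G) s t : open L -> open (overlap L s t).
Proof. by move=> oL; apply: openI => //; exact: open_preimage_mulg. Qed.

Lemma overlap_measure_fin (L : set G) s t : compact_open_subgroup L ->
  mu (overlap L s t) = (fine (mu (overlap L s t)))%:E.
Proof.
move=> [_ oL cL]; rewrite fineK // ge0_fin_numE ?measure_ge0 //.
apply: le_lt_trans (haar_compact_fin mu_haar cL).
apply: le_measure; rewrite ?inE; try exact: measurable_borel_open.
  by apply: measurable_borel_open; exact: overlap_open.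
by move=> b [].
Qed.

(** Members of [Pmin] are hermitian, and this one is real. The change of variable [b -> s b t^-1]
    alone would give the equality only up to a value of the modular function. *)
Lemma overlapV (L : set G) s t : compact_open_subgroup L ->
  fine (mu (overlap L s^-1%g t^-1%g)) = fine (mu (overlap L s t)).
Proof.
move=> coL; have [_ muL0] := haar_compact_open hG mu_haar coL.
have := overlap_Pmin hG bG tdG mu_haar varpi_universal varpi2_tensor sepG coL.
have coefH (xi : rep_space varpi2) p : rep_coef xi (p^-1)%g = (rep_coef xi p)^*.
  by rewrite /rep_coef rep_dotV invgK dotC.
move=> /(Pmin_ind (@closed_cone_hermitian R (G * G)%type) coefH) /(_ (s, t)) /=.
rewrite [RHS]conjC_real => /complexI /(congr1 (fun x => x * fine (mu L))).
by rewrite !mulfVK // gt_eqF.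
Qed.

(* [mu (L /\ s^-1 L t)] is positive definite in [(s, t)], in particular
   symmetric, whereas conjugating by [t] multiplies its value at [(t, t)] by
   [Delta t^-1]. *)
Lemma unimodular (Delta : G -> R) t : modular_function mu Delta -> Delta t = 1.
Proof.
move=> modD; have [L coL _] := van_dantzig hG bG tdG (filterT : nbhs 1%g setT).
have [[L1 LM LV] oL cL] := coL.
pose A := overlap L t^-1%g t^-1%g.
have mA : measurable (A : set (borel G)) by apply: measurable_borel_open; exact: overlap_open.
have muA := overlap_measure_fin t^-1%g t^-1%g coL.
have muA0 : 0 < fine (mu A).
  rewrite -lte_fin -muA; apply: haar_open_gt0 => //; first exact: overlap_open.
  by exists 1%g; split=> //; rewrite mulg1 mulgV.
have [_ /(_ [set x | A (t * x)%g])] := modD t.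
rewrite image_mulgr haar_mulgl //.
(* Conjugation by [t^-1] carries the overlap at [(t^-1, t^-1)] to the one at [(t, t)], and
   [overlapV] equates their measures. *)
have -> : [set x | [set x | A (t * x)%g] (x * t^-1)%g] = overlap L t t.
  apply/seteqP; split=> b.
    by rewrite /= mulgA /A => -[Ltbt]; rewrite invgK !mulgA mulVg mul1g mulgVK.
  by move=> [Lb Ltbt]; rewrite /= mulgA; split=> //; rewrite invgK !mulgA mulVg mul1g mulgVK.
rewrite (overlap_measure_fin t t coL) muA -EFinM -(overlapV t t coL) -/A => H.
have {}H : fine (mu A) = Delta t * fine (mu A).
  by apply: EFin_inj; apply: H; apply: measurable_borel_open;
    exact/open_preimage_mulgl/overlap_open.
by apply: (mulIf (lt0r_neq0 muA0)); rewrite mul1r.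
Qed.

End Unimodular.

(** * Square-integrable functions *)

Section SquareIntegrable.
Variables (R : realType) (d : measure_display) (T : measurableType d).
Variable mu : {measure set T -> \bar R}.
Implicit Types f g a b : T -> R.

Definition summable f : Prop := mu.-integrable setT (EFin \o f).

Lemma summableD f g : summable f -> summable g -> summable (fun x => f x + g x).
Proof. by move=> sf sg; exact: (integrableD measurableT sf sg). Qed.

Lemma summableZ (k : R) f : summable f -> summable (fun x => k * f x).
Proof. by move=> sf; exact: (integrableZl measurableT k sf). Qed.

Lemma summable_le f g : measurable_fun setT f -> (forall x, `|f x| <= g x) ->
  summable g -> summable f.
Proof.
move=> mf fg; apply: le_integrable => //; first exact/measurable_EFinP.
by move=> x _ /=; rewrite lee_fin (le_trans (fg x)) // ler_norm.
Qed.

Lemma summable_sum (I : Type) (r : seq I) (F : I -> T -> R) :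
  (forall i, summable (F i)) ->
  summable (fun x => \sum_(i <- r) F i x) /\
  Rintegral mu setT (fun x => \sum_(i <- r) F i x) =
  \sum_(i <- r) Rintegral mu setT (F i).
Proof.
move=> sF; elim: r => [|i r [sr IH]].
  have -> : (fun x => \sum_(j <- [::]) F j x) = cst 0 by apply/funext => x; rewrite big_nil.
  rewrite big_nil Rintegral_cst // mul0r; split=> //; exact: integrable0.
have E : (fun x => \sum_(j <- i :: r) F j x) =
    fun x => F i x + \sum_(j <- r) F j x by apply/funext => x; rewrite big_cons.
rewrite E big_cons -IH; split; first exact: summableD.
by rewrite RintegralD //; exact: sF.
Qed.

Lemma summable_indic (A : set T) : measurable A -> (mu A < +oo)%E ->
  summable \1_A /\ Rintegral mu setT \1_A = fine (mu A).
Proof.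
move=> mA Ay; split; last by rewrite /Rintegral integral_indic ?setIT.
apply/integrableP; split; first exact/measurable_EFinP/measurable_indic.
rewrite (eq_integral (fun x => (\1_A x)%:E)).
  by rewrite integral_indic // setIT.
by move=> x _ /=; rewrite ger0_norm.
Qed.

Lemma Rintegral_norm_le f g (C : R) : measurable_fun setT f ->
  (forall x, `|f x| <= g x) -> summable g -> Rintegral mu setT g <= C ->
  `|Rintegral mu setT f| <= C.
Proof.
move=> mf fg sg gC; have sf := summable_le mf fg sg.
apply: le_trans (le_normr_Rintegral measurableT sf) _; apply: le_trans gC.
apply: le_Rintegral => //.
by apply: (summable_le _ _ sg) => [|x]; [exact: measurableT_comp|rewrite normr_id].
Qed.

Definition square_summable a : Prop :=
  measurable_fun setT a /\ summable (fun x => a x ^+ 2).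

(** The squared L^2 norm. Estimates stay in this form, with [2 * energy a + 2 * energy b] for a sum
    in place of the triangle inequality. *)
Definition energy a : R := Rintegral mu setT (fun x => a x ^+ 2).

Lemma energy_ge0 a : 0 <= energy a.
Proof. by apply: Rintegral_ge0 => x _; exact: sqr_ge0. Qed.

Lemma square_summable_le a b : measurable_fun setT a ->
  (forall x, a x ^+ 2 <= b x) -> summable b ->
  square_summable a /\ energy a <= Rintegral mu setT b.
Proof.
move=> ma ab sb; have sa : summable (fun x => a x ^+ 2).
  apply: (summable_le _ _ sb) => [|x]; first exact: measurable_funX.
  by rewrite ger0_norm ?sqr_ge0.
by split=> //; apply: le_Rintegral.
Qed.

Lemma square_summableD a b : square_summable a -> square_summable b ->
  square_summable (fun x => a x + b x) /\
  energy (fun x => a x + b x) <= 2 * energy a + 2 * energy b.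
Proof.
move=> [ma sa] [mb sb].
have [|||sab Eab] := @square_summable_le (fun x => a x + b x)
    (fun x => 2 * a x ^+ 2 + 2 * b x ^+ 2).
- exact: measurable_funD.
- by move=> x; have := sqr_ge0 (a x - b x); lra.
- by apply: summableD; exact: summableZ.
split=> //; apply: le_trans Eab _.
by rewrite RintegralD ?RintegralZl //; exact: summableZ.
Qed.

Lemma square_summableZ (k : R) a : square_summable a ->
  square_summable (fun x => k * a x) /\ energy (fun x => k * a x) = k ^+ 2 * energy a.
Proof.
move=> [ma sa]; have E : (fun x => (k * a x) ^+ 2) = fun x => k ^+ 2 * a x ^+ 2.
  by apply/funext => x; rewrite exprMn.
split; last by rewrite /energy E RintegralZl.
split; last by rewrite E; exact: summableZ.
exact: measurable_funM.
Qed.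

Lemma square_summableB a b : square_summable a -> square_summable b ->
  square_summable (fun x => a x - b x).
Proof.
move=> sa sb; have [sNb _] := square_summableZ (-1) sb.
have [+ _] := square_summableD sa sNb; congr square_summable.
by apply/funext => x; rewrite mulN1r.
Qed.

Lemma square_summable_mul a b : square_summable a -> square_summable b ->
  summable (fun x => a x * b x).
Proof.
move=> [ma sa] [mb sb]; apply: (summable_le (g := fun x => a x ^+ 2 + b x ^+ 2)).
- exact: measurable_funM.
- move=> x; rewrite ler_norml; have := sqr_ge0 (a x - b x).
  by have := sqr_ge0 (a x + b x); have := sqr_ge0 (a x); have := sqr_ge0 (b x); nra.
- exact: summableD.
Qed.

Lemma square_summable_indic (A : set T) : measurable A -> (mu A < +oo)%E ->
  square_summable \1_A /\ energy \1_A = fine (mu A).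
Proof.
move=> mA Ay; have [sA IA] := summable_indic mA Ay.
have E : (fun x => \1_A x ^+ 2 : R) = \1_A.
  by apply/funext => x; rewrite indicE; case: (_ \in _); rewrite ?expr1n ?expr0n.
by rewrite /square_summable /energy E.
Qed.

(* AM-GM applied to each term of
   [a b - a' b' = (a - a') b + a (b - b') - (a - a') (b - b')]. *)
Lemma Rintegral_mul_close a a' b b' (e : R) : 0 < e ->
  square_summable a -> square_summable a' -> square_summable b -> square_summable b' ->
  energy (fun x => a x - a' x) <= e ^+ 2 -> energy (fun x => b x - b' x) <= e ^+ 2 ->
  `|Rintegral mu setT (fun x => a x * b x) - Rintegral mu setT (fun x => a' x * b' x)|
    <= e * (1 + energy a + energy b + e).
Proof.
move=> e0 sa sa' sb sb'.
have sp := square_summableB sa sa'; have sq := square_summableB sb sb'.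
have sab := square_summable_mul sa sb; have sab' := square_summable_mul sa' sb'.
rewrite /energy; set p := fun x => (a x - a' x) ^+ 2; set q := fun x => (b x - b' x) ^+ 2.
move=> pe qe; rewrite -RintegralB //.
have [[ma s2a] [mb s2b]] := (sa, sb); have [[mp s2p] [mq s2q]] := (sp, sq).
have [ma' _] := sa'; have [mb' _] := sb'.
(* AM-GM is taken with weight [e] for the first two terms and weight 1 for the last; [k] and [h]
   collect the resulting coefficients of the differences and of [a], [b]. *)
pose k := (2 * e)^-1 + 2^-1; pose h := 2^-1 * e.
have e2 : 0 < 2 * e by rewrite mulr_gt0.
have k0 : 0 < k by rewrite addr_gt0 // invr_gt0.
have h0 : 0 < h by rewrite mulr_gt0 ?invr_gt0.
pose g x := (k * p x + k * q x) + (h * (a x ^+ 2) + h * (b x ^+ 2)).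
have spq : summable (fun x => k * p x + k * q x) by apply: summableD; exact: summableZ.
have sa2b2 : summable (fun x => h * (a x ^+ 2) + h * (b x ^+ 2)).
  by apply: summableD; exact: summableZ.
apply: (@Rintegral_norm_le _ g).
- by apply: measurable_funB; exact: measurable_funM.
- move=> x; rewrite /g /p /q.
  have amgm (u v t : R) : 0 < t -> `|u * v| <= (2 * t)^-1 * u ^+ 2 + 2^-1 * t * v ^+ 2.
    move=> t0; have := sqr_ge0 (`|u| - t * `|v|); rewrite sqrrB.
    rewrite -[u ^+ 2](real_normK (num_real u)) -[v ^+ 2](real_normK (num_real v)) normrM.
    move: `|u| `|v| => {}u {}v H.
    have : 0 <= (2 * t)^-1 * (u ^+ 2 - u * (t * v) *+ 2 + (t * v) ^+ 2).
      by rewrite mulr_ge0 // invr_ge0 mulr_ge0 // ltW.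
    suff -> : (2 * t)^-1 * (u ^+ 2 - u * (t * v) *+ 2 + (t * v) ^+ 2) =
      (2 * t)^-1 * u ^+ 2 + 2^-1 * t * v ^+ 2 - u * v by lra.
    by field; rewrite gt_eqF.
  have := amgm (a x - a' x) (b x) e e0; have := amgm (b x - b' x) (a x) e e0.
  have := amgm (a x - a' x) (b x - b' x) 1 ltr01; rewrite mulr1 mulr1.
  have -> : a x * b x - a' x * b' x = (a x - a' x) * b x + (b x - b' x) * a x -
    (a x - a' x) * (b x - b' x) by ring.
  have := ler_normD ((a x - a' x) * b x) ((b x - b' x) * a x).
  have := ler_normB ((a x - a' x) * b x + (b x - b' x) * a x)
    ((a x - a' x) * (b x - b' x)).
  by rewrite /k /h; lra.
- exact: summableD.
- rewrite /g RintegralD // RintegralD ?RintegralD ?RintegralZl //; try exact: summableZ.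
  move: pe qe; set P := Rintegral _ _ p; set Q := Rintegral _ _ q => pe qe.
  set A := Rintegral _ _ _; set B := Rintegral _ _ _.
  have A0 : 0 <= A by exact: energy_ge0.
  have B0 : 0 <= B by exact: energy_ge0.
  have H : k * P + k * Q <= k * (2 * e ^+ 2).
    by rewrite -mulrDr ler_pM2l //; lra.
  apply: le_trans (lerD H (lexx _)) _.
  have -> : k * (2 * e ^+ 2) = e + e ^+ 2 by rewrite /k; field; rewrite gt_eqF.
  have : 0 <= e * A by rewrite mulr_ge0 // ltW.
  have : 0 <= e * B by rewrite mulr_ge0 // ltW.
  by rewrite /h; lra.
Qed.

Section MeasurePreserving.
Variable tau : T -> T.
Hypothesis mtau : measurable_fun setT tau.
Hypothesis mu_tau : forall A, measurable A -> mu (tau @^-1` A) = mu A.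

Lemma ge0_integral_tau (f : T -> \bar R) : measurable_fun setT f ->
  (forall x, (0 <= f x)%E) ->
  (\int[mu]_x f (tau x) = \int[mu]_x f x)%E.
Proof.
move=> mf f0; have <- := ge0_integral_pushforward mtau mu measurableT mf (fun x _ => f0 x).
by apply: eq_measure_integral => A mA _; exact: mu_tau.
Qed.

Lemma square_summable_tau a : square_summable a ->
  square_summable (fun x => a (tau x)) /\ energy (fun x => a (tau x)) = energy a.
Proof.
move=> [ma sa]; have m2 : measurable_fun setT (fun x => (a x ^+ 2)%:E).
  by apply/measurable_EFinP; exact: measurable_funX.
have E := ge0_integral_tau m2 (fun x => sqr_ge0 (a x)).
split; last by rewrite /energy /Rintegral E.
have matau : measurable_fun setT (fun x => a (tau x)) by exact: measurableT_comp.
split=> //; apply/integrableP; split.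
  by apply/measurable_EFinP; exact: measurable_funX.
move/integrableP : sa => [_]; rewrite (eq_integral (fun x => (a x ^+ 2)%:E)).
  rewrite -E; congr (_ < _)%E; apply: eq_integral => x _ /=.
  by rewrite ger0_norm // sqr_ge0.
by move=> x _ /=; rewrite ger0_norm // sqr_ge0.
Qed.

End MeasurePreserving.

End SquareIntegrable.

(** * Density of step functions over cosets of compact open subgroups *)

Section StepDensity.
Variables (R : realType) (G : topGroupType).
Hypothesis hG : hausdorff_space G.
Variable mu : {measure set (borel G) -> \bar R}.
Hypothesis mu_haar : left_haar_measure mu.
Implicit Types a b : borel G -> R.

Definition left_coset (L : set G) (x : G) : set (borel G) :=
  [set z : G | L (x^-1 * z)%g].

Definition step (L : set G) (g : borel G -> R) : Prop :=
  exists (I : finType) (c : I -> R) (x : I -> G),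
    g = fun y => \sum_i c i * \1_(left_coset L (x i)) y.

Lemma left_coset_measurable L x : open L -> measurable (left_coset L x).
Proof.
move=> oL; apply: measurable_borel_open; exact: open_preimage_mulgl.
Qed.

Lemma left_coset_fin L x : open L -> compact L -> (mu (left_coset L x) < +oo)%E.
Proof.
move=> oL cL; rewrite (@haar_mulgl _ _ _ mu_haar x^-1%g L); last exact: measurable_borel_open.
exact: haar_compact_fin.
Qed.

Lemma square_summable0 : square_summable mu (fun=> 0).
Proof.
have [+ _] := square_summable_indic (measurable0 : measurable (set0 : set (borel G)))
  (eq_ind_r (fun y => (y < +oo)%E) (ltry 0) (measure0 mu)).
by rewrite indic0.
Qed.

Lemma square_summable_sum (I : Type) (r : seq I) (F : I -> borel G -> R) :
  (forall i, square_summable mu (F i)) ->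
  square_summable mu (fun x => \sum_(i <- r) F i x).
Proof.
move=> sF; elim: r => [|i r IH].
  rewrite (_ : (fun _ => _) = fun=> 0); first exact: square_summable0.
  by apply/funext => x; rewrite big_nil.
rewrite (_ : (fun _ => _) = fun x => F i x + \sum_(j <- r) F j x).
  by have [] := square_summableD (sF i) IH.
by apply/funext => x; rewrite big_cons.
Qed.

Lemma step_square_summable L g : open L -> compact L -> step L g ->
  square_summable mu g.
Proof.
move=> oL cL [I [c [x ->]]]; apply: square_summable_sum => i.
have [s1 _] := square_summable_indic (left_coset_measurable (x i) oL) (left_coset_fin (x i) oL cL).
by have [] := square_summableZ (c i) s1.
Qed.

Lemma step0 L : step L (fun=> 0).
Proof.
by exists void, (fun=> 0), (fun=> 1%g); apply/funext => y; rewrite big1 // => -[].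
Qed.

Lemma stepD L g h : step L g -> step L h -> step L (fun y => g y + h y).
Proof.
move=> [I [c [x ->]]] [J [c' [x' ->]]].
exists (I + J)%type, (fun k => match k with inl i => c i | inr j => c' j end),
  (fun k => match k with inl i => x i | inr j => x' j end).
by apply/funext => y; rewrite big_sumType.
Qed.

Lemma stepZ L (k : R) g : step L g -> step L (fun y => k * g y).
Proof.
move=> [I [c [x ->]]]; exists I, (fun i => k * c i), x.
by apply/funext => y; rewrite mulr_sumr; apply: eq_bigr => i _; rewrite mulrA.
Qed.

(* Step functions over every small enough [L], so that finitely many
   approximations can be made over the same [L]. *)
Definition step_approximable a : Prop := forall e : R, 0 < e ->
  exists2 V : set G, nbhs 1%g V & forall L, compact_open_subgroup L -> L `<=` V ->
    exists2 g, step L g & energy mu (fun x => a x - g x) < e.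

Lemma step_approximable0 : step_approximable (fun=> 0).
Proof.
move=> e e0; exists setT => [|L _ _]; first exact: filterT.
exists (fun=> 0); first exact: step0.
rewrite /energy (_ : (fun _ => _) = cst 0); first by rewrite Rintegral_cst // mul0r.
by apply/funext => x; rewrite subrr expr0n.
Qed.

Lemma step_approximableD a b : square_summable mu a -> square_summable mu b ->
  step_approximable a -> step_approximable b -> step_approximable (fun x => a x + b x).
Proof.
move=> sa sb pa pb e e0; have e4 : 0 < e / 4 by rewrite divr_gt0.
have [V V1 VP] := pa _ e4; have [W W1 WP] := pb _ e4.
exists (V `&` W) => [|L coL LVW]; first exact: filterI.
have [_ oL cL] := coL.
have [g sg ag] := VP L coL (fun x Lx => (LVW x Lx).1).
have [h sh bh] := WP L coL (fun x Lx => (LVW x Lx).2).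
exists (fun x => g x + h x); first exact: stepD.
have sag := square_summableB sa (step_square_summable oL cL sg).
have sbh := square_summableB sb (step_square_summable oL cL sh).
have [_] := square_summableD sag sbh.
rewrite (_ : (fun x => a x - g x + _) = fun x => a x + b x - (g x + h x)).
  by move: ag bh; lra.
by apply/funext => x; rewrite opprD addrACA.
Qed.

Lemma step_approximableZ (k : R) a : square_summable mu a ->
  step_approximable a -> step_approximable (fun x => k * a x).
Proof.
move=> sa pa e e0; have k1 : 0 < k ^+ 2 + 1 by rewrite ltr_wpDl // sqr_ge0.
have [V V1 VP] := pa (e / (k ^+ 2 + 1)) (divr_gt0 e0 k1).
exists V => // L coL LV; have [_ oL cL] := coL; have [g sg ag] := VP L coL LV.
exists (fun x => k * g x); first exact: stepZ.
have sag := square_summableB sa (step_square_summable oL cL sg).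
have [_] := square_summableZ k sag; rewrite (_ : (fun x => k * _) = fun x => k * a x - k * g x).
  move=> ->; move: ag; rewrite ltr_pdivlMr // mulrDr mulr1 mulrC.
  by have := energy_ge0 mu (fun x => a x - g x); lra.
by apply/funext => x; rewrite mulrBr.
Qed.

Lemma step_approximable_limit a : square_summable mu a ->
  (forall e : R, 0 < e -> exists b, [/\ square_summable mu b, step_approximable b &
    energy mu (fun x => a x - b x) < e]) -> step_approximable a.
Proof.
move=> sa lim e e0; have e4 : 0 < e / 4 by rewrite divr_gt0.
have [b [sb pb ab]] := lim _ e4; have [V V1 VP] := pb _ e4.
exists V => // L coL LV; have [_ oL cL] := coL; have [g sg bg] := VP L coL LV.
exists g => //; have sg' := step_square_summable oL cL sg.
have [_] := square_summableD (square_summableB sa sb) (square_summableB sb sg').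
rewrite (_ : (fun x => a x - b x + _) = fun x => a x - g x); first by move: ab bg; lra.
by apply/funext => x; rewrite subrKA.
Qed.

(** Outer regularity gives an open [U] around [A], inner regularity a compact [K] in [U] (not
    necessarily in [A]), each within [e / 2] in measure. The cosets of [L] through [K] form a set
    [B] between [K] and [U]. *)
Lemma step_approximable_indic (A : set (borel G)) : measurable A ->
  (mu A < +oo)%E -> step_approximable \1_A.
Proof.
move=> mA Ay e e0; have e2 : 0 < e / 2 by rewrite divr_gt0.
have [_ _ _ outer inner] := mu_haar.
have muA : mu A = (fine (mu A))%:E by rewrite fineK // ge0_fin_numE.
have [U oU [AU UA]] : exists2 U : set G, open U & A `<=` U /\ (mu U < mu A + (e / 2)%:E)%E.
  have [|_ [U [oU AU] <-] UA] := @lb_ereal_inf_adherent _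
      [set mu U | U in [set U : set G | open U /\ A `<=` U]] _ e2.
    by rewrite -(outer A mA) ge0_fin_numE.
  by exists U => //; split=> //; rewrite (outer A mA).
have Uy : (mu U < +oo)%E by apply: lt_trans UA _; rewrite muA -EFinD ltry.
have muU : mu U = (fine (mu U))%:E by rewrite fineK // ge0_fin_numE.
have [K [cK KU] UK] : exists2 K : set G, compact K /\ K `<=` U &
    (mu U - (e / 2)%:E < mu K)%E.
  have [|_ [K [cK KU] <-] UK] := @ub_ereal_sup_adherent _
      [set mu K | K in [set K : set G | compact K /\ K `<=` U]] _ e2.
    by rewrite -(inner U oU) ge0_fin_numE.
  by exists K => //; rewrite (inner U oU).
have Ky := haar_compact_fin mu_haar cK.
have muK : mu K = (fine (mu K))%:E by rewrite fineK // ge0_fin_numE.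
(* For [L] inside this neighbourhood, the cosets [k L] with [k] in [K] stay in [U]. *)
exists [set v | forall k, K k -> U (k * v)%g].
  apply: (near_compact cK) => k Kk; apply: (@mulg_continuous G (k, 1%g)) => /=.
  by rewrite mulg1; apply: open_nbhs_nbhs; split=> //; exact: KU.
move=> L [[L1 LM LV] oL cL] LU.
have [n [x [xK xcover xinj]]] := coset_representatives (And3 L1 LM LV) oL cK.
pose B := [set y : borel G | exists i, left_coset L (x i) y].
have gE y : \sum_i 1 * \1_(left_coset L (x i)) y = \1_B y :> R.
  have [[i xiy]|nB] := pselect (B y).
    rewrite (bigD1 i) //= mul1r !indicE mem_set // mem_set; last by exists i.
    rewrite big1 ?addr0 // => j ji; rewrite mul1r indicE memNset // => xjy.
    move/eqP: ji; apply; apply: xinj.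
    rewrite (_ : _ * _ = ((x j)^-1 * y) * ((x i)^-1 * y)^-1)%g; first by apply: LM => //; exact: LV.
    by rewrite invgM invgK mulgA mulgK.
  rewrite big1 ?indicE ?memNset // => i _; rewrite indicE memNset ?mulr0 // => xiy.
  by apply: nB; exists i.
exists \1_B; first by exists 'I_n, (fun=> 1), x; apply/funext => y; rewrite gE.
have mU := measurable_borel_open oU; have mK := measurable_borel_compact hG cK.
have [sA IA] := summable_indic mA Ay; have [sU IU] := summable_indic mU Uy.
have [sK IK] := summable_indic mK Ky.
have mB : measurable B.
  apply: measurable_borel_open.
  rewrite (_ : B = \bigcup_i left_coset L (x i)).
    apply: bigcup_open => i _; exact: open_preimage_mulgl.
  by apply/seteqP; split=> y [k]; exists k.
(* It dominates the square of [\1_A - \1_B], and its integral is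
   [(mu U - mu A) + (mu U - mu K) < e]. *)
pose b (y : borel G) : R := ((\1_U y : R) + (\1_U y : R)) - ((\1_A y : R) + (\1_K y : R)).
have sb : summable mu b.
  rewrite (_ : b = fun y => (\1_U y + \1_U y) + (-1) * (\1_A y + \1_K y)).
    by apply: summableD; [exact: summableD|apply: summableZ; exact: summableD].
  by apply/funext => y; rewrite mulN1r.
have [| | |_] := @square_summable_le _ _ _ mu (fun y => \1_A y - \1_B y) b.
- by apply: measurable_funB; exact: measurable_indic.
- move=> y; rewrite /b !indicE.
  have KB : K y -> B y by move=> /xcover[k]; exists k.
  have BU : B y -> U y.
    by move=> [i xiy]; rewrite -(mulVKg (x i) y); apply: (LU _ xiy).
  have [Ayy|nAy] := pselect (A y).
    rewrite (mem_set Ayy) (mem_set (AU _ Ayy)) /=.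
    have [Kyy|nK] := pselect (K y).
      by rewrite (mem_set Kyy) (mem_set (KB Kyy)) /=; lra.
    by rewrite (memNset nK); case: (_ \in _) => /=; lra.
  rewrite (memNset nAy); have [By|nB] := pselect (B y).
    by rewrite (mem_set By) (mem_set (BU By)); case: (_ \in _) => /=; lra.
  have nK : ~ K y by move/KB.
  by rewrite (memNset nB) (memNset nK); case: (_ \in _) => /=; lra.
- exact: sb.
- move/le_lt_trans; apply; rewrite /b RintegralB //; try exact: summableD.
  rewrite !RintegralD // IA IU IK.
  move: UA; rewrite muA muU -EFinD lte_fin.
  by move: UK; rewrite muU muK -EFinB lte_fin; lra.
Qed.

(** Simple functions below [a] converge to it in energy by dominated convergence, the squared error
    being at most [a ^+ 2]; this leaves their level sets. *)
Lemma step_approximable_nonneg a : square_summable mu a -> (forall x, 0 <= a x) ->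
  step_approximable a.
Proof.
move=> sa a0; apply: step_approximable_limit => // e e0.
have [ma s2a] := sa.
have mEa : measurable_fun setT (EFin \o a) by exact/measurable_EFinP.
pose f := nnsfun_approx measurableT mEa.
have fa n x : f n x <= a x.
  by rewrite -lee_fin nnsfun_approxE le_approx // => y _; rewrite lee_fin.
have f0 n x : 0 <= f n x by exact: fun_ge0.
have cf x : f n x @[n --> \oo] --> a x.
  have := cvg_nnsfun_approx measurableT mEa (x := x) (fun y _ => a0 y) I.
  by move/fine_cvgP => [].
have mf n : measurable_fun setT (f n : borel G -> R) by exact: measurable_funPT.
have mD n : measurable_fun setT (fun x => (a x - f n x) ^+ 2).
  by apply: measurable_funX; exact: measurable_funB.
have bound n x : (a x - f n x) ^+ 2 <= a x ^+ 2.
  by have := fa n x; have := f0 n x; nra.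
have [] := @dominated_convergence _ _ _ mu setT measurableT
   (fun n x => ((a x - f n x) ^+ 2)%:E) (cst 0%E) (EFin \o (fun x => a x ^+ 2)).
- by move=> n; exact/measurable_EFinP.
- exact: measurable_cst.
- apply/aeW => x _; apply: cvg_EFin; first by near=> n.
  have c1 : (a x - f n x) @[n --> \oo] --> (0 : R).
    by rewrite -(subrr (a x)); apply: (@cvgB R R^o) => //; exact: cvg_cst.
  have := @cvgM R _ _ _ _ _ _ _ c1 c1; rewrite mulr0; exact.
- exact: s2a.
- by apply/aeW => x n _; rewrite /= ger0_norm ?sqr_ge0 // lee_fin.
move=> _ + _; move/fine_cvgP => [_ /cvgrPdist_lt /(_ _ e0)] [n _ /(_ n (leqnn n))].
rewrite /= sub0r normrN => en.
have sfn : square_summable mu (f n).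
  have [] // := @square_summable_le _ _ _ mu (f n) (fun x => a x ^+ 2).
  by move=> x; have := fa n x; have := f0 n x; nra.
exists (f n); split=> //; last first.
  apply: le_lt_trans en; rewrite /energy /Rintegral.
  rewrite (eq_integral (fun x => `|((a x - f n x) ^+ 2)%:E - 0|%E)) ?ler_norm //.
  by move=> x _; rewrite sube0 /= ger0_norm // sqr_ge0.
have fE : (f n : borel G -> R) =
    fun x => \sum_(y \in range (f n)) y * \1_(f n @^-1` [set y]) x.
  by apply/funext => x; exact: fimfunE.
have rf : finite_set (range (f n)) by exact: fimfunP.
have level y : square_summable mu (fun x => y * \1_(f n @^-1` [set y]) x) /\
    step_approximable (fun x => y * \1_(f n @^-1` [set y]) x).
  have mA : measurable (f n @^-1` [set y]) by exact: measurable_funPTI.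
  (* The level 0 may have infinite measure, but its coefficient is 0. A level [y != 0] has finite
     measure because its indicator is at most [y ^- 2 * f n x ^+ 2]. *)
  have [->|y0] := eqVneq y 0.
    have -> : (fun x : borel G => 0 * \1_(f n @^-1` [set 0]) x) = fun=> 0 :> R.
      by apply/funext => x; rewrite mul0r.
    by split; [exact: square_summable0|exact: step_approximable0].
  have Ay : (mu (f n @^-1` [set y]) < +oo)%E.
    have [_ s1] : square_summable mu (fun x => \1_(f n @^-1` [set y]) x).
      have [] // := @square_summable_le _ _ _ mu \1_(f n @^-1` [set y])
        (fun x => (y ^- 2) * f n x ^+ 2).
      - move=> x; rewrite indicE; case: (boolP (x \in _)) => xA /=.
          move: xA; rewrite inE /= => ->.
          by rewrite expr1n mulVf // expf_neq0.
        by rewrite expr0n mulr_ge0 ?invr_ge0 ?sqr_ge0.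
      - by apply: summableZ; have [] := sfn.
    move/integrableP : s1 => [_]; rewrite (eq_integral (fun x => (\1_(f n @^-1` [set y]) x)%:E)).
      by rewrite integral_indic // setIT.
    by move=> x _ /=; rewrite indicE; case: (_ \in _); rewrite /= ?expr1n ?expr0n /= ?normr1 ?normr0.
  have [s1 _] := square_summable_indic mA Ay.
  have [sy _] := square_summableZ y s1; split=> //.
  by apply: step_approximableZ => //; exact: step_approximable_indic.
suff : square_summable mu (f n) /\ step_approximable (f n) by case.
rewrite fE; under eq_fun do rewrite fsbig_finite //=.
elim: (finmap.enum_fset _) => [|y s [ss ps]].
  have -> : (fun x : borel G => \sum_(y <- [::]) y * \1_(f n @^-1` [set y]) x) = fun=> 0 :> R.
    by apply/funext => x; rewrite big_nil.
  by split; [exact: square_summable0|exact: step_approximable0].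
under eq_fun do rewrite big_cons.
have [sy py] := level y; split; first by have [] := square_summableD sy ss.
exact: step_approximableD.
Unshelve. all: by end_near. Qed.

Lemma square_summable_step_approximable a : square_summable mu a -> step_approximable a.
Proof.
move=> sa; have [ma s2a] := sa.
have key b : measurable_fun setT b -> (forall x, `|b x| <= `|a x|) -> square_summable mu b.
  move=> mb ba; have [] // := @square_summable_le _ _ _ mu b (fun x => a x ^+ 2).
  move=> x; rewrite -[b x ^+ 2]real_normK ?num_real // -[a x ^+ 2]real_normK ?num_real //.
  by rewrite ler_pXn2r ?nnegrE.
have sp : square_summable mu (fun x => Num.max (a x) 0).
  apply: key => [|x]; first exact: measurable_maxr.
  by rewrite /Num.max; case: ifP; rewrite ?normr0.
have sn : square_summable mu (fun x => Num.max (- a x) 0).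
  apply: key => [|x]; first by apply: measurable_maxr => //; exact: measurableT_comp.
  by rewrite /Num.max; case: ifP; rewrite ?normr0 ?normrN.
have [sNn _] := square_summableZ (-1) sn.
have : step_approximable (fun x => Num.max (a x) 0 + (-1) * Num.max (- a x) 0).
  apply: step_approximableD => //.
    by apply: step_approximable_nonneg => // x; rewrite le_max lexx orbT.
  apply: step_approximableZ => //.
  by apply: step_approximable_nonneg => // x; rewrite le_max lexx orbT.
congr step_approximable; apply/funext => x; rewrite mulN1r.
have [a0|a0] := leP 0 (a x); first by rewrite max_r ?subr0 // oppr_le0.
by rewrite max_l ?sub0r ?opprK // oppr_ge0 ltW.
Qed.

End StepDensity.

(** * Coefficients of the left-right regular representation *)

Section SquareIntegrableCoefficients.
Variables (R : realType) (G : topGroupType).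
Hypothesis hG : hausdorff_space G.
Variable mu : {measure set (borel G) -> \bar R}.
Hypothesis mu_haar : left_haar_measure mu.

Lemma L2_square_summable (h : G -> R[i]) : L2 mu h ->
  square_summable mu (fun x : borel G => complex.Re (h x)) /\
  square_summable mu (fun x : borel G => complex.Im (h x)).
Proof.
move=> [mRe mIm hfin].
have m2 : measurable_fun setT
    (fun x : borel G => complex.Re (h x) ^+ 2 + complex.Im (h x) ^+ 2).
  by apply: measurable_funD; exact: measurable_funX.
have s2 : summable mu (fun x : borel G => complex.Re (h x) ^+ 2 + complex.Im (h x) ^+ 2).
  apply/integrableP; split; first exact/measurable_EFinP.
  apply: le_lt_trans hfin; rewrite le_eqVlt; apply/orP; left; apply/eqP.
  apply: eq_integral => x _ /=; rewrite ger0_norm // addr_ge0 ?sqr_ge0 //.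
have le1 x : complex.Re (h x) ^+ 2 <= complex.Re (h x) ^+ 2 + complex.Im (h x) ^+ 2.
  by rewrite lerDl sqr_ge0.
have le2 x : complex.Im (h x) ^+ 2 <= complex.Re (h x) ^+ 2 + complex.Im (h x) ^+ 2.
  by rewrite lerDr sqr_ge0.
by have [s1 _] := square_summable_le mRe le1 s2; have [] := square_summable_le mIm le2 s2.
Qed.

Variable Delta : G -> R.
Hypothesis Delta_modular : modular_function mu Delta.
Hypothesis Delta1 : forall t, Delta t = 1.

Lemma haar_translation (s t : G) (A : set (borel G)) : measurable A ->
  mu [set x | A (s * x * t)%g] = mu A.
Proof.
move=> mA; have mAt : measurable ([set x | A (x * t)%g] : set (borel G)).
  have := @measurable_fun_translation G 1%g t measurableT A mA.
  by rewrite setTI; congr measurable; apply/seteqP; split=> x /=; rewrite mul1g.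
rewrite -[RHS]mul1e -(Delta1 t^-1%g); have [_ <- //] := Delta_modular t^-1%g.
rewrite image_mulgr invgK -[RHS](haar_mulgl mu_haar s) //.
Qed.

(** Splits the hermitian form into real bilinear integrals, to which the real L^2 estimates
    apply. *)
Lemma left_right_coefE (h : G -> R[i]) (s t : G) : L2 mu h ->
  let B u v := Rintegral mu setT (fun x : borel G => u (s^-1 * x * t)%g * v x) in
  let a x := complex.Re (h x) in let b x := complex.Im (h x) in
  left_right_coef mu Delta h (s, t) = Complex (B a a + B b b) (B b a - B a b).
Proof.
move=> /L2_square_summable[sa sb] B a b.
have tauA A : measurable A ->
    mu ((fun x : borel G => s^-1 * x * t : borel G)%g @^-1` A) = mu A.
  exact: haar_translation.
have mt := @measurable_fun_translation G s^-1%g t.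
have [sat _] := square_summable_tau mt tauA sa.
have [sbt _] := square_summable_tau mt tauA sb.
have E x : left_right Delta s t h x = h (s^-1 * x * t)%g.
  by rewrite /left_right Delta1 sqrtr1 mulr1.
rewrite /left_right_coef /cintegral /=; congr Complex.
  rewrite /B -RintegralD //; try exact: square_summable_mul.
  by apply: eq_Rintegral => x _; rewrite E conjCE ReM /=; rewrite mulrN opprK.
rewrite /B -RintegralB //; try exact: square_summable_mul.
by apply: eq_Rintegral => x _; rewrite E conjCE ImM /= mulrN addrC.
Qed.

(** The bound does not depend on [s] and [t] because translations preserve [energy]; the factor 4
    counts the bilinear terms in the real and imaginary parts. *)
Lemma left_right_coef_close (h : G -> R[i]) (a b : borel G -> R) (e : R) (s t : G) :
  L2 mu h -> square_summable mu a -> square_summable mu b -> 0 < e ->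
  let B u v := Rintegral mu setT (fun x : borel G => u (s^-1 * x * t)%g * v x) in
  let E := energy mu (fun x : borel G => complex.Re (h x)) +
    energy mu (fun x : borel G => complex.Im (h x)) in
  energy mu (fun x : borel G => complex.Re (h x) - a x) <= e ^+ 2 ->
  energy mu (fun x : borel G => complex.Im (h x) - b x) <= e ^+ 2 ->
  cabs (left_right_coef mu Delta h (s, t) -
    Complex (B a a + B b b) (B b a - B a b)) <= 4 * (e * (1 + 2 * E + e)).
Proof.
move=> Lh sa sb e0 B E ae be; have [sRe sIm] := L2_square_summable Lh.
rewrite (left_right_coefE s t Lh) -/B.
have tauA A : measurable A ->
    mu ((fun x : borel G => s^-1 * x * t : borel G)%g @^-1` A) = mu A.
  exact: haar_translation.
have mt := @measurable_fun_translation G s^-1%g t.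
have E1 := energy_ge0 mu (fun x : borel G => complex.Re (h x)).
have E2 := energy_ge0 mu (fun x : borel G => complex.Im (h x)).
have close u u' v v' : square_summable mu u -> square_summable mu u' ->
    square_summable mu v -> square_summable mu v' ->
    energy mu (fun x => u x - u' x) <= e ^+ 2 ->
    energy mu (fun x => v x - v' x) <= e ^+ 2 -> energy mu u <= E -> energy mu v <= E ->
    `|B u v - B u' v'| <= e * (1 + 2 * E + e).
  move=> su su' sv sv' ue ve uE vE.
  have [sut Eut] := square_summable_tau mt tauA su.
  have [sut' _] := square_summable_tau mt tauA su'.
  have [_ Euut] := square_summable_tau mt tauA (square_summableB su su').
  rewrite -Euut in ue.
  have := Rintegral_mul_close e0 sut sut' sv sv' ue ve; rewrite Eut => H.
  by apply: le_trans H _; rewrite ler_pM2l //; lra.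
have normC (x y : R) : cabs (Complex x y) <= `|x| + `|y|.
  rewrite -(@ler_pXn2r _ 2) ?nnegrE ?cabs_ge0 ?addr_ge0 // cabs_sqr /=.
  rewrite -(real_normK (num_real x)) -(real_normK (num_real y)).
  by have := normr_ge0 x; have := normr_ge0 y; nra.
have c1 := close _ _ _ _ sRe sa sRe sa ae ae; have c2 := close _ _ _ _ sIm sb sIm sb be be.
have c3 := close _ _ _ _ sIm sb sRe sa be ae; have c4 := close _ _ _ _ sRe sa sIm sb ae be.
have {}E1 : energy mu (fun x : borel G => complex.Im (h x)) <= E by rewrite /E lerDr.
have {}E2 : energy mu (fun x : borel G => complex.Re (h x)) <= E by rewrite /E lerDl //; lra.
move: (c1 E2 E2) (c2 E1 E1) (c3 E1 E2) (c4 E2 E1) => {}c1 {}c2 {}c3 {}c4.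
have CB (x y x' y' : R) : Complex x y - Complex x' y' = Complex (x - x') (y - y') by [].
rewrite CB; apply: le_trans (normC _ _) _.
move: c1 c2 c3 c4; set m := e * _; rewrite !ler_norml.
move=> /andP[? ?] /andP[? ?] /andP[? ?] /andP[? ?].
suff : `|B (fun x => complex.Re (h x)) (fun x => complex.Re (h x)) +
    B (fun x => complex.Im (h x)) (fun x => complex.Im (h x)) - (B a a + B b b)| <= 2 * m /\
    `|B (fun x => complex.Im (h x)) (fun x => complex.Re (h x)) -
    B (fun x => complex.Re (h x)) (fun x => complex.Im (h x)) - (B b a - B a b)| <= 2 * m.
  by move=> [? ?]; lra.
by rewrite !ler_norml; split; apply/andP; split; lra.
Qed.

End SquareIntegrableCoefficients.

Section PropertyF.
Variables (R : realType) (G : topGroupType).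
Hypothesis hG : hausdorff_space G.
Hypothesis bG : compact_nbhs_base G.
Hypothesis tdG : totally_disconnected [set: G].
Variable mu : {measure set (borel G) -> \bar R}.
Hypothesis mu_haar : left_haar_measure mu.
Variable varpi : unitary_rep R G.
Hypothesis varpi_universal : is_universal_rep varpi.
Variable varpi2 : unitary_rep R (G * G)%type.
Hypothesis varpi2_tensor : is_outer_tensor varpi varpi varpi2.
Hypothesis sepG : amenably_tracially_separated varpi2.
Variable Delta : G -> R.
Hypothesis Delta_modular : modular_function mu Delta.

Lemma Delta_eq1 t : Delta t = 1.
Proof. exact: (unimodular hG bG tdG mu_haar varpi_universal varpi2_tensor sepG). Qed.

(** The change of variable [z -> x j z] turns the intersection of two translated cosets into an
    overlap at inverted arguments, and [overlapV] removes the inverses. *)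
Lemma step_correlation (L : set G) (I : finType) (x : I -> G) (c c' : I -> R) (s t : G) :
  compact_open_subgroup L ->
  Rintegral mu setT (fun z : borel G =>
    (\sum_i c i * \1_(left_coset L (x i)) (s^-1 * z * t)%g) *
    (\sum_i c' i * \1_(left_coset L (x i)) z)) =
  \sum_i \sum_j c i * c' j * fine (mu (overlap L ((x j)^-1 * s * x i)%g t)).
Proof.
move=> coL; have [_ oL cL] := coL.
pose A i j : set (borel G) := [set z | L ((x i)^-1 * s^-1 * z * t)%g /\ L ((x j)^-1 * z)%g].
have oA i j : open (A i j : set G).
  apply: openI; first exact: open_preimage_mulg.
  exact: open_preimage_mulgl.
have mA i j : measurable (A i j) by exact: measurable_borel_open.
have Ay i j : (mu (A i j) < +oo)%E.
  apply: le_lt_trans (left_coset_fin mu_haar (x j) oL cL).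
  by apply: le_measure; rewrite ?inE //; [exact: left_coset_measurable|move=> z []].
have muA i j : fine (mu (A i j)) = fine (mu (overlap L ((x j)^-1 * s * x i)%g t)).
  rewrite -(overlapV hG bG tdG mu_haar varpi_universal varpi2_tensor sepG) //.
  rewrite -(haar_mulgl mu_haar (x j) (mA i j)); congr (fine (mu _)).
  apply/seteqP; split=> b.
    by move=> [L1 L2]; split; [rewrite mulKg in L2|rewrite !(invgM, invgK) !mulgA in L1 *].
  by move=> [Lb L2]; split; [rewrite !(invgM, invgK) !mulgA in L2 *|rewrite mulKg].
have E : (fun z : borel G =>
    (\sum_i c i * \1_(left_coset L (x i)) (s^-1 * z * t)%g) *
    (\sum_i c' i * \1_(left_coset L (x i)) z)) =
    fun z => \sum_(ij : I * I) (c ij.1 * c' ij.2) * \1_(A ij.1 ij.2) z.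
  apply/funext => z; rewrite big_distrlr /= pair_bigA; apply: eq_bigr => -[i j] _ /=.
  rewrite mulrACA; congr (_ * _); rewrite !indicE -natrM mulnb; congr (_%:R : R).
  congr nat_of_bool; apply/idP/idP.
    by move=> /andP[]; rewrite !inE /left_coset /A /= => H1 H2; split; rewrite ?mulgA in H1 *.
  by rewrite !inE => -[H1 H2]; apply/andP; split; rewrite inE /left_coset /= ?mulgA.
have sA ij := summable_indic (mA ij.1 ij.2) (Ay ij.1 ij.2).
rewrite E (summable_sum _ (fun ij : I * I => summableZ _ (sA ij).1)).2 pair_bigA /=.
by apply: eq_bigr => -[i j] _ /=; rewrite RintegralZl // ?(sA (i, j)).2 ?muA //; exact: (sA (i, j)).1.
Qed.

Lemma step_coef_Pmin (L : set G) (a b : borel G -> R) : compact_open_subgroup L ->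
  step L a -> step L b ->
  let B p u v := Rintegral mu setT (fun x : borel G => u (p.1^-1 * x * p.2)%g * v x) in
  Pmin varpi2 (fun p => Complex (B p a a + B p b b) (B p b a - B p a b)).
Proof.
move=> coL [I [al [x ->]]] [J [be [y ->]]] B.
pose z (k : I + J) := match k with inl i => x i | inr j => y j end.
(* Real coefficients on [I] and purely imaginary ones on [J] make [a + i b] a single complex step
   function with centres [z], to which [Pmin_translate] applies. *)
pose c (k : I + J) : R[i] := match k with inl i => Complex (al i) 0 | inr j => Complex 0 (be j) end.
pose ind k := \1_(left_coset L (z k)) : borel G -> R.
have aE : (fun w : borel G => \sum_i al i * \1_(left_coset L (x i)) w) =
    fun w => \sum_k complex.Re (c k) * ind k w.
  apply/funext => w; rewrite big_sumType /= [X in _ = _ + X]big1 ?addr0 //.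
  by move=> j _; rewrite mul0r.
have bE : (fun w : borel G => \sum_i be i * \1_(left_coset L (y i)) w) =
    fun w => \sum_k complex.Im (c k) * ind k w.
  apply/funext => w; rewrite big_sumType /= [X in _ = X + _]big1 ?add0r //.
  by move=> j _; rewrite mul0r.
have [muL muL0] := haar_compact_open hG mu_haar coL.
have PF := overlap_Pmin hG bG tdG mu_haar varpi_universal varpi2_tensor sepG coL.
have [_ _ PZ _] := Pmin_closed_cone varpi2.
have := @Pmin_translate _ _ varpi2 _ (fun k => (z k, 1%g)) c _ (PZ _ _ (ltW muL0) PF).
congr (Pmin _ _); apply/funext => -[s t]; rewrite aE bE /B /ind /=.
rewrite !(step_correlation z) // -!big_split -sumrB /=.
transitivity (\sum_i \sum_j
  c i * (c j)^* * (fine (mu (overlap L ((z j)^-1 * s * z i)%g t)))%:C).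
  apply: eq_bigr => i _; apply: eq_bigr => j _; congr (_ * _).
  rewrite -rmorphM mulrC mulfVK ?gt_eqF // invg1 mul1g mulg1 //.
have Csum (K : finType) (u v : K -> R) :
    Complex (\sum_k u k) (\sum_k v k) = \sum_k Complex (u k) (v k).
  apply: eqC; first by rewrite /= (big_morph _ (@ReD R) (erefl _)).
  by rewrite /= (big_morph _ (@ImD R) (erefl _)).
rewrite Csum; apply: eq_bigr => i _; rewrite -big_split -sumrB Csum; apply: eq_bigr => j _.
by apply: eqC; rewrite !conjCE !(ReM, ImM) /=; ring.
Qed.

Lemma separated_property_F : property_F mu varpi2 Delta.
Proof.
move=> h Lh; have [sRe sIm] := L2_square_summable Lh.
have [_ _ _ Pap] := Pmin_closed_cone varpi2; apply: Pap => K e cK e0.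
pose E := energy mu (fun x : borel G => complex.Re (h x)) +
  energy mu (fun x : borel G => complex.Im (h x)).
have E0 : 0 <= E by rewrite addr_ge0 ?energy_ge0.
(* As [d <= 1], the error [4 * d + 8 * (d * E) + 4 * (d * d)] is at most [8 * d * (1 + E)], hence at
   most [e / 2]. *)
pose d := Num.min 1 (e / (16 * (1 + E))).
have E1 : 0 < 16 * (1 + E) by rewrite mulr_gt0 // ltr_wpDr.
have d0 : 0 < d by rewrite lt_min ltr01 divr_gt0.
have d20 : 0 < d ^+ 2 by exact: exprn_gt0.
have [V V1 VP] := square_summable_step_approximable hG mu_haar sRe d20.
have [W W1 WP] := square_summable_step_approximable hG mu_haar sIm d20.
have [L coL LVW] := van_dantzig hG bG tdG (filterI V1 W1).
have [_ oL cL] := coL.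
have [a sa /ltW ha] := VP L coL (fun x Lx => (LVW x Lx).1).
have [b sb /ltW hb] := WP L coL (fun x Lx => (LVW x Lx).2).
have ssa := step_square_summable mu_haar oL cL sa.
have ssb := step_square_summable mu_haar oL cL sb.
have Pg := step_coef_Pmin coL sa sb.
exists (fun p => let B u v := Rintegral mu setT
    (fun x : borel G => u (p.1^-1 * x * p.2)%g * v x) in
  Complex (B a a + B b b) (B b a - B a b)) => [|[s t] _]; first exact: Pg.
have := left_right_coef_close mu_haar Delta_modular Delta_eq1 s t Lh ssa ssb d0 ha hb.
move=> /le_lt_trans; apply; rewrite -/E.
have : d <= 1 by rewrite ge_min lexx.
have : d <= e / (16 * (1 + E)) by rewrite ge_min lexx orbT.
rewrite ler_pdivlMr // => H1 H2.
have dE : 0 <= d * E by rewrite mulr_ge0 // ltW.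
have dd : d * d <= d * 1 by rewrite ler_pM2l.
have -> : 4 * (d * (1 + 2 * E + d)) = 4 * d + 8 * (d * E) + 4 * (d * d) by ring.
have H3 : 16 * d + 16 * (d * E) <= e.
  by apply: le_trans H1; rewrite le_eqVlt; apply/orP; left; apply/eqP; ring.
by move: H3 dd dE; set y := d * E; set w := d * d; lra.
Qed.

End PropertyF.

(** * Traces from conjugation-invariant neighbourhoods *)

Section InvariantNeighbourhoods.
Variables (R : realType) (G : topGroupType).
Hypothesis hG : hausdorff_space G.
Hypothesis bG : compact_nbhs_base G.
Variable mu : {measure set (borel G) -> \bar R}.
Hypothesis mu_haar : left_haar_measure mu.
Variable Delta : G -> R.
Hypothesis Delta_modular : modular_function mu Delta.
Variable V : set G.
Hypothesis oV : open V.
Hypothesis V1 : V 1%g.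
Hypothesis invV : forall s x, V x -> V (s * x * s^-1)%g.
Hypothesis Vfin : (mu V < +oo)%E.

Lemma invariantE s x : V (s * x * s^-1)%g <-> V x.
Proof.
split; last exact: invV; move=> /(invV s^-1%g).
by rewrite invgK !mulgA mulVg mul1g mulgVK.
Qed.

Lemma invariant_measure : mu V = (fine (mu V))%:E /\ 0 < fine (mu V).
Proof.
have V0 : (0 < mu V)%E by apply: haar_open_gt0 => //; exists 1%g.
by split; [rewrite fineK // ge0_fin_numE // ltW|rewrite fine_gt0 // V0].
Qed.

(** Invariance gives [V t = t V], so left invariance fixes the measure of [V t]; that measure is
    finite and nonzero. *)
Lemma invariant_unimodular t : Delta t = 1.
Proof.
have [muV muV0] := invariant_measure; have mV := measurable_borel_open oV.
have [_ /(_ V mV)] := Delta_modular t.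
have -> : mu [set (x * t)%g | x in V] = mu V.
  rewrite image_mulgr -[RHS](haar_mulgl mu_haar t^-1%g mV); congr (mu _).
  apply/seteqP; split=> x /=; rewrite -(invariantE t (t^-1 * x)%g) mulVKg //.
rewrite muV -EFinM => H0; have H := EFin_inj H0.
by apply: (mulIf (lt0r_neq0 muV0)); rewrite mul1r.
Qed.

(** This is [s V /\ V]. *)
Definition displacement (s : G) : set (borel G) := [set x : G | V (s^-1 * x)%g /\ V x].

Definition invariant_trace (s : G) : R[i] := (fine (mu (displacement s)) / fine (mu V))%:C.

Lemma displacement_measurable s : measurable (displacement s).
Proof.
apply: measurable_borel_open; apply: openI => //.
exact: open_preimage_mulgl.
Qed.

Lemma displacement_fin s : (mu (displacement s) < +oo)%E.
Proof.
apply: le_lt_trans Vfin; apply: le_measure; rewrite ?inE.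
- exact: displacement_measurable.
- exact: measurable_borel_open.
- by move=> x [].
Qed.

Definition invariant_vector (x : G) : R[i] :=
  ((Num.sqrt (fine (mu V)))^-1 * \1_V x)%:C.

Lemma invariant_vector_L2 : L2 mu invariant_vector.
Proof.
have mV := measurable_borel_open oV.
have [s1 _] := square_summable_indic mV Vfin.
have [[m2 s2] _] := square_summableZ (Num.sqrt (fine (mu V)))^-1 s1.
split=> //=.
move/integrableP : s2 => [_]; congr (_ < _)%E; apply: eq_integral => x _ /=.
by rewrite expr0n addr0 ger0_norm // sqr_ge0.
Qed.

(** Conjugation by [t] shows that [s^-1 x t] is in [V] exactly when [t s^-1 x] is, so the two
    translations merge into the displacement by [s t^-1]. *)
Lemma invariant_vector_coef p :
  left_right_coef mu Delta invariant_vector p = invariant_trace (p.1 * p.2^-1)%g.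
Proof.
case: p => s t /=; have [muV muV0] := invariant_measure.
have mD := displacement_measurable (s * t^-1)%g.
have Dy := displacement_fin (s * t^-1)%g.
have [sD ID] := summable_indic mD Dy.
pose k := (Num.sqrt (fine (mu V)))^-1.
have kk : k * k = (fine (mu V))^-1 by rewrite -invfM -expr2 sqr_sqrtr // ltW.
have E x : left_right Delta s t invariant_vector x * (invariant_vector x)^* =
    ((fine (mu V))^-1 * \1_(displacement (s * t^-1)%g) x)%:C.
  rewrite /left_right invariant_unimodular sqrtr1 mulr1 /invariant_vector.
  rewrite [X in _ * X]conjC_real -rmorphM -/k mulrACA kk; congr ((_ * _)%:C).
  rewrite !indicE -natrM mulnb; congr (_%:R); congr nat_of_bool.
  have st : V (s^-1 * x * t)%g <-> V ((s * t^-1)^-1 * x)%g.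
    rewrite -(invariantE t (s^-1 * x * t)%g) invgM invgK !mulgA mulgK.
    by [].
  apply/idP/idP; rewrite !inE.
    by move=> /andP[]; rewrite !inE => /st ? ?.
  by move=> [/st ? ?]; apply/andP; rewrite !inE.
rewrite /left_right_coef /= (funext E) /cintegral; apply: eqC => /=.
  by rewrite RintegralZl // ID mulrC.
by rewrite (_ : (fun _ => 0) = cst 0) // Rintegral_cst // mul0r.
Qed.

(** Continuity and positive definiteness are not computed from the measure: they are inherited from
    membership in [Pmin] and restricted to the pairs [(s, 1)]. *)
Lemma invariant_trace_amenable (varpi2 : unitary_rep R (G * G)%type) :
  property_F mu varpi2 Delta -> amenable_trace varpi2 invariant_trace.
Proof.
move=> /(_ _ invariant_vector_L2).
rewrite (_ : left_right_coef _ _ _ = fun p => invariant_trace (p.1 * p.2^-1)%g); last first.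
  by apply/funext => p; exact: invariant_vector_coef.
move=> PF; have [muV muV0] := invariant_measure.
have cF : continuous ((fun p => invariant_trace (p.1 * p.2^-1)%g) : G * G -> R[i]^o).
  have cone := @closed_cone_continuous R (G * G)%type (compact_nbhs_base_prod bG bG).
  have coefc (xi : rep_space varpi2) : continuous (rep_coef xi : _ -> R[i]^o).
    exact: coef_continuous.
  have PC := Pmin_ind cone coefc. exact: PC PF.
have pF := Pmin_ind (@closed_cone_pd R (G * G)%type) (@coef_pd _ _ varpi2) PF.
split=> //; split; [split|].
- move=> s; have -> : invariant_trace =
      (fun p : G * G => invariant_trace (p.1 * p.2^-1)%g) \o (fun x => (x, 1%g)).
    by apply/funext => x /=; rewrite invg1 mulg1.
  by apply: continuous_comp; [apply: cvg_pair; [exact: cvg_id|exact: cvg_cst]|exact: cF].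
- move=> n s c; have := pF n (fun i => (s i, 1%g)) c; congr (0 <= _).
  apply: eq_bigr => i _; apply: eq_bigr => j _ /=; congr (_ * invariant_trace _).
  by rewrite !(invg1, mulg1).
- rewrite /invariant_trace (_ : displacement 1%g = V) ?divff ?gt_eqF //.
  by apply/seteqP; split=> x; [case|move=> Vx; split=> //; rewrite invg1 mul1g].
(* Conjugation by [t] preserves [V] and the measure, and carries the displacement by [s * t] to that
   by [t * s]. *)
- move=> s t; rewrite /invariant_trace; congr ((fine _ / _)%:C).
  rewrite -(haar_translation mu_haar Delta_modular invariant_unimodular t t^-1%g
    (displacement_measurable (t * s)%g)); congr (mu _).
  have st x : V ((s * t)^-1 * x)%g <-> V ((t * s)^-1 * (t * x * t^-1))%g.
    rewrite -(invariantE t ((s * t)^-1 * x)%g).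
    by rewrite !invgM !mulgA mulgV mul1g mulgVK.
  apply/seteqP; split=> x [Vstx Vx].
    by split; [exact: (st x).1|exact: invV].
  by split; [exact: (st x).2|exact: (invariantE t x).1].
Qed.

Lemma invariant_trace_eq0 s : (forall x y, V x -> V y -> x <> (s * y)%g) ->
  invariant_trace s = 0.
Proof.
move=> sV; rewrite /invariant_trace (_ : displacement s = set0).
  by rewrite measure0 mul0r.
apply/seteqP; split=> // x [Vsx Vx]; apply: (sV x (s^-1 * x)%g) => //.
by rewrite mulVKg.
Qed.

End InvariantNeighbourhoods.

Section SINSeparation.
Variables (R : realType) (G : topGroupType).
Hypothesis hG : hausdorff_space G.
Hypothesis bG : compact_nbhs_base G.
Variable mu : {measure set (borel G) -> \bar R}.
Hypothesis mu_haar : left_haar_measure mu.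
Variable Delta : G -> R.
Hypothesis Delta_modular : modular_function mu Delta.
Variable varpi2 : unitary_rep R (G * G)%type.

Lemma SIN_property_F_separated : SIN G -> property_F mu varpi2 Delta ->
  amenably_tracially_separated varpi2.
Proof.
move=> sin propF; apply/seteqP; split; last first.
  by move=> _ -> u [[[_ _ u1] _] _].
move=> s sN; apply: contrapT => s1.
have cl1 : closed [set s].
  by apply: accessible_closed_set1; exact: hausdorff_accessible.
have cdiv : continuous (fun p : G * G => (p.1 * p.2^-1)%g).
  apply: continuous_mulg => [?|]; first exact: cvg_fst.
  by apply: continuous_invg => ?; exact: cvg_snd.
(* This yields [A] and [B] with [s] outside [A B^-1], so that any [V] contained in both is disjoint
   from [s V]. *)
have : nbhs (1%g, 1%g) [set p : G * G | (p.1 * p.2^-1)%g <> s].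
  apply: (cdiv (1%g, 1%g) (~` [set s])); apply: open_nbhs_nbhs; split.
    exact: closed_openC.
  by rewrite /= mulgV => s1'; apply: s1.
move=> [[A B] /= [A1 B1] AB].
have [C C1 cC] := bG 1%g.
have [W [W1 WABC invW]] := sin _ (filterI (filterI A1 B1) C1).
(* The invariant neighbourhood [W] need not be open; its interior is still invariant because
   conjugations are homeomorphisms. *)
pose V := W°; have oV : open V by exact: open_interior.
have V1 : V 1%g by [].
have VW : V `<=` W by exact: interior_subset.
have invV t x : V x -> V (t * x * t^-1)%g.
  move=> Vx; have oVt : open [set y | V (t^-1 * y * t)%g] by exact: open_preimage_mulg.
  have sub : [set y | V (t^-1 * y * t)%g] `<=` W.
    by move=> y /= /VW /(invW t); rewrite !mulgA mulgV mul1g mulgK.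
  have nsub : nbhs (t * x * t^-1)%g [set y | V (t^-1 * y * t)%g].
    apply: open_nbhs_nbhs; split=> //=.
    by rewrite !mulgA mulVg mul1g mulgVK.
  exact: filterS sub nsub.
have Vfin : (mu V < +oo)%E.
  apply: le_lt_trans (haar_compact_fin mu_haar cC).
  apply: le_measure; rewrite ?inE; [exact: measurable_borel_open|exact: measurable_borel_compact|].
  by move=> x /VW /WABC[].
have := invariant_trace_amenable hG bG mu_haar Delta_modular oV V1 invV Vfin propF.
move=> /sN /=; rewrite invariant_trace_eq0 => [/eqP|x y Vx Vy xsy].
  by rewrite eq_sym oner_eq0.
have [[Ax _] _] := WABC _ (VW _ Vx); have [[_ By] _] := WABC _ (VW _ Vy).
by apply: (AB (x, y)) => //=; rewrite xsy mulgK.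
Qed.

End SINSeparation.

Theorem theorem5p7 (R : realType) (G : topGroupType)
    (G_lc : locally_compact_group G)
    (mu : {measure set (borel G) -> \bar R}) (mu_haar : left_haar_measure mu)
    (Delta : G -> R) (Delta_modular : modular_function mu Delta)
    (varpi : unitary_rep R G) (varpi_universal : is_universal_rep varpi)
    (varpi2 : unitary_rep R (G * G)%type)
    (varpi2_tensor : is_outer_tensor varpi varpi varpi2) :
  (SIN G -> property_F mu varpi2 Delta -> amenably_tracially_separated varpi2) /\
  (totally_disconnected [set: G] -> amenably_tracially_separated varpi2 ->
     property_F mu varpi2 Delta).
Proof.
have hG := G_lc.1; have bG := locally_compact_compact_nbhs G_lc.
split; first exact: (SIN_property_F_separated hG bG mu_haar Delta_modular).
move=> tdG sepG.
exact: (separated_property_F hG bG tdG mu_haar varpi_universal varpi2_tensor sepG).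
Qed.
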